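(* Let $\mathbf{p}=(p_{12},p_{13},p_{14},p_{23},p_{24},p_{34})$ be a vector of integers such that the class $\eta(\mathbf{p})\in\mathrm{H}_4((\mathbb{P}^1)^4,\mathbb{Z})$ is realizable over $\mathbb{Z}$, and let $\{i,j,k,l\}=\{1,2,3,4\}$. If $p_{ij}>0$, then $$p_{kl}\le p_{ik}p_{jl}+p_{il}p_{jk}.$$
   Context: Varieties are over $\mathbb{C}$; a variety and its subvarieties are reduced and irreducible. We use the convention $p_{ij}=p_{ji}$, and $$\eta(\mathbf{p})=p_{12}[\mathbb{P}^1\times\mathbb{P}^1\times\mathbb{P}^0\times\mathbb{P}^0]+\cdots+p_{34}[\mathbb{P}^0\times\mathbb{P}^0\times\mathbb{P}^1\times\mathbb{P}^1],$$ where $p_{ij}$ ($i<j$) multiplies the class of the product with $\mathbb{P}^1$ in factors $i,j$ and a point in the other two factors. A class $\eta\in\mathrm{H}_{2k}(X,\mathbb{Z})$ on a smooth projective variety $X$ is realizable over $\mathbb{Z}$ if $\eta=[V]$ for some subvariety $V\subseteq X$. *)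

(* Defs.v *)
From HB Require Import structures.
From mathcomp Require Import all_boot all_order all_algebra.
From mathcomp Require Import generic_quotient.
From mathcomp Require Import all_classical all_reals all_analysis.
From mathcomp Require Import complex.
From mathcomp.multinomials Require Import freeg.
(* the notations of mpoly clash with those of MathComp-Analysis *)
From mathcomp.multinomials Require Import -(notations) mpoly.

Set Implicit Arguments.
Unset Strict Implicit.
Unset Printing Implicit Defensive.

Import Order.TTheory GRing.Theory Num.Theory.
Import numFieldNormedType.Exports.

Local Open Scope classical_set_scope.
Local Open Scope ring_scope.

(** * Singular homology with integer coefficients *)

Definition std_simplex (R : realType) (n : nat) : set 'rV[R]_n.+1 :=
  [set x | (forall i, 0 <= x ord0 i) /\ \sum_i x ord0 i = 1].

Notation simplex R n := (set_type (@std_simplex R n)).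

Definition insert0 (R : realType) (n : nat) (j : 'I_n.+2) (x : 'rV[R]_n.+1) :
    'rV[R]_n.+2 :=
  \row_k (if unlift j k is Some i then x ord0 i else 0).

Lemma insert0_simplex (R : realType) (n : nat) (j : 'I_n.+2)
  (x : simplex R n) : insert0 j (set_val x) \in @std_simplex R n.+1.
Proof.
have [x0 x1] := set_valP x; apply/mem_set; split=> [k|].
  by rewrite mxE; case: unlift.
rewrite (bigD1_ord j) //= mxE unlift_none add0r -[RHS]x1.
by apply: eq_bigr => i _; rewrite mxE liftK.
Qed.

Definition coface (R : realType) (n : nat) (j : 'I_n.+2) (x : simplex R n) :
  simplex R n.+1 :=
  exist (fun y => y \in @std_simplex R n.+1) _ (insert0_simplex j x).

(* The free abelian group on all maps from the simplex to [T]; the singular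
   chains of a subspace [A] are its elements satisfying [chain_in A]. *)
Notation singular_chain R T n := {freeg (simplex R n -> T) / int}.

Definition chain_in (R : realType) (T : topologicalType) (n : nat)
    (A : set T) (c : singular_chain R T n) : Prop :=
  forall s : simplex R n -> T,
    coeff s c != 0 -> continuous s /\ (forall x, A (s x)).

Definition singular_boundary (R : realType) (T : topologicalType) (n : nat)
    (c : singular_chain R T n.+1) : singular_chain R T n :=
  fglift (fun s : simplex R n.+1 -> T =>
    \sum_(j < n.+2) (-1) ^+ j *: << s \o coface j >> : singular_chain R T n) c.

(* [c] and [c'] define the same element of H_n(A, B; Z), for [B] a subset
   of [A]. *)
Definition homologous (R : realType) (T : topologicalType) (n : nat)
    (A B : set T) (c c' : singular_chain R T n) : Prop :=
  exists (d : singular_chain R T n.+1) (b : singular_chain R T n),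
    [/\ chain_in A d, chain_in B b & c - c' = singular_boundary d + b].

(** * The complex projective line and the product of four copies of it *)

(* Typed as a [numClosedFieldType] so as to inherit the topology and the normed
   module structure that numeric fields have. *)
Definition C (R : realType) : numClosedFieldType := R[i].

Definition nonzero_vec (R : realType) : set (C R * C R) := [set v | v != 0].

Notation hvec R := (set_type (@nonzero_vec R)).

Definition proportional (R : realType) (v w : hvec R) : bool :=
  `[< exists l : C R, set_val w = l *: set_val v >].

Lemma proportional_refl (R : realType) : reflexive (@proportional R).
Proof. by move=> v; apply/asboolP; exists 1; rewrite scale1r. Qed.

Lemma proportional_sym (R : realType) :
  ssrbool.symmetric (@proportional R).
Proof.
suff H v w : @proportional R v w -> proportional w v.
  by move=> v w; apply/idP/idP; apply: H.
move=> /asboolP [l lE]; apply/asboolP; exists l^-1.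
have l0 : l != 0.
  apply/eqP => l0; have : nonzero_vec (set_val w) := set_valP w.
  by rewrite /nonzero_vec lE l0 scale0r /= eqxx.
by rewrite lE scalerA mulVf // scale1r.
Qed.

Lemma proportional_trans (R : realType) : transitive (@proportional R).
Proof.
move=> v u w /asboolP [l lE] /asboolP [m mE]; apply/asboolP.
by exists (m * l); rewrite mE lE scalerA.
Qed.

Canonical proportional_equiv (R : realType) :=
  EquivRel (@proportional R) (@proportional_refl R) (@proportional_sym R)
    (@proportional_trans R).

Definition P1 (R : realType) := {eq_quot (@proportional R)}%qT.
HB.instance Definition _ R := Topological.copy (P1 R) (quotient_topology (P1 R)).
HB.instance Definition _ R := Quotient.on (P1 R).

Notation P1x4 R := {ptws 'I_4 -> P1 R}.

Definition hpoint (R : realType) (v : hvec R) : P1 R := \pi_(P1 R)%qT v.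

(** * Subvarieties of the product *)

(* The eight homogeneous coordinates: the variables of index [mxvec_index i 0]
   and [mxvec_index i 1] are the coordinates of the factor [i]. *)
Definition hcoords (R : realType) (v : 'I_4 -> hvec R) (k : 'I_(4 * 2)) : C R :=
  mxvec (\matrix_(i < 4, b < 2)
    (if b == 0 then (set_val (v i)).1 else (set_val (v i)).2)) ord0 k.

Definition multihomogeneous (R : realType) (f : mpoly (4 * 2) (C R)) : Prop :=
  exists e : 'I_4 -> nat, forall m, m \in msupp f -> forall i : 'I_4,
    (\sum_(b < 2) m (mxvec_index i b))%N = e i.

Definition zero_locus (R : realType) (S : set (mpoly (4 * 2) (C R))) :
    set (P1x4 R) :=
  [set x | forall f, S f -> forall v : 'I_4 -> hvec R,
    (forall i, hpoint (v i) = x i) -> meval (hcoords v) f = 0].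

Definition zariski_closed (R : realType) (Z : set (P1x4 R)) : Prop :=
  exists S, (forall f, S f -> multihomogeneous f) /\ Z = zero_locus S.

(* Reduced irreducible closed subschemes, identified with their sets of
   complex points. *)
Definition subvariety (R : realType) (V : set (P1x4 R)) : Prop :=
  [/\ zariski_closed V, V !=set0 &
    forall A B : set (P1x4 R), zariski_closed A -> zariski_closed B ->
      V `<=` A `|` B -> V `<=` A \/ V `<=` B].

Definition subvariety_chain (R : realType) (V : set (P1x4 R)) (n : nat) : Prop :=
  exists Z : 'I_n.+1 -> set (P1x4 R),
    (forall i, subvariety (Z i) /\ Z i `<=` V) /\
    (forall i j : 'I_n.+1, (i < j)%N -> Z i `<` Z j).

Definition has_dim (R : realType) (V : set (P1x4 R)) (n : nat) : Prop :=
  subvariety_chain V n /\ ~ subvariety_chain V n.+1.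

(** * Fundamental classes of surfaces *)

Lemma aff_nonzero (R : realType) (b : bool) (t : C R) :
  (if b then (1, t) else (t, 1)) \in @nonzero_vec R.
Proof.
apply/mem_set; rewrite /nonzero_vec /=.
by case: b; rewrite xpair_eqE oner_eq0 ?andbF.
Qed.

(* [1 : t] or [t : 1], according to [b] *)
Definition aff (R : realType) (b : bool) (t : C R) : P1 R :=
  hpoint (exist (fun v => v \in @nonzero_vec R) _ (aff_nonzero b t)).

Definition polydisc (R : realType) : set (C R * C R) :=
  [set z | `|z.1| < 1 /\ `|z.2| < 1].

(* The map from C^2 to the product with components [f i] in the standard
   affine charts selected by [a]. *)
Definition param (R : realType) (a : 'I_4 -> bool)
    (f : 'I_4 -> C R * C R -> C R) (z : C R * C R) : P1x4 R :=
  fun i => aff (a i) (f i z).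

(* [param a f] restricts to a holomorphic embedding of the unit polydisc onto
   an open subset (for the classical topology) of [V]; the points of such
   subsets are the smooth points of a surface [V].  Differentiability is
   complex (Frechet) differentiability. *)
Definition holomorphic_chart (R : realType) (V : set (P1x4 R))
    (a : 'I_4 -> bool) (f : 'I_4 -> C R * C R -> C R) : Prop :=
  [/\ forall i z, polydisc z -> differentiable (f i) z,
      forall z, polydisc z ->
        forall v, (forall i, 'd (f i) z v = 0) -> v = 0,
      {in @polydisc R &, injective (param a f)} &
      forall U, open U -> U `<=` @polydisc R ->
        exists W : set (P1x4 R), open W /\ param a f @` U = V `&` W].

(* The affine 4-simplex in the unit polydisc of C^2 = R^4, with real
   coordinates (Re z1, Im z1, Re z2, Im z2), whose vertices are
   -(1,1,1,1)/2, e1/2, e2/2, e3/2, e4/2. It contains the origin in its interior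
   and is positively oriented, so that it represents the generator of
   H_4(C^2, C^2 - 0; Z) given by the complex orientation. *)
Definition orientation_simplex (R : realType) (x : simplex R 4) : C R * C R :=
  let y k := (set_val x ord0 (inord k) - set_val x ord0 ord0) / 2 in
  (Complex (y 1%N) (y 2%N), Complex (y 3%N) (y 4%N)).

(* A cycle on the surface [V] representing the fundamental class [V]: at every
   smooth point it restricts to the local generator of the homology of
   (V, V minus the point) given by the complex orientation. *)
Definition fundamental_cycle (R : realType) (V : set (P1x4 R))
    (z : singular_chain R (P1x4 R) 4) : Prop :=
  [/\ chain_in V z, singular_boundary z = 0 &
    forall a f, holomorphic_chart V a f ->
      homologous V (V `\ param a f 0) z
        << param a f \o @orientation_simplex R >>].

(** * Realizable classes *)

(* P^1 in the factors [i] and [j], and the point [1 : 0] in the others *)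
Definition coordinate_surface (R : realType) (i j : 'I_4) : set (P1x4 R) :=
  [set x | forall k, k != i -> k != j -> x k = aff true 0].

(* [c] is a cycle representing the class eta(p) *)
Definition represents_eta (R : realType) (p : 'I_4 -> 'I_4 -> int)
    (c : singular_chain R (P1x4 R) 4) : Prop :=
  exists2 l : 'I_4 -> 'I_4 -> singular_chain R (P1x4 R) 4,
    forall i j : 'I_4, (i < j)%N ->
      fundamental_cycle (@coordinate_surface R i j) (l i j) &
    c = \sum_(i < 4) \sum_(j < 4 | (i < j)%N) p i j *: l i j.

(* eta(p) = [V] in H_4((P^1)^4; Z) for some surface [V] *)
Definition eta_realizable (R : realType) (p : 'I_4 -> 'I_4 -> int) : Prop :=
  exists V : set (P1x4 R), [/\ subvariety V, has_dim V 2 &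
    exists c z, [/\ represents_eta p c, fundamental_cycle V z &
      homologous setT set0 c z]].

(* Main.v *)
Require Import Defs.
From HB Require Import structures.
From mathcomp Require Import all_boot all_order all_algebra.
From mathcomp Require Import all_classical all_reals all_analysis.
From mathcomp Require Import generic_quotient complex ring lra zify.
From mathcomp.multinomials Require Import freeg.
From mathcomp.multinomials Require Import -(notations) mpoly.

Set Implicit Arguments.
Unset Strict Implicit.
Unset Printing Implicit Defensive.

Import Order.TTheory GRing.Theory Num.Theory.
Import numFieldNormedType.Exports.

Local Open Scope classical_set_scope.
Local Open Scope ring_scope.

(** The coefficient [p i j] is the number of points of the surface [V] with
    prescribed general coordinates in the factors [i] and [j], so the inequality
    counts points.  As [p i j] is positive, [V] dominates the plane of these two
    coordinates, and its projection to the factors [i, j, k] is a hypersurface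
    [P = 0].  A line in the direction of [i] at general values of the coordinates
    [j] and [k] meets it in at most as many points as [V] has points over these
    values; hence [P] has degree at most [p j k] in the coordinate [i], and
    likewise at most [p i k] in the coordinate [j].  The projection to the
    factors [i, j, l] similarly has an equation [Q = 0] of degrees at most
    [p j l] and [p i l].  Now fix general values of the coordinates [k] and [l].
    The [p k l] points of [V] over them are determined by their coordinates [i]
    and [j], at which the two plane curves cut out by [P] and [Q] meet, and
    by the theorem of Bezout for bidegrees these curves have at most
    [p i k * p j l + p i l * p j k] common points.

    Topology enters only through the identification of [p i j] with a number of
    points ([eta_sheets]).  A small box in the coordinates [i] and [j] is
    labelled by the five vertices of a 4-simplex, and the determinant that tells
    whether the labels of the vertices of a small simplex form a permutation is a
    cochain.  It is a cocycle, it vanishes when a label is missing, and by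
    Sperner's lemma ([sperner]) it takes the value 1 on every subdivision of a
    simplex that covers the box once.  Evaluated on sufficiently subdivided
    chains it therefore kills boundaries ([eval_sd_local]) and counts the sheets
    of [V] over the box ([sheeted_degree]), while among the coordinate surfaces
    it detects only the one in the directions [i] and [j].

    The sheets come from algebra.  In the affine chart [V] is the zero set of a
    prime ideal of polynomials.  Any three coordinates satisfy a relation on [V],
    since otherwise successive specialization would give a chain of subvarieties
    of length 3 ([three_dependent]).  If the coordinates [i] and [j] are
    independent, a general point of their plane has a finite fibre described by
    two polynomials with simple roots ([tower_exists]); simple roots depend
    holomorphically on the coefficients ([root_functions]), so that the points of
    the fibre extend to sheets ([fibre_number]).  If they are dependent, a small
    box misses [V] and [p i j] is zero ([dependent_number]).

    That the ideal of the projection is generated by one equation is Gauss's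
    lemma ([principal_over_zero]); reordering the variables then bounds the
    partial degrees ([generator]).  The theorem of Bezout ([bezout]) is proved
    with the Sylvester matrix: its determinant has bounded degree, and it vanishes
    at a point to an order at least the number of common zeros above it.  A
    surface that lies at infinity in some factor misses all boxes in the
    directions of that factor, which settles this remaining case. *)

(** * Barycentric subdivision of lists of points *)

Section Coboundary.
Variable T : Type.
Implicit Types (f g : seq T -> int) (w : seq T).

(** The alternating sum of [f] over the faces of [w], as a recursion on the
    cone structure of a list: this is how [f] evaluates on the boundary of the
    ordered simplex [w]. *)
Fixpoint bd f w : int :=
  if w is b :: y then f y - bd (fun u => f (b :: u)) y else 0.

Lemma eq_bd f g w :
    (forall y, (size y).+1 = size w -> (forall P : T -> Prop,
       (forall x, List.In x w -> P x) -> forall x, List.In x y -> P x) ->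
     f y = g y) ->
  bd f w = bd g w.
Proof.
elim: w f g => [//|b y IH] f g fg /=; congr (_ - _).
  by apply: fg => // P Py x xy; apply: Py; right.
apply: IH => u su Hu; apply: fg => [|P Pw x]; first by rewrite /= su.
case=> [<-|xu]; first by apply: Pw; left.
by apply: Hu xu => z zy; apply: Pw; right.
Qed.

Lemma bdB f g w : bd (fun y => f y - g y) w = bd f w - bd g w.
Proof.
elim: w f g => [|b y IH] f g /=; first by rewrite subr0.
by rewrite IH; ring.
Qed.

Lemma bd_bd f w : bd (bd f) w = 0.
Proof.
elim: w f => [//|b y IH] f /=.
by rewrite bdB IH; ring.
Qed.

Lemma bd_nth f w :
  bd f w = \sum_(j < size w) (-1) ^+ j * f (take j w ++ drop j.+1 w).
Proof.
elim: w f => [|b y IH] f /=; first by rewrite big_ord0.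
rewrite big_ord_recl /= expr0 mul1r drop0 IH -sumrN; congr (_ + _).
by apply: eq_bigr => j _; rewrite /bump /= exprS; ring.
Qed.

End Coboundary.

Lemma bd_map (S T : Type) (h : S -> T) (f : seq T -> int) w :
  bd (fun y => f (map h y)) w = bd f (map h w).
Proof. by elim: w f => [//|b y IH] f /=; rewrite -IH. Qed.

Section Subdivision.
Variables (R : realType) (E : normedModType R).
Implicit Types (f g : seq E -> int) (w : seq E) (K : E -> Prop).

Definition bary w : E := (size w)%:R^-1 *: \sum_(x <- w) x.

(** Evaluation on the barycentric subdivision of the ordered simplex [w]: the
    cone from the barycentre over the subdivided boundary.  The empty list is
    the simplex of dimension -1, which makes the recursion uniform. *)
Fixpoint sdn n f w : int :=
  if n is n'.+1 then bd (sdn n' (fun u => f (bary w :: u))) w else f w.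

Definition sd f w := sdn (size w) f w.

Fixpoint sdN N f w : int :=
  if N is N'.+1 then sd (sdN N' f) w else f w.

Lemma sdnB n f g w : sdn n (fun y => f y - g y) w = sdn n f w - sdn n g w.
Proof.
elim: n f g w => [//|n IH] f g w /=.
by rewrite -bdB; congr (bd _ w); apply/funext => y; rewrite -IH.
Qed.

Lemma sdNB N f g w : sdN N (fun y => f y - g y) w = sdN N f w - sdN N g w.
Proof.
elim: N w => [//|N IH] w /=.
by rewrite /sd -sdnB; congr (sdn _ _ _); apply/funext => y; rewrite IH.
Qed.

(** Subdivision commutes with boundaries because the boundary of a cone is its
    base minus the cone over the boundary of the base. *)
Lemma sd_bd f w : sd (bd f) w = bd (sd f) w.
Proof.
rewrite /sd; have [n] := ubnP (size w).
elim: n f w => [//|n IH] f w; case: w => [//|a w'] sw.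
set w := a :: w' in sw *; set b := bary w.
change (bd (sdn (size w') (fun u => bd f (b :: u))) w =
  bd (fun y => sdn (size y) f y) w).
have -> : bd (sdn (size w') (fun u => bd f (b :: u))) w =
   bd (fun y => sdn (size y) f y - bd (fun z => sdn (size z) (fun u => f (b :: u)) z) y) w.
  apply: eq_bd => y [sy] _; rewrite sy /= sdnB; congr (_ - _).
  by rewrite -sy IH // -ltnS (leq_trans _ sw) //= sy.
by rewrite bdB bd_bd subr0.
Qed.

Lemma sdN_bd N f w : sdN N (bd f) w = bd (sdN N f) w.
Proof.
elim: N w => [//|N IH] w /=; rewrite -sd_bd.
by congr (sd _ w); apply/funext => y; rewrite IH.
Qed.

Definition bary_convex K :=
  forall w, w <> [::] -> (forall x, List.In x w -> K x) -> K (bary w).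

Lemma ball_bary_convex c r : bary_convex (fun x => `|c - x| <= r).
Proof.
move=> w w0 wr.
have s0 : 0 < (size w)%:R :> R by rewrite ltr0n; case: (w) w0.
have -> : c - bary w = (size w)%:R^-1 *: \sum_(x <- w) (c - x).
  have -> : \sum_(x <- w) (c - x) = c *+ size w - \sum_(x <- w) x.
    elim: (w) => [|x w' IH]; first by rewrite !big_nil subr0.
    by rewrite !big_cons /= IH mulrS opprD; rewrite addrACA.
  rewrite scalerBr -[c *+ _]scaler_nat scalerA mulVf ?gt_eqF // scale1r.
  by [].
rewrite normrZ ger0_norm ?invr_ge0 ?ler0n //.
rewrite mulrC ler_pdivrMr // mulr_natr.
elim: (w) wr => [|x w' IH] wr /=; first by rewrite big_nil normr0.
rewrite big_cons mulrS; apply: (le_trans (ler_normD _ _)); apply: lerD.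
  by apply: wr; left.
by apply: IH => y yw; apply: wr; right.
Qed.

(** The mean of the differences [x - a] over a list containing [a] has one term
    equal to zero, whence the factor smaller than 1. *)
Lemma bary_near w a d : List.In a w -> 0 <= d ->
    (forall x y, List.In x w -> List.In y w -> `|x - y| <= d) ->
  `|bary w - a| <= ((size w).-1%:R / (size w)%:R) * d.
Proof.
move=> aw d0 wd.
have s0 : 0 < (size w)%:R :> R by rewrite ltr0n; case: (w) aw.
have -> : bary w - a = (size w)%:R^-1 *: \sum_(x <- w) (x - a).
  have -> : \sum_(x <- w) (x - a) = \sum_(x <- w) x - a *+ size w.
    elim: (w) => [|x w' IH]; first by rewrite !big_nil subr0.
    by rewrite !big_cons /= IH mulrS opprD addrACA.
  by rewrite scalerBr -[a *+ _]scaler_nat scalerA mulVf ?gt_eqF // scale1r.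
rewrite normrZ ger0_norm ?invr_ge0 ?ler0n //.
rewrite mulrC mulrAC ler_pM2r ?invr_gt0 //.
have {}wd x : List.In x w -> `|x - a| <= d by move=> xw; apply: wd.
suff main w1 : (forall x, List.In x w1 -> `|x - a| <= d) ->
   `|\sum_(x <- w1) (x - a)| <= (size w1)%:R * d /\
   (List.In a w1 -> `|\sum_(x <- w1) (x - a)| <= (size w1).-1%:R * d).
  by have [_] := main w wd; apply.
elim: w1 => [|x w1 IH] w1d /=; first by rewrite big_nil normr0 mul0r.
have [|IH1 IH2] := IH; first by move=> z zw; apply: w1d; right.
rewrite big_cons; split.
  apply: (le_trans (ler_normD _ _)); rewrite -natr1 mulrDl mul1r addrC.
  by apply: lerD => //; apply: w1d; left.
case=> [->|aw1]; first by rewrite subrr add0r.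
apply: (le_trans (ler_normD _ _)).
have -> : size w1 = (size w1).-1.+1 by case: (w1) aw1.
rewrite -natr1 mulrDl mul1r addrC; apply: lerD; first exact: IH2.
by apply: w1d; left.
Qed.

Definition mesh (M : nat) : R := M%:R / M.+1%:R.

Lemma mesh_ge0 M : 0 <= mesh M. Proof. by rewrite divr_ge0. Qed.

Lemma mesh_lt1 M : mesh M < 1.
Proof. by rewrite ltr_pdivrMr ?ltr0n // mul1r ltr_nat. Qed.

(** What the estimates use of a simplex of the subdivision; the quantification
    over convex predicates stands for membership in the convex hull of [w]. *)
Definition refines n d w y :=
  [/\ size y = n,
      forall K, bary_convex K -> (forall x, List.In x w -> K x) ->
        forall x, List.In x y -> K x &
      forall a b, List.In a y -> List.In b y -> `|a - b| <= d].

Lemma eq_sdn M n f g w d : size w = n -> (n <= M.+1)%N -> 0 <= d ->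
    (forall x y, List.In x w -> List.In y w -> `|x - y| <= d) ->
    (forall y, refines n (mesh M * d) w y -> f y = g y) ->
  sdn n f w = sdn n g w.
Proof.
elim: n f g w => [|n IH] f g w sw nM d0 wd fg /=.
  by case: w sw fg {wd} => // _ fg; apply: fg.
apply: eq_bd => y0 sy0 y0w.
have {}sy0 : size y0 = n by apply: succn_inj; rewrite sy0.
have y0d x y : List.In x y0 -> List.In y y0 -> `|x - y| <= d.
  move=> xy yy; apply: (y0w (fun x => `|x - y| <= d)) xy => z zw.
  by apply: (y0w (fun y => `|z - y| <= d)) yy => t tw; apply: wd.
apply: IH => //; first exact: ltnW.
move=> y [sy yK yd]; apply: fg; split; first by rewrite /= sy.
  move=> K cK wK x /= [<-|xy].
    by apply: cK => //; case: (w) sw.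
  by apply: (yK K cK _ x xy) => z zy; exact: (y0w K).
have bw x : List.In x w -> `|bary w - x| <= mesh M * d.
  move=> xw; apply: (le_trans (bary_near xw d0 wd)).
  rewrite ler_wpM2r // /mesh sw /= ler_pdivrMr ?ltr0n // mulrAC ler_pdivlMr ?ltr0n //.
  rewrite -!natrM ler_nat; lia.
have by' x : List.In x y -> `|bary w - x| <= mesh M * d.
  move=> xy; apply: (yK (fun x => `|bary w - x| <= mesh M * d)) xy.
    exact: ball_bary_convex.
  by move=> z zy; exact: (y0w (fun x => `|bary w - x| <= mesh M * d)).
move=> u v /= [<-|uy] [<-|vy].
- by rewrite subrr normr0 mulr_ge0 // mesh_ge0.
- exact: by'.
- by rewrite distrC; apply: by'.
- exact: yd.
Qed.

(** Congruence with control of size: only the simplices that occur in the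
    subdivision matter, and their diameters decrease geometrically. *)
Lemma eq_sdN M N f g w d : (size w <= M.+1)%N -> 0 <= d ->
    (forall x y, List.In x w -> List.In y w -> `|x - y| <= d) ->
    (forall y, refines (size w) (mesh M ^+ N * d) w y -> f y = g y) ->
  sdN N f w = sdN N g w.
Proof.
elim: N w d => [|N IH] w d wM d0 wd fg /=.
  by apply: fg; split => //; rewrite expr0 mul1r.
apply: (@eq_sdn M _ _ _ _ d) => // y [sy yK yd].
apply: (IH y (mesh M * d)); first by rewrite sy.
- by rewrite mulr_ge0 // mesh_ge0.
- exact: yd.
move=> u [su uK ud]; apply: fg; split; first by rewrite su sy.
  move=> K cK wK; apply: uK => //; exact: yK.
by rewrite exprSr -mulrA.
Qed.

Lemma eq_sdN_in N f g w K : bary_convex K -> (forall x, List.In x w -> K x) ->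
    (forall y, size y = size w -> (forall x, List.In x y -> K x) -> f y = g y) ->
  sdN N f w = sdN N g w.
Proof.
move=> cK wK fg.
have [d d0 wd] : exists2 d : R, 0 <= d &
    (forall x y, List.In x w -> List.In y w -> `|x - y| <= d).
  pose m (v : seq E) := \sum_(x <- v) `|x|.
  have m0 v : 0 <= m v by apply: sumr_ge0.
  have mle x v : List.In x v -> `|x| <= m v.
    elim: v => [//|a v IH] /= [<-|xv]; rewrite /m big_cons.
      by rewrite lerDl m0.
    by rewrite (le_trans (IH xv)) // lerDr.
  exists (m w + m w); first by rewrite addr_ge0.
  by move=> x y xw yw; rewrite (le_trans (ler_normB _ _)) // lerD ?mle.
apply: (@eq_sdN (size w) N _ _ _ d) => // y [sy yK _]; apply: fg => //.
exact: yK.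
Qed.

End Subdivision.

Section Naturality.
Variables (R : realType) (E F : normedModType R) (L : E -> F) (K : E -> Prop).
Hypothesis cK : bary_convex K.
Hypothesis LK : forall w, w <> [::] -> (forall x, List.In x w -> K x) ->
  L (bary w) = bary (map L w).

Lemma sdn_map n f w : size w = n -> (forall x, List.In x w -> K x) ->
  sdn n (fun y => f (map L y)) w = sdn n f (map L w).
Proof.
elim: n f w => [//|n IH] f w sw wK /=; rewrite -bd_map.
apply: eq_bd => y0 sy0 y0w; rewrite -IH; last exact: (y0w K).
  by rewrite -LK //; case: (w) sw.
by apply: succn_inj; rewrite sy0.
Qed.

Lemma sdN_map N f w : (forall x, List.In x w -> K x) ->
  sdN N (fun y => f (map L y)) w = sdN N f (map L w).
Proof.
elim: N w => [//|N IH] w wK /=; rewrite /sd size_map -sdn_map //.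
apply: (@eq_sdN_in _ _ 1 _ _ w K) => // y sy yK; exact: IH.
Qed.

End Naturality.

(** * Evaluating cochains on subdivided singular chains *)

Section SingularEvaluation.
Variable R : realType.

Lemma std_simplex_bary_convex n : bary_convex (@std_simplex R n).
Proof.
move=> w w0 wS.
have s0 : 0 < (size w)%:R :> R by rewrite ltr0n; case: (w) w0.
split=> [i|].
  rewrite /bary mxE summxE mulr_ge0 ?invr_ge0 ?ler0n // big_seq sumr_ge0 // => x xw.
  suff /wS[] : List.In x w by [].
  by elim: (w) xw => [//|a v IH]; rewrite inE => /orP[/eqP->|/IH]; [left|right].
under eq_bigr => i _ do rewrite /bary mxE.
rewrite -mulr_sumr; under eq_bigr => i _ do rewrite summxE.
rewrite exchange_big /=.
have -> : \sum_(x <- w) \sum_i x ord0 i = (size w)%:R.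
  elim: (w) wS => [|a v IH] wS; first by rewrite big_nil.
  rewrite big_cons IH => [|x xv]; last by apply: wS; right.
  have [_ ->] : std_simplex a by apply: wS; left.
  by rewrite /= -natr1 addrC.
by rewrite mulVf // gt_eqF.
Qed.

Lemma vertex_simplex n (i : 'I_n.+1) : std_simplex (delta_mx ord0 i : 'rV[R]_n.+1).
Proof.
split=> [j|]; first by rewrite mxE eqxx /= ler0n.
rewrite (bigD1 i) //= mxE !eqxx big1 ?addr0 // => j /negbTE ji.
by rewrite mxE eqxx ji.
Qed.

Lemma std_simplex_le1 n (x : 'rV[R]_n.+1) i : std_simplex x -> x ord0 i <= 1.
Proof.
by move=> [x0 <-]; rewrite (bigD1 i) //= lerDl sumr_ge0.
Qed.

Lemma compact_std_simplex n : compact (@std_simplex R n).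
Proof.
apply: bounded_closed_compact.
  exists 1; split; first exact: num_real.
  move=> M M1 x xS /=; rewrite [leLHS]mx_normrE bigmax_le ?(le_trans ler01) ?ltW //.
  move=> [i j] _ /=; rewrite ord1 ger0_norm; last by case: xS.
  by rewrite (le_trans _ (ltW M1)) // std_simplex_le1.
have -> : @std_simplex R n = (\bigcap_(i in [set: 'I_n.+1])
    ((fun x : 'rV[R]_n.+1 => x ord0 i) @^-1` [set y | 0 <= y])) `&`
    ((fun x : 'rV[R]_n.+1 => \sum_i x ord0 i) @^-1` [set 1]).
  apply/seteqP; split=> x /=; first by move=> [x0 x1]; split=> // i _; apply: x0.
  by move=> [x0 x1]; split=> // i; apply: x0.
apply: closedI.
  apply: closed_bigI => i _; apply: preimage_closed (@closed_ge _ _).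
  by move=> x _; apply: coord_continuous.
apply: preimage_closed (@closed_eq _ _); move=> x _; move: x.
have -> : (fun x : 'rV[R]_n.+1 => \sum_i x ord0 i) =
    \sum_i (fun x : 'rV[R]_n.+1 => x ord0 i).
  by apply/funext => x; rewrite fct_sumE.
elim/big_ind: _ => [|f g cf cg|i _].
- exact: (@cst_continuous _ _ (0 : R)).
- by move=> x; exact: (continuousD (cf x) (cg x)).
- exact: coord_continuous.
Qed.

Definition vertices n : seq 'rV[R]_n.+1 := [seq delta_mx ord0 i | i <- enum 'I_n.+1].

Lemma size_vertices n : size (vertices n) = n.+1.
Proof. by rewrite size_map size_enum_ord. Qed.

Lemma vertices_simplex n x : List.In x (vertices n) -> std_simplex x.
Proof. move=> xv; suff [i ->] : exists i, x = delta_mx ord0 i by exact: vertex_simplex.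
by rewrite /vertices in xv; elim: (enum 'I_n.+1) xv => [//|i v IH] /= [<-|/IH//]; exists i. Qed.

Lemma vertices_dist n x y : List.In x (vertices n) -> List.In y (vertices n) ->
  `|x - y| <= 2.
Proof.
have H z : std_simplex (z : 'rV[R]_n.+1) -> `|z| <= 1.
  move=> zS; rewrite [leLHS]mx_normrE bigmax_le // => -[i j] _ /=.
  by rewrite ord1 ger0_norm ?std_simplex_le1 //; case: zS.
move=> /vertices_simplex/H x1 /vertices_simplex/H y1.
by rewrite (le_trans (ler_normB _ _)) // [2]/(1 + 1) lerD.
Qed.

Lemma vertex0_mem n : (delta_mx ord0 ord0 : 'rV[R]_n.+1) \in @std_simplex R n.
Proof. by apply/mem_set/vertex_simplex. Qed.

(** The default value outside the simplex is never reached; it allows lists of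
    points of the ambient vector space to be used as simplices. *)
Definition to_simplex n (x : 'rV[R]_n.+1) : simplex R n :=
  insubd (exist (fun y => y \in @std_simplex R n) _ (vertex0_mem n)) x.

Lemma to_simplexK n x : std_simplex x -> set_val (@to_simplex n x) = x.
Proof. by move=> /mem_set xS; rewrite /to_simplex set_valE val_insubd xS. Qed.

Lemma coface_to_simplex n (j : 'I_n.+2) x : std_simplex x ->
  to_simplex (insert0 j x) = coface j (to_simplex x).
Proof.
move=> xS; apply: val_inj; rewrite -!set_valE to_simplexK; last first.
  by apply/set_mem; have := insert0_simplex j (to_simplex x); rewrite to_simplexK.
rewrite [RHS](_ : _ = insert0 j (set_val (to_simplex x))) //.
by rewrite to_simplexK.
Qed.

Lemma insert0_bary n (j : 'I_n.+2) w :
  insert0 j (bary w) = bary (map (@insert0 R n j) w).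
Proof.
apply/rowP => k; rewrite /bary !mxE size_map summxE big_map.
case: unliftP => [i ki|kj].
  rewrite mxE summxE; congr (_ * _); apply: eq_bigr => x _.
  by rewrite mxE ki liftK.
rewrite big1 ?mulr0 // => x _; by rewrite mxE kj unlift_none.
Qed.

Lemma take_drop_vertices n (j : 'I_n.+2) :
  take j (vertices n.+1) ++ drop j.+1 (vertices n.+1) =
  map (insert0 j) (vertices n).
Proof.
have -> : map (insert0 j) (vertices n) =
    [seq delta_mx ord0 (fintype.lift j i) : 'rV[R]_n.+2 | i <- enum 'I_n.+1].
  rewrite -map_comp; apply: eq_map => i /=; apply/rowP => k; rewrite !mxE.
  case: unliftP => [m ->|->]; first by rewrite mxE (inj_eq (@lift_inj _ j)).
  by rewrite eqxx /= (negbTE (neq_lift _ _)).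
rewrite (map_comp (fun k => delta_mx ord0 k) (fintype.lift j)) -map_take -map_drop -map_cat.
congr map; apply: (inj_map val_inj).
rewrite map_cat map_take map_drop val_enum_ord -map_comp.
rewrite (_ : [seq _ | i <- _] = [seq fintype.bump j i | i <- [seq val i | i <- enum 'I_n.+1]]); last first.
  by rewrite -map_comp; apply: eq_map.
rewrite val_enum_ord.
have jn : (j <= n.+1)%N by rewrite -ltnS.
apply: (@eq_from_nth _ 0%N).
  by rewrite size_cat size_takel ?size_drop ?size_map !size_iota; lia.
move=> i; rewrite size_cat size_takel ?size_drop ?size_iota; last lia.
move=> il; rewrite nth_cat size_takel ?size_iota; last lia.
rewrite (nth_map 0%N) ?size_iota; last lia.
rewrite nth_iota /fintype.bump; last lia.
case: ltnP => ij; first by rewrite nth_take // nth_iota; lia.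
by rewrite nth_drop nth_iota; lia.
Qed.

Section Chains.
Variable T : topologicalType.

Definition chain_eval n (f : (simplex R n -> T) -> int) (c : singular_chain R T n) : int :=
  fglift (f : _ -> int^o) c.

HB.instance Definition _ n f := GRing.isZmodMorphism.Build
  (singular_chain R T n) int (@chain_eval n f)
  (@lift_is_additive int (simplex R n -> T) int^o f).

Lemma chain_evalU n (f : (simplex R n -> T) -> int) s : chain_eval f << s >> = f s.
Proof. by rewrite /chain_eval liftU scale1r. Qed.

Lemma chain_evalZ n (f : (simplex R n -> T) -> int) k c :
  chain_eval f (k *: c) = k * chain_eval f c.
Proof.
rewrite /GRing.scale /= /fgscale raddf_sum -[in RHS](freeg_sumE c) raddf_sum mulr_sumr.
by apply: eq_bigr => s _ /=; rewrite /chain_eval !liftU /GRing.scale /= mulrA.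
Qed.

Lemma chain_eval_sum n (f : (simplex R n -> T) -> int) I (r : seq I) P
    (F : I -> singular_chain R T n) :
  chain_eval f (\sum_(i <- r | P i) F i) = \sum_(i <- r | P i) chain_eval f (F i).
Proof. exact: raddf_sum. Qed.

Lemma chain_evalE n (f : (simplex R n -> T) -> int) c :
  chain_eval f c = \sum_(s <- dom c) coeff s c * f s.
Proof.
rewrite -{1}[c]freeg_sumE raddf_sum; apply: eq_bigr => s _ /=.
by rewrite /chain_eval liftU.
Qed.

Lemma chain_eval_boundary n (f : (simplex R n -> T) -> int)
    (c : singular_chain R T n.+1) :
  chain_eval f (singular_boundary c) =
  chain_eval (fun s => \sum_(j < n.+2) (-1) ^+ j * f (s \o coface j)) c.
Proof.
rewrite [RHS]chain_evalE -{1}[c]freeg_sumE /singular_boundary.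
set g := fun s : simplex R n.+1 -> T => _.
have -> : fglift g (\sum_(z <- dom c) << coeff z c *g z >>) =
   \sum_(s <- dom c) coeff s c *: g s.
  have gB a b : fglift g (a - b) = fglift g a - fglift g b.
    exact: lift_is_additive.
  have g0 : fglift g 0 = 0 by have := gB 0 0; rewrite !subrr.
  have gD a b : fglift g (a + b) = fglift g a + fglift g b.
    by rewrite -[b in LHS]opprK gB -(sub0r b) gB g0 sub0r opprK.
  elim: (dom c) => [|s v IH]; first by rewrite !big_nil.
  by rewrite !big_cons -IH gD liftU.
rewrite chain_eval_sum; apply: eq_bigr => s _; rewrite chain_evalZ; congr (_ * _).
rewrite chain_eval_sum; apply: eq_bigr => j _; rewrite chain_evalZ.
by rewrite chain_evalU.
Qed.

(** Subdivision is applied to the cochain, not to the chain: the subdivided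
    chain is never formed, and no chain homotopy between a chain and its
    subdivision is needed. *)
Definition eval_sd n N (f : seq T -> int) : singular_chain R T n -> int :=
  chain_eval (fun s => sdN N (fun y => f (map (s \o @to_simplex n) y)) (vertices n)).

Lemma eval_sdU n N f (s : simplex R n -> T) :
  eval_sd N f << s >> = sdN N (fun y => f (map (s \o @to_simplex n) y)) (vertices n).
Proof. exact: chain_evalU. Qed.

Lemma eval_sdD n N f (c c' : singular_chain R T n) :
  eval_sd N f (c + c') = eval_sd N f c + eval_sd N f c'.
Proof. by rewrite /eval_sd raddfD. Qed.

Lemma eval_sdB n N f (c c' : singular_chain R T n) :
  eval_sd N f (c - c') = eval_sd N f c - eval_sd N f c'.
Proof. by rewrite /eval_sd raddfB. Qed.

Lemma eval_sdZ n N f k (c : singular_chain R T n) :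
  eval_sd N f (k *: c) = k * eval_sd N f c.
Proof. exact: chain_evalZ. Qed.

Lemma eval_sdBf n N f g (c : singular_chain R T n) :
  eval_sd N (fun y => f y - g y) c = eval_sd N f c - eval_sd N g c.
Proof.
rewrite /eval_sd !chain_evalE -sumrB; apply: eq_bigr => s _.
by rewrite -mulrBr -sdNB.
Qed.

(** Faces of the subdivision are the subdivision of faces, because cofaces are
    affine and hence preserve barycentres. *)
Lemma eval_sd_boundary n N f (c : singular_chain R T n.+1) :
  eval_sd N f (singular_boundary c) = eval_sd N (bd f) c.
Proof.
rewrite /eval_sd chain_eval_boundary !chain_evalE; apply: eq_bigr => s _.
congr (_ * _).
have -> : sdN N (fun y => bd f (map (s \o @to_simplex n.+1) y)) (vertices n.+1) =
    bd (sdN N (fun y => f (map (s \o @to_simplex n.+1) y))) (vertices n.+1).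
  by rewrite -sdN_bd; congr (sdN _ _ _); apply/funext => y; rewrite bd_map.
rewrite bd_nth size_vertices; apply: eq_bigr => j _; congr (_ * _).
rewrite take_drop_vertices.
rewrite -(@sdN_map _ _ _ (@insert0 R n j) (@std_simplex R n)) //; first last.
- exact: vertices_simplex.
- by move=> w _ _; exact: insert0_bary.
- exact: std_simplex_bary_convex.
apply: (@eq_sdN_in _ _ _ _ _ _ (@std_simplex R n)) => [|x /vertices_simplex //|y _ yS].
  exact: std_simplex_bary_convex.
rewrite -map_comp; congr f.
elim: y yS => [//|a y IH] yS /=; rewrite IH => [|x xy]; last by apply: yS; right.
by rewrite coface_to_simplex //; apply: yS; left.
Qed.

(** A cochain that vanishes on small simplices vanishes on sufficiently fine
    subdivisions: compactness of the standard simplex gives one number of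
    subdivisions for each of the finitely many maps of the chain. *)
Lemma eval_sd_local n f (X : set T) (c : singular_chain R T n) :
    chain_in X c ->
    (forall x, X x -> exists2 O, nbhs x O & forall y, size y = n.+1 ->
       (forall a, List.In a y -> X a /\ O a) -> f y = 0) ->
  exists N0, forall N, (N0 <= N)%N -> eval_sd N f c = 0.
Proof.
move=> cX fX.
suff H (s : simplex R n -> T) : coeff s c != 0 ->
    exists N0, forall N, (N0 <= N)%N ->
    sdN N (fun y => f (map (s \o @to_simplex n) y)) (vertices n) = 0.
  (* it suffices to treat one map of the chain *)
  have {}H : forall v : seq (simplex R n -> T), (forall s, s \in v -> coeff s c != 0) ->
      exists N0, forall N, (N0 <= N)%N ->
      \sum_(s <- v) coeff s c *
      sdN N (fun y => f (map (s \o @to_simplex n) y)) (vertices n) = 0.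
    elim=> [_|s v IH vc]; first by exists 0%N => N _; rewrite big_nil.
    have [N1 HN1] := H s (vc _ (mem_head _ _)).
    have [|N2 HN2] := IH; first by move=> t tv; apply: vc; rewrite inE tv orbT.
    exists (maxn N1 N2) => N; rewrite geq_max => /andP[N1N N2N].
    by rewrite big_cons HN2 // HN1 // mulr0 addr0.
  have [|N0 HN0] := H (dom c); first by move=> s; rewrite mem_dom.
  by exists N0 => N NN; rewrite /eval_sd chain_evalE HN0.
move=> /cX[cs sX].
(* [f] vanishes on the images of small simplices near [a] *)
pose P (d : R) (a : 'rV[R]_n.+1) := forall y : seq 'rV[R]_n.+1, size y = n.+1 ->
  (forall b, List.In b y -> std_simplex b /\ `|a - b| <= d) ->
  f (map (s \o @to_simplex n) y) = 0.
have [d d0 dP] : exists2 d, 0 < d & forall a, @std_simplex R n a -> P d a.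
  have /compact_near_coveringP/near_covering_withinP cov := @compact_std_simplex n.
  have /cov : forall a, @std_simplex R n a ->
      \forall a' \near a & d \near 0^'+, std_simplex a' -> P d a'.
    move=> a aS; have [U nU fU] := fX (s (to_simplex a)) (sX _).
    have H := cs (to_simplex a) U nU; move: H.
    case=> _ [[W oW <-] /= Wa sWU].
    have : nbhs a W by apply: open_nbhs_nbhs; split=> //; rewrite -[a]to_simplexK.
    move=> /nbhs_ballP[r /= r0 rW].
    exists (ball a (r / 2), [set d | 0 < d < r / 2]) => /=.
      split; first by apply: nbhsx_ballx; rewrite divr_gt0.
      near=> d; apply/andP; split; near: d; first exact: nbhs_right_gt.
      by apply: nbhs_right_lt; rewrite divr_gt0.
    move=> [a' d] /= [aa' /andP[d0 dr]] a'S y sy yd.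
    apply: fU; first by rewrite size_map.
    move=> t; elim: y yd {sy} => [//|b y IH] yd /= [<-|]; last first.
      by apply: IH => e ey; apply: yd; right.
    split; first exact: sX.
    have [bS abd] := yd b (or_introl erefl).
    apply: sWU; rewrite /= to_simplexK //; apply: rW.
    rewrite -ball_normE /= in aa' *.
    have -> : a - b = (a - a') + (a' - b) by rewrite addrA subrK.
    by rewrite (le_lt_trans (ler_normD _ _)) // [ltRHS]splitr ltrD // (le_lt_trans abd).
  move=> dP; near (0 : R)^'+ => d; exists d; first by near: d; exact: nbhs_right_gt.
  by near: d.
have [N0 N0d] : exists N0, forall N, (N0 <= N)%N -> mesh R n ^+ N * 2 <= d.
  have m1 : `|mesh R n| < 1 by rewrite ger0_norm ?mesh_ge0 ?mesh_lt1.
  have /cvgrPdist_lt H := cvg_expr m1.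
  have [N0 _ HN] := H (d / 2) (divr_gt0 d0 (ltr0n _ 2)).
  exists N0 => N /HN /=; rewrite sub0r normrN ger0_norm ?exprn_ge0 ?mesh_ge0 //.
  by rewrite ltr_pdivlMr // => /ltW.
exists N0 => N /N0d Nd.
rewrite -[RHS](subrr (sdN N (fun=> 0) (vertices n))) -sdNB subr0.
apply: (@eq_sdN _ _ n N _ _ _ 2) => //; first by rewrite size_vertices.
  exact: vertices_dist.
move=> y [sy yK yd]; have yS x : List.In x y -> std_simplex x.
  by apply: yK; [exact: std_simplex_bary_convex|exact: vertices_simplex].
rewrite size_vertices in sy; case: y sy yS yd {yK} => [//|a y] sy yS yd.
apply: (dP a); [by apply: yS; left|by []|] => b by_; split; first exact: yS.
by apply: le_trans Nd; apply: yd => //; left.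
Unshelve. all: by end_near.
Qed.
End Chains.
End SingularEvaluation.

(** * The Sperner cochain *)

Lemma InP (A : eqType) (x : A) s : List.In x s <-> x \in s.
Proof.
elim: s => [//|a s IH] /=; rewrite inE; split; first by case=> [->|/IH->]; rewrite ?eqxx ?orbT.
by case/orP => [/eqP->|/IH]; [left|right].
Qed.

Section Sperner.

(** The sign of [hs] as a permutation of [0 .. m-1], and 0 otherwise: the
    simplicial cochain dual to the simplex with vertices [0 .. m-1].  Pulled back
    along a labelling of the points of a space, it gives a degree. *)
Definition perm_sign m (hs : seq nat) : int :=
  \det (\matrix_(a < m, b < m) (nth m hs a == b)%:R : 'M[int]_m).

Lemma perm_sign_missing m hs (b : 'I_m) : size hs = m -> (b : nat) \notin hs ->
  perm_sign m hs = 0.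
Proof.
move=> sh bhs; rewrite /perm_sign (expand_det_col _ b) big1 // => a _.
rewrite mxE; case: eqP => [h|]; last by rewrite mul0r.
by move: bhs; rewrite -h mem_nth // sh.
Qed.

Lemma nth_skip (hs : seq nat) x0 j a : (j < size hs)%N ->
  nth x0 (take j hs ++ drop j.+1 hs) a = nth x0 hs (fintype.bump j a).
Proof.
move=> js; rewrite nth_cat size_take js /fintype.bump; case: ltnP => ja /=.
  by rewrite add0n nth_take.
by rewrite nth_drop; congr nth; lia.
Qed.

Definition mx_ones m k (hs : seq nat) : 'M[int]_m.+1 :=
  \matrix_(a, b) (if unlift ord0 b is Some c then (nth (k + m)%N hs a == k + c)%N%:R else 1).

Definition shifted_sign m k hs : int :=
  \det (\matrix_(a < m, b < m) (nth (k + m)%N hs a == k + b)%N%:R : 'M[int]_m).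

(** Expansion of the determinant along its column of ones. *)
Lemma bd_shifted_sign m k hs : size hs = m.+1 ->
  bd (shifted_sign m k) hs = \det (mx_ones m k hs).
Proof.
move=> sh; rewrite bd_nth sh (expand_det_col _ ord0); apply: eq_bigr => j _.
rewrite mxE unlift_none mul1r /cofactor addn0; congr (_ * _).
rewrite /shifted_sign; congr (\det _); apply/matrixP => a b.
by rewrite !mxE liftK nth_skip ?sh.
Qed.

(** The columns of the matrix other than the column of ones add up to it, so the
    matrix is singular. *)
Lemma bd_perm_sign m hs : size hs = m.+1 -> all (gtn m) hs ->
  bd (perm_sign m) hs = 0.
Proof.
move=> sh hm; have -> : perm_sign m = shifted_sign m 0 by [].
rewrite bd_shifted_sign //; set A := mx_ones m 0 hs.
pose v : 'cV[int]_m.+1 := \col_i (if i == ord0 then 1 else -1).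
have Av : A *m v = 0.
  apply/matrixP => a c; rewrite !mxE big_ord_recl !mxE unlift_none eqxx mulr1.
  have ha : (nth m hs a < m)%N by apply: (allP hm); rewrite mem_nth // sh.
  rewrite (bigD1 (Ordinal ha)) //= !mxE liftK eqxx mulrN1 big1 ?addr0 ?subrr //.
  move=> i iha; rewrite !mxE liftK eq_sym.
  case: eqP => [h|]; last by rewrite mul0r.
  by case/eqP: iha; apply: val_inj; rewrite /= -h.
have := congr1 (fun w => (\adj A *m w) ord0 ord0) Av.
rewrite mulmx0 mulmxA mul_adj_mx mul_scalar_mx !mxE eqxx mulr1.
by [].
Qed.

(** Adding all other columns to the first turns it into a column of ones. *)
Lemma perm_sign_bd m hs : size hs = m.+1 -> all (gtn m.+1) hs ->
  perm_sign m.+1 hs = bd (shifted_sign m 1) hs.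
Proof.
move=> sh hm; rewrite bd_shifted_sign //.
pose T : 'M[int]_m.+1 := \matrix_(i, j) ((j == ord0) || (i == j))%:R.
have detT : \det T = 1.
  rewrite det_trig; last first.
    apply/is_trig_mxP => i j ij; rewrite mxE.
    case: eqP => [j0|_]; first by move: ij; rewrite j0.
    by case: eqP ij => // ->; rewrite ltnn.
  by rewrite big1 // => i _; rewrite mxE eqxx orbT.
rewrite /perm_sign -[LHS]mulr1 -[X in _ * X]detT -det_mulmx; congr (\det _).
apply/matrixP => a b; rewrite !mxE.
have ha : (nth m.+1 hs a < m.+1)%N by apply: (allP hm); rewrite mem_nth // sh.
rewrite (bigD1 (Ordinal ha)) //= !mxE eqxx mul1r big1 ?addr0; last first.
  move=> i iha; rewrite !mxE; case: eqP => [h|]; last by rewrite mul0r.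
  by case/eqP: iha; apply: val_inj; rewrite /= -h.
case: unliftP => [c ->|->] /=; last by [].
by rewrite -!val_eqE.
Qed.

Variable R : realType.

(** Sperner's lemma by induction on the dimension: as long as all labels are in
    range the cochain is a coboundary, and on the boundary only the face
    opposite to the vertex 0 contributes, since the other faces lack the label
    of their opposite vertex. *)
Lemma sperner N n (r : 'rV[R]_n.+1 -> nat) :
    (forall x, std_simplex x -> exists2 i : 'I_n.+1, r x = i :> nat & x ord0 i != 0) ->
  sdN N (fun y => perm_sign n.+1 (map r y)) (vertices R n) = 1.
Proof.
elim: n r => [|n IH] r rP.
  have vS := @vertices_simplex R 0.
  rewrite (@eq_sdN_in _ _ N _ (fun=> 1) _ _ (@std_simplex_bary_convex R 0) vS).
    rewrite /vertices enum_ordSl enum_ord0 /=.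
    by elim: N (delta_mx _ _) => [//|N IH] v /=; rewrite /sd /= IH subr0.
  move=> y; rewrite size_vertices; case: y => [//|x [|//]] _ yS.
  have [|i ri _] := rP x; first by apply: yS; left.
  by rewrite /perm_sign det_mx11 mxE /= ri ord1.
have vS := @vertices_simplex R n.+1.
have cS := @std_simplex_bary_convex R n.+1.
rewrite (@eq_sdN_in _ _ N _ (bd (fun y => shifted_sign n.+1 1 (map r y))) _ _ cS vS); last first.
  move=> y; rewrite size_vertices => sy yS; rewrite bd_map -perm_sign_bd ?size_map //.
  apply/allP => h /mapP[x /InP/yS/rP[i -> _] ->].
  exact: ltn_ord.
rewrite sdN_bd bd_nth size_vertices big_ord_recl take_drop_vertices.
have vSn := @vertices_simplex R n; have cSn := @std_simplex_bary_convex R n.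
have face (j : 'I_n.+2) f : sdN N f (map (insert0 j) (vertices R n)) =
    sdN N (fun y => f (map (insert0 j) y)) (vertices R n).
  rewrite (@sdN_map _ _ _ (@insert0 R n j) (@std_simplex R n)) //.
  by move=> w _ _; exact: insert0_bary.
have rface (j : 'I_n.+2) (y : seq 'rV[R]_n.+1) (a : 'I_n.+1) :
    size y = n.+1 -> (forall x, List.In x y -> std_simplex x) ->
    exists2 i : 'I_n.+2, r (insert0 j (nth 0 y a)) = i :> nat & unlift j i != None.
  move=> sy yS; have S : std_simplex (insert0 j (nth 0 y a)).
    rewrite -[X in insert0 _ X]to_simplexK; first exact/set_mem/insert0_simplex.
    by apply/yS/InP; rewrite mem_nth ?sy.
  have [i -> xi] := rP _ S.
  exists i => //; apply: contra_neq xi => ji; by rewrite mxE ji.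
rewrite [X in _ + X]big1 ?addr0 ?expr0 ?mul1r; last first.
  move=> j _; rewrite take_drop_vertices face.
  rewrite (@eq_sdN_in _ _ N _ (fun=> 0 - 0) _ _ cSn vSn) ?sdNB ?subrr ?mulr0 //.
  move=> y; rewrite size_vertices => sy yS.
  rewrite /shifted_sign (expand_det_col _ j) big1 // => a _; rewrite mxE.
  case: eqP => [|]; last by rewrite mul0r.
  rewrite -map_comp (nth_map 0) ?sy //=.
  have [i -> xi] := rface (fintype.lift ord0 j) y a sy yS => ij.
  have ji : i = fintype.lift ord0 j by apply: val_inj; rewrite /= ij.
  by rewrite ji unlift_none in xi.
rewrite face.
rewrite -(IH (fun x => (r (insert0 ord0 x)).-1)).
  apply: (eq_sdN_in N cSn vSn) => y; rewrite size_vertices => sy yS.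
  rewrite /shifted_sign /perm_sign; congr (\det _); apply/matrixP => a b; rewrite !mxE.
  rewrite -map_comp !(nth_map 0) ?sy //=.
  have [i -> xi] := rface ord0 y a sy yS.
  case: unliftP xi => [c ->|//] _.
  by rewrite /= add1n eqSS.
move=> x xS.
have S : std_simplex (insert0 ord0 x).
  by rewrite -[x]to_simplexK //; exact/set_mem/insert0_simplex.
have [i -> xi] := rP _ S.
move: xi; rewrite mxE; case: unliftP => [c ->|_] xi; last by rewrite eqxx in xi.
by exists c.
Qed.
End Sperner.

(** * The topology of the projective line and of the product *)

Section ProjectiveLine.
Variable R : realType.
Implicit Types (t q : C R) (x : P1 R).

Lemma hpointP (v w : hvec R) :
  hpoint v = hpoint w <-> exists l : C R, set_val w = l *: set_val v.
Proof.
split=> [/eqmodP/asboolP //|H].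
by apply/eqmodP/asboolP.
Qed.

Lemma hpoint_repr x : exists v, x = hpoint v.
Proof. by exists (repr x); rewrite /hpoint reprK. Qed.

Lemma hvec_neq0 (v : hvec R) : ((set_val v).1 != 0) || ((set_val v).2 != 0).
Proof.
have : set_val v != 0 := set_valP v.
by case: (set_val v) => a b; rewrite xpair_eqE negb_and.
Qed.

Lemma hpoint_aff (v : hvec R) t : hpoint v = aff true t <->
  (set_val v).1 != 0 /\ t = (set_val v).2 / (set_val v).1.
Proof.
pose w : hvec R := exist (fun v => v \in @nonzero_vec R) _ (aff_nonzero true t).
have wE : set_val w = (1, t) by [].
rewrite (hpointP v w) wE; case: (set_val v) => a b /=.
have sE (l : C R) : l *: (a, b) = (l * a, l * b) by [].
split=> [[l]|[a0 ->]].
  rewrite sE => -[l1 ->]; have a0 : a != 0.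
    by apply: contra_eq_neq l1 => ->; rewrite mulr0 oner_neq0.
  by split=> //; apply: (mulIf a0); rewrite divfK // mulrAC -l1 mul1r.
by exists a^-1; rewrite sE mulVf // mulrC.
Qed.

Lemma aff_true_inj : injective (@aff R true).
Proof.
by move=> s t /hpoint_aff[_ ->]; exact: esym (divr1 s).
Qed.

Lemma P1_cases x : (exists t, x = aff true t) \/ x = aff false 0.
Proof.
have [v ->] := hpoint_repr x; have [v0|v0] := eqVneq (set_val v).1 0; last first.
  by left; exists ((set_val v).2 / (set_val v).1); apply/hpoint_aff.
right; apply/esym/hpointP; exists (set_val v).2.
rewrite [X in _ = _ *: X](_ : _ = (0, 1)) //.
case: (set_val v) v0 => a b /= ->.
have -> : b *: ((0, 1) : C R * C R) = (b * 0, b * 1) by [].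
by rewrite mulr0 mulr1.
Qed.

Lemma aff_infty t : aff true t <> aff false 0.
Proof. by move/esym/hpoint_aff => -[/eqP]. Qed.

Lemma continuous_hvec1 : continuous (fun v : hvec R => (set_val v).1).
Proof.
move=> v; apply: (@continuous_comp _ _ _ set_val fst); last exact: cvg_fst.
exact: initial_continuous.
Qed.

Lemma continuous_hvec2 : continuous (fun v : hvec R => (set_val v).2).
Proof.
move=> v; apply: (@continuous_comp _ _ _ set_val snd); last exact: cvg_snd.
exact: initial_continuous.
Qed.

Lemma continuous_hratio (v : hvec R) : (set_val v).1 != 0 ->
  {for v, continuous (fun w : hvec R => (set_val w).2 / (set_val w).1 : C R)}.
Proof.
move=> v0; apply: continuousM; first exact: continuous_hvec2.
exact: (@cvgV _ _ _ _ _ _ v0 (@continuous_hvec1 v)).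
Qed.

Lemma aff_nbhs t (A : set (C R)) : nbhs t A ->
  nbhs (aff true t) [set x | exists2 s, x = aff true s & A s].
Proof.
rewrite nbhsE => -[B [oB Bt] BA].
suff oU : open [set x | exists2 s : C R, x = aff true s & B s].
  apply: (@filterS _ _ _ [set x | exists2 s, x = aff true s & B s]).
    by move=> x [s -> /BA]; exists s.
  by apply: open_nbhs_nbhs; split=> //; exists t.
have hB (v : hvec R) (s : C R) : hpoint v = aff true s -> B s ->
    nbhs v [set w : hvec R | exists2 s : C R, hpoint w = aff true s & B s].
  move=> /hpoint_aff[v0 sE] Bs.
  have nB : \forall w \near v, B ((set_val w).2 / (set_val w).1).
    by apply: (continuous_hratio v0); rewrite -sE; apply: open_nbhs_nbhs.
  have nv0 : \forall w \near v, (set_val w).1 != 0.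
    exact: cvgr_neq0 (@continuous_hvec1 v) v0.
  near=> w; exists ((set_val w).2 / (set_val w).1); last by near: w.
  by apply/hpoint_aff; split=> //; near: w.
rewrite /open /= /quotient_open openE => v /= [s vs Bs].
exact: (hB v s).
Unshelve. all: by end_near. Qed.

Lemma continuous_far (T : topologicalType) (f1 f2 : T -> C R) (q e : C R) :
  continuous f1 -> continuous f2 ->
  continuous (fun w => `|f2 w - q * f1 w| - e * `|f1 w| : C R).
Proof.
move=> c1 c2 v; apply: cvgB; last by apply: cvgM; [exact: cvg_cst|exact: cvg_norm (c1 v)].
have c3 : f2 w - q * f1 w @[w --> v] --> f2 v - q * f1 v.
  by apply: cvgB; [exact: c2|apply: cvgM; [exact: cvg_cst|exact: c1]].
exact: cvg_norm c3.
Qed.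

(** The condition is homogeneous in the coordinates of a vector, so it defines
    an open set also at infinity. *)
Lemma infty_nbhs q (e : C R) : 0 < e ->
  nbhs (aff false 0 : P1 R) [set x | forall t, x = aff true t -> e < `|t - q|].
Proof.
move=> e0.
suff oU : open [set x : P1 R | forall t, x = aff true t -> e < `|t - q|].
  by apply: open_nbhs_nbhs; split=> // t /esym/aff_infty.
rewrite /open /= /quotient_open.
pose h (v : hvec R) : C R := `|(set_val v).2 - q * (set_val v).1| - e * `|(set_val v).1|.
have hP (v : hvec R) : (forall t, hpoint v = aff true t -> e < `|t - q|) <-> 0 < h v.
  split=> [vt|].
    rewrite /h; have [v0|v0] := eqVneq (set_val v).1 0.
      have := hvec_neq0 v; rewrite v0 eqxx /= mulr0 subr0 normr0 mulr0 subr0 normr_gt0.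
      by [].
    have /vt := (hpoint_aff v ((set_val v).2 / (set_val v).1)).2 (conj v0 erefl).
    rewrite subr_gt0 => H; rewrite -ltr_pdivlMr ?normr_gt0 // -normf_div.
    by rewrite mulrBl mulfK.
  rewrite subr_gt0 => H t /hpoint_aff[v0 ->].
  by move: H; rewrite -ltr_pdivlMr ?normr_gt0 // -normf_div mulrBl mulfK.
have hc : continuous h.
  exact: continuous_far continuous_hvec1 continuous_hvec2.
have hr v : h v \is Num.real.
  apply: rpredB; first exact: normr_real.
  by apply: rpredM; [exact/ger0_real/ltW|exact: normr_real].
have nh (v : hvec R) : 0 < h v -> \forall w \near v, 0 < h w.
  move=> v0; have /cvgrPdist_lt/(_ _ v0) := hc v.
  apply: filterS => w; rewrite real_ltr_distl; last by apply: rpredB; exact: hr.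
  by move=> /andP[_]; rewrite ltrDr.
rewrite openE => v /hP/nh; apply: filterS => w.
by move/hP.
Qed.

End ProjectiveLine.

(** * Local degrees *)

Lemma continuous_affine (K : numFieldType) (u c : K) :
  continuous (fun t : K => u * (t - c)).
Proof.
move=> t; apply: (@continuousM _ _ (fun=> u) (fun t => t - c)).
  exact: cst_continuous.
exact: (@continuousB _ _ _ id (fun=> c) _ (@cvg_id _ _) (@cst_continuous _ _ _ _)).
Qed.

Section Boxes.
Variables (R : realType) (i j : 'I_4) (q : C R * C R) (e : C R).
Hypothesis e0 : 0 < e.
Implicit Types (x : P1x4 R).

Definition coord1 (x : P1 R) : C R := xget 0 [set t | x = aff true t].

Lemma coord1_aff t : coord1 (aff true t) = t.
Proof. by rewrite /coord1; case: xgetP => [s _ /aff_true_inj ->|/(_ t)/(_ erefl)]. Qed.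

Definition coord2 x : C R * C R :=
  ((coord1 (x i) - q.1) / e, (coord1 (x j) - q.2) / e).

Definition heights x : seq R :=
  [:: 0; complex.Re ((coord2 x).1 : R[i]); complex.Im ((coord2 x).1 : R[i]);
      complex.Re ((coord2 x).2 : R[i]); complex.Im ((coord2 x).2 : R[i])].

(** The vertex of the standard simplex whose barycentric coordinate is the
    largest; at the centre of the box all are equal. *)
Definition label x : nat :=
  [arg max_(k > ord0 : 'I_5) nth 0 (heights x) k]%O.

Lemma label_max x k : (k < 5)%N -> nth 0 (heights x) k <= nth 0 (heights x) (label x).
Proof.
move=> k5; rewrite /label; case: arg_maxP => // a _ amax.
exact: (amax (Ordinal k5)).
Qed.

Lemma label_lt x : (label x < 5)%N. Proof. exact: ltn_ord. Qed.

Definition over (U : set (C R * C R)) : set (P1x4 R) :=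
  [set x | exists z, [/\ U z, x i = aff true (q.1 + e * z.1) & x j = aff true (q.2 + e * z.2)]].

Lemma coord2_over z x : x i = aff true (q.1 + e * z.1) -> x j = aff true (q.2 + e * z.2) ->
  coord2 x = z.
Proof.
move=> xi xj; rewrite /coord2 xi xj !coord1_aff.
have e1 : e != 0 by rewrite gt_eqF.
have s (c w : C R) : (c + e * w - c) / e = w by rewrite addrAC subrr add0r mulrC mulKf.
by rewrite !s; case: z {xi xj}.
Qed.

Lemma nbhs_coord x (k : 'I_4) (t : C R) (A : set (C R)) : x k = aff true t -> nbhs t A ->
  \forall y \near x, exists2 s, y k = aff true s & A s.
Proof.
move=> xk /aff_nbhs H; rewrite -xk in H.
exact: (@proj_continuous _ _ k x _ H).
Qed.

Lemma open_over U : open U -> open (over U).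
Proof.
move=> oU; rewrite openE => x [z [Uz xi xj]].
have /= [[A B] /= [nA nB] AB] : nbhs z U by apply: open_nbhs_nbhs.
have e1 : e != 0 by rewrite gt_eqF.
have near_affine (c w : C R) (D : set (C R)) : nbhs w D ->
    nbhs (c + e * w) [set t | D ((t - c) / e)].
  move=> nD; have := @continuous_affine (C R) e^-1 c (c + e * w) D.
  rewrite addrAC subrr add0r mulKf // => /(_ nD).
  suff -> : [set t | D ((t - c) / e)] = [set t | D (e^-1 * (t - c))] by [].
  by apply/seteqP; split=> t /=; rewrite [_ / e]mulrC.
have := nbhs_coord xi (near_affine q.1 _ _ nA).
have := nbhs_coord xj (near_affine q.2 _ _ nB).
apply: (@filterS2 _ _ (nbhs_filter (x : P1x4 R))) => y [s ys Bs] [t yt At].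
exists ((t - q.1) / e, (s - q.2) / e); split => /=.
- exact: (AB (_, _)).
- by rewrite mulrC divfK // addrC subrK.
- by rewrite mulrC divfK // addrC subrK.
Qed.

Lemma open_polydisc : open (@polydisc R).
Proof.
have H (c : C R) : `|c| < 1 -> nbhs c (ball (0 : C R) 1).
  move=> c1; apply: open_nbhs_nbhs; split; first exact: ball_open.
  by rewrite -ball_normE /= sub0r normrN.
rewrite openE => -[a b] [/= /H a1 /H b1].
exists (ball (0 : C R) 1, ball (0 : C R) 1); first by split; [exact: a1|exact: b1].
by move=> [c d] [/= c1 d1]; move: c1 d1; rewrite -ball_normE /ball_ /= !sub0r !normrN.
Qed.

Definition box := over (@polydisc R).

Lemma near_Re (u c t : C R) : 0 < complex.Re (u * (t - c) : R[i]) ->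
  \forall s \near t, 0 < complex.Re (u * (s - c) : R[i]).
Proof.
move=> t0; have H := @continuous_affine (C R) u c t.
have r0 : (0 : C R) < ((complex.Re (u * (t - c) : R[i]))%:C)%C by rewrite (ltcR 0).
have /cvgrPdist_lt/(_ _ r0) := H.
apply: filterS => s st.
have := le_lt_trans (normc_ge_Re (u * (t - c) - u * (s - c) : R[i])) st.
rewrite ltcR raddfB /= => /(le_lt_trans (ler_norm _)); lra.
Qed.

Lemma coord_direction (w : C R) : w != 0 -> exists u k k', [/\ (k < 3)%N, (k' < 3)%N,
  0 < complex.Re (u * w : R[i]) & forall w' : C R, 0 < complex.Re (u * w' : R[i]) ->
  nth 0 [:: 0; complex.Re (w' : R[i]); complex.Im (w' : R[i])] k <
  nth 0 [:: 0; complex.Re (w' : R[i]); complex.Im (w' : R[i])] k'].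
Proof.
case: w => a b w0.
have [a0|a0|a0] := ltgtP a 0.
- exists (-1), 1%N, 0%N; split=> //= [|[c d]] /=; lra.
- exists 1, 0%N, 1%N; split=> //= [|[c d]] /=; lra.
have [b0|b0|b0] := ltgtP b 0.
- exists (Complex 0 1), 2%N, 0%N; split=> //= [|[c d]] /=; lra.
- exists (Complex 0 (-1)), 0%N, 2%N; split=> //= [|[c d]] /=; lra.
by case/eqP: w0; rewrite a0 b0.
Qed.

(** Away from the centre some coordinate is nonzero, and one of the inequalities
    between its real part, its imaginary part and zero persists nearby; the
    point at infinity is far from the box. *)
Lemma label_avoid x : ~ (x i = aff true q.1 /\ x j = aff true q.2) ->
  exists k, (k < 5)%N /\ \forall y \near x, box y -> label y <> k.
Proof.
have e1 : e != 0 by rewrite gt_eqF.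
(* [off] is the position of the coordinate [m] in the list of heights *)
have main (m : 'I_4) (c : C R) (off : nat) : (off <= 2)%N ->
    (forall y a, (a < 3)%N -> nth 0 (heights y) (if a is 0 then 0 else a + off)%N =
      let w := (coord1 (y m) - c) / e : R[i] in nth 0 [:: 0; complex.Re w; complex.Im w] a) ->
    (forall y, box y -> exists2 z : C R, `|z| < 1 & y m = aff true (c + e * z)) ->
    x m <> aff true c ->
    exists k, (k < 5)%N /\ \forall y \near x, box y -> label y <> k.
  move=> off2 hm bm xm.
  have [[t xt]|xinf] := P1_cases (x m); last first.
    exists 0%N; split=> //; have := @infty_nbhs R c e e0; rewrite -xinf => H.
    have := @proj_continuous _ _ m x _ H.
    apply: (@filterS _ _ (nbhs_filter (x : P1x4 R))) => y /= yfar by_ _.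
    have [z z1 yz] := bm y by_; have := yfar _ yz.
    rewrite addrAC subrr add0r normrM gtr0_norm // ltr_pMr // => /lt_trans /(_ z1).
    by rewrite ltxx.
  have w0 : (t - c) / e != 0.
    by rewrite mulf_neq0 ?invr_eq0 // subr_eq0; apply: contra_notN xm => /eqP <-.
  have [u [k [k' [k3 k'3 up uP]]]] := coord_direction w0.
  exists (if k is 0 then 0 else k + off)%N; split; first by case: (k) k3; lia.
  have near_t : \forall s \near t, 0 < complex.Re (u * ((s - c) / e) : R[i]).
    have := @near_Re (u / e) c t; rewrite mulrAC -mulrA => /(_ up).
    by apply: filterS => s; rewrite mulrAC -mulrA.
  have := nbhs_coord xt near_t.
  apply: (@filterS _ _ (nbhs_filter (x : P1x4 R))) => y [s ys sp] _ laby.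
  have := @label_max y (if k' is 0 then 0 else k' + off)%N.
  have -> : ((if k' is 0 then 0 else k' + off) < 5)%N by case: (k') k'3; lia.
  rewrite laby !hm // ys coord1_aff /= => /(_ isT).
  by rewrite leNgt uP.
move=> xq; have [xi|xi] := pselect (x i = aff true q.1); last first.
  apply: (main i q.1 0%N) => //.
    by move=> y [|[|[|]]].
  by move=> y [z [[z1 _] yi _]]; exists z.1.
apply: (main j q.2 2%N) => //; last by move=> xj; apply: xq.
  by move=> y [|[|[|]]].
by move=> y [z [[_ z2] _ yj]]; exists z.2.
Qed.

(** The determinant of the labels, cut off outside [S]; the cut-off does no harm
    near points where a label is missing. *)
Definition local_degree (S : set (P1x4 R)) (y : seq (P1x4 R)) : int :=
  if `[< forall x, List.In x y -> S x >] then perm_sign 5 (map label y) else 0.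

End Boxes.

Lemma is_diff_affine1 (K : numFieldType) (c e : K) (z : K * K) :
  is_diff z (fun z : K * K => c + e * z.1) (fun v => e * v.1).
Proof.
have l1 : continuous (@fst K K) by move=> ?; exact: cvg_fst.
have D := is_diffD (is_diff_cst c z)
  (is_diffZ e (DiffDef _ (@linear_differentiable _ _ _ _ z l1) (@diff_lin _ _ _ _ z l1))).
apply: (is_diff_eq D); apply/funext => v /=; exact: add0r.
Qed.

Lemma is_diff_affine2 (K : numFieldType) (c e : K) (z : K * K) :
  is_diff z (fun z : K * K => c + e * z.2) (fun v => e * v.2).
Proof.
have l1 : continuous (@snd K K) by move=> ?; exact: cvg_snd.
have D := is_diffD (is_diff_cst c z)
  (is_diffZ e (DiffDef _ (@linear_differentiable _ _ _ _ z l1) (@diff_lin _ _ _ _ z l1))).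
apply: (is_diff_eq D); apply/funext => v /=; exact: add0r.
Qed.

Section LocalDegree.
Variables (R : realType) (i j : 'I_4) (q : C R * C R) (e : C R).
Hypothesis e0 : 0 < e.
Implicit Types (x : P1x4 R) (S X V : set (P1x4 R)).

Local Notation label := (label i j q e).
Local Notation ldeg := (local_degree i j q e).
Local Notation bx := (box i j q e).

Lemma local_degree_in S y : (forall x, List.In x y -> S x) ->
  ldeg S y = perm_sign 5 (map label y).
Proof. by move=> yS; rewrite /local_degree asboolT. Qed.

Lemma local_degree_avoid S y k : size y = 5%N -> (k < 5)%N ->
  (forall x, List.In x y -> S x -> label x <> k) -> ldeg S y = 0.
Proof.
move=> sy k5 yk; rewrite /local_degree; case: asboolP => // yS.
apply: (@perm_sign_missing 5 _ (Ordinal k5)); first by rewrite size_map.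
by apply/negP => /mapP[x /InP xy kx]; apply: (yk x xy (yS x xy)).
Qed.

Lemma bd0 (T : Type) (y : seq T) : bd (fun=> 0) y = 0.
Proof. by elim: y => [//|a y IH] /=; rewrite IH subr0. Qed.

(** Near such a point a label is missing, and the local degree vanishes. *)
Definition null_at S X x := exists O, [/\ nbhs x O & exists k, (k < 5)%N /\
  forall y, X y -> O y -> S y -> label y <> k].

(** Near such a point the local degree is a cocycle. *)
Definition good_at S X x :=
  (exists O, nbhs x O /\ forall y, X y -> O y -> S y) \/ null_at S X x.

Lemma local_degree_null S X x : null_at S X x ->
  exists2 O, nbhs x O & forall y, size y = 5%N ->
    (forall a, List.In a y -> X a /\ O a) -> ldeg S y = 0.
Proof.
move=> [U [nU [k [k5 Uk]]]]; exists U => // y sy yU.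
by apply: (@local_degree_avoid S y k) => // a /yU[]; exact: Uk.
Qed.

Lemma local_degree_good S X x : good_at S X x ->
  exists2 O, nbhs x O & forall y, size y = 6%N ->
    (forall a, List.In a y -> X a /\ O a) -> bd (ldeg S) y = 0.
Proof.
move=> [[U [nU US]]|[U [nU [k [k5 Uk]]]]]; exists U => // y sy yU; last first.
  rewrite -(bd0 y); apply: eq_bd => y' sy' y'y.
  apply: (@local_degree_avoid S y' k) => //; first by move: sy'; rewrite sy => -[].
  move=> a ay'; have [Xa Ua] := y'y (fun a => X a /\ U a) yU a ay'.
  exact: Uk.
rewrite (@eq_bd _ _ (fun y => perm_sign 5 (map label y))) => [|y' _ y'y]; last first.
  apply: local_degree_in => a ay'.
  by have [Xa Ua] := y'y (fun a => X a /\ U a) yU a ay'; exact: US.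
rewrite bd_map; apply: bd_perm_sign; first by rewrite size_map.
by apply/allP => h /mapP[x' _ ->]; exact: label_lt.
Qed.

Lemma null_at_off S X x : (forall y, X y -> S y -> bx y) ->
  ~ (x i = aff true q.1 /\ x j = aff true q.2) -> null_at S X x.
Proof.
move=> SN /(label_avoid e0)[k [k5 nk]]; exists [set y | bx y -> label y <> k]; split=> //.
by exists k; split=> // y Xy Oy Sy; apply: Oy; exact: SN.
Qed.

Definition sheet_point (f : 'I_4 -> C R * C R -> C R) z : P1x4 R :=
  param (fun=> true) f z.

(** The sheets are graphs over the box because their coordinates [i] and [j] are
    fixed; the open sets [W t] make each of them open in [V]. *)
Definition sheeted V m (f : 'I_m -> 'I_4 -> C R * C R -> C R)
    (W : 'I_m -> set (P1x4 R)) : Prop :=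
  [/\ forall t k z, polydisc z -> differentiable (f t k) z,
      forall t z, f t i z = q.1 + e * z.1 /\ f t j z = q.2 + e * z.2,
      (forall t, open (W t)) /\ (forall t t' x, W t x -> W t' x -> t = t'),
      forall x, V x -> bx x -> exists t z, polydisc z /\ x = sheet_point (f t) z &
      forall t z, polydisc z -> V (sheet_point (f t) z) /\ W t (sheet_point (f t) z)].

Lemma sheet_coord2 (f : 'I_4 -> C R * C R -> C R) z :
  f i z = q.1 + e * z.1 -> f j z = q.2 + e * z.2 ->
  coord2 i j q e (sheet_point f z) = z.
Proof. by move=> fi fj; apply: coord2_over => //; rewrite /sheet_point /param ?fi ?fj. Qed.

Lemma sheet_box (f : 'I_4 -> C R * C R -> C R) z : polydisc z ->
  f i z = q.1 + e * z.1 -> f j z = q.2 + e * z.2 -> bx (sheet_point f z).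
Proof. by move=> z1 fi fj; exists z; rewrite /sheet_point /param fi fj. Qed.

(** The coordinates [i] and [j] of a sheet are the affine coordinates of the
    box, so a sheet is the graph of a map and has no critical points. *)
Lemma sheet_chart V m (f : 'I_m -> 'I_4 -> C R * C R -> C R) W t :
  sheeted V f W -> holomorphic_chart V (fun=> true) (f t).
Proof.
move=> [df fij [oW Wd] Vf fV]; have e1 : e != 0 by rewrite gt_eqF.
have inj z z' : sheet_point (f t) z = sheet_point (f t) z' -> z = z'.
  have [fi fj] := fij t z; have [fi' fj'] := fij t z'.
  by move=> zz; rewrite -(sheet_coord2 fi fj) zz sheet_coord2.
split.
- by move=> k z; exact: df.
- move=> z z1 v dv.
  have -> : v = (v.1, v.2) by case: (v).
  have f1 : f t i = (fun z => q.1 + e * z.1) by apply/funext => w; have [] := fij t w.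
  have f2 : f t j = (fun z => q.2 + e * z.2) by apply/funext => w; have [] := fij t w.
  have D1 := @diff_val _ _ _ _ _ _ _ (is_diff_affine1 q.1 e z).
  have D2 := @diff_val _ _ _ _ _ _ _ (is_diff_affine2 q.2 e z).
  have d1 := dv i; rewrite f1 in d1; have E1 := congr1 (fun h => h v) D1.
  have d2 := dv j; rewrite f2 in d2; have E2 := congr1 (fun h => h v) D2.
  have {E1 d1}/eqP : e * v.1 = 0 := etrans (esym E1) d1.
  have {E2 d2}/eqP : e * v.2 = 0 := etrans (esym E2) d2.
  by rewrite !mulf_eq0 (negbTE e1) /= => /eqP -> /eqP ->.
- by move=> z z' _ _; exact: inj.
move=> U oU U1; exists (W t `&` over i j q e U); split.
  by apply: openI => //; exact: open_over.
apply/seteqP; split=> x.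
  move=> [z Uz <-]; have [Vz Wz] := fV t z (U1 z Uz); split=> //; split=> //.
  by have [fi fj] := fij t z; exists z; rewrite /param fi fj.
move=> [Vx [Wx [z [Uz xi xj]]]].
have [|t' [z' [z'1 xE]]] := Vf x Vx; first by exists z; split=> //; exact: U1.
have tt : t' = t.
  by apply: (Wd _ _ x) => //; rewrite xE; have [] := fV t' z' z'1.
have [fi fj] := fij t z'.
exists z => //; rewrite xE tt; congr param.
by rewrite -(coord2_over e0 xi xj) xE tt sheet_coord2.
Qed.

End LocalDegree.

(** * Counting sheets by degrees *)

Section SheetedDegree.
Variable R : realType.

Lemma eval_sd_sum (T : topologicalType) n N I (r : seq I) (F : I -> seq T -> int)
    (c : singular_chain R T n) :
  eval_sd N (fun y => \sum_(t <- r) F t y) c = \sum_(t <- r) eval_sd N (F t) c.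
Proof.
have ev0 : eval_sd N (fun=> 0) c = 0.
  rewrite -[RHS](subrr (eval_sd N (fun=> 0) c)) -eval_sdBf.
  by congr (eval_sd _ _ _); apply/funext => y; rewrite subrr.
elim: r => [|a r IH].
  by rewrite big_nil -[RHS]ev0; congr (eval_sd _ _ _); apply/funext => y; rewrite big_nil.
rewrite big_cons -IH.
rewrite -[X in _ + X]opprK -[X in _ - X]sub0r -[X in X - eval_sd _ _ _]ev0 -!eval_sdBf.
by congr (eval_sd _ _ _); apply/funext => y; rewrite big_cons sub0r opprK.
Qed.

Lemma norm_half_lt1 (a b : R) : `|a| <= 1 / 2 -> `|b| <= 1 / 2 -> `|Complex a b : C R| < 1.
Proof.
move=> a1 b1; rewrite [ltLHS]normc_def /= (ltcR _ 1) -sqrtr1 ltr_sqrt //.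
by move: a1 b1; rewrite !ler_norml => /andP[? ?] /andP[? ?]; nra.
Qed.

Lemma orientation_polydisc (x : simplex R 4) : polydisc (orientation_simplex x).
Proof.
have [x0 x1] := set_valP x.
have b k : `|(set_val x ord0 (inord k) - set_val x ord0 ord0) / 2| <= 1 / 2.
  have := std_simplex_le1 (inord k) (set_valP x); have := x0 (inord k).
  have := std_simplex_le1 ord0 (set_valP x); have := x0 ord0.
  by rewrite ler_norml -!set_valE => *; apply/andP; split; lra.
by split; apply: norm_half_lt1; apply: b.
Qed.

Section Degree.
Variables (i j : 'I_4) (q : C R * C R) (e : C R).
Hypothesis e0 : 0 < e.
Local Notation label := (label i j q e).
Local Notation ldeg := (local_degree i j q e).
Local Notation bx := (box i j q e).

(** The heights of a point of the orientation simplex are, up to a common shift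
    and scale, its barycentric coordinates. *)
Lemma label_orientation (f : 'I_4 -> C R * C R -> C R) (x : 'rV[R]_5) :
    (forall z, f i z = q.1 + e * z.1 /\ f j z = q.2 + e * z.2) -> std_simplex x ->
  exists2 k : 'I_5, label (sheet_point f (orientation_simplex (to_simplex x))) = k :> nat &
    x ord0 k != 0.
Proof.
move=> fij xS; set y := sheet_point f _.
exists (Ordinal (label_lt i j q e y)) => //; apply/negP => /eqP xl.
have hy k : (k < 5)%N -> nth 0 (heights i j q e y) k = (x ord0 (inord k) - x ord0 ord0) / 2.
  move=> k5; have [fi fj] := fij (orientation_simplex (to_simplex x)).
  rewrite /heights (sheet_coord2 e0 fi fj) /orientation_simplex to_simplexK //.
  case: k k5 => [|[|[|[|[|//]]]]] _ //=.
  by rewrite (_ : inord 0 = ord0) ?subrr ?mul0r //; apply/val_inj; rewrite /= inordK.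
have [x0 x1] := xS.
suff : \sum_k x ord0 k = 0 by rewrite x1 => /eqP; rewrite oner_eq0.
apply: big1 => k _; apply/eqP; rewrite eq_le x0 andbT.
have := label_max i j q e y (ltn_ord k); rewrite !hy ?label_lt // inord_val.
have -> : inord (label y) = Ordinal (label_lt i j q e y).
  by apply: val_inj; rewrite /= inordK // label_lt.
rewrite xl; lra.
Qed.

Lemma over_center_box x : x i = aff true q.1 -> x j = aff true q.2 -> bx x.
Proof.
by move=> xi xj; exists (0, 0); split; rewrite /= ?mulr0 ?addr0 // /polydisc /= normr0 ltr01.
Qed.

(** Near the centre of the box every small simplex of [V] lies on one sheet, so
    the local degree splits into contributions of the sheets; for each of them
    the cycle may be replaced by the orientation simplex, which has degree 1. *)
Lemma sheeted_degree V m (f : 'I_m -> 'I_4 -> C R * C R -> C R) W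
    (z : singular_chain R (P1x4 R) 4) :
    sheeted i j q e V f W -> fundamental_cycle V z ->
  \forall N \near \oo, eval_sd N (ldeg bx) z = m%:Z.
Proof.
move=> sh [zV dz fund]; have [df fij [oW Wd] Vf fV] := sh.
pose S t := V `&` (bx `&` W t).
have oO t : open (bx `&` W t) by apply: openI => //; apply: open_over => //; exact: open_polydisc.
have nO t x : bx x -> W t x -> nbhs x (bx `&` W t) by move=> *; exact: open_nbhs_nbhs.
have overP x : V x -> x i = aff true q.1 -> x j = aff true q.2 ->
    bx x /\ exists t, W t x /\ x = sheet_point (f t) 0.
  move=> Vx xi xj; have bxx := over_center_box xi xj; split=> //.
  have [t [w [w1 xE]]] := Vf x Vx bxx; exists t.
  have [fi fj] := fij t w; have [_ Wx] := fV t w w1; rewrite xE; split=> //; congr sheet_point.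
  rewrite -(sheet_coord2 e0 fi fj) -xE; apply: coord2_over => //=; by rewrite mulr0 addr0.
have St t : (forall y, V y -> S t y -> bx y) by move=> y _ [_ []].
have St' t t' : t' <> t -> forall y, V y -> (bx `&` W t') y -> S t y -> False.
  by move=> tt y _ [_ W'] [_ [_ Wy]]; apply: tt; exact: Wd Wy.
have good t x : V x -> good_at i j q e (S t) V x.
  move=> Vx; have [[xi xj]|xq] := pselect (x i = aff true q.1 /\ x j = aff true q.2); last first.
    by right; apply: null_at_off => //; exact: St.
  have [bxx [t' [Wx _]]] := overP x Vx xi xj.
  have [<-|tt] := pselect (t' = t).
    by left; exists (bx `&` W t'); split; [exact: nO|].
  right; exists (bx `&` W t'); split; first exact: nO.
  by exists 0%N; split=> // y Vy Oy /(St' t t' tt y Vy Oy).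
have null t x : (V `\ param (fun=> true) (f t) 0) x ->
    null_at i j q e (S t) (V `\ param (fun=> true) (f t) 0) x.
  move=> [Vx xt]; have [[xi xj]|xq] := pselect (x i = aff true q.1 /\ x j = aff true q.2); last first.
    by apply: null_at_off => // y [Vy _]; exact: St.
  have [bxx [t' [Wx xE]]] := overP x Vx xi xj.
  have tt : t' <> t by move=> tt; apply: xt; rewrite xE tt.
  exists (bx `&` W t'); split; first exact: nO.
  by exists 0%N; split=> // y [Vy _] Oy /(St' t t' tt y Vy Oy).
have one t : \forall N \near \oo, eval_sd N (ldeg (S t)) z = 1.
  have [d [b [dV bV zE]]] := fund _ _ (sheet_chart e0 t sh).
  have [N1 HN1] := eval_sd_local dV (fun x Vx => local_degree_good (good t x Vx)).
  have [N2 HN2] := eval_sd_local bV (fun x Vx => local_degree_null (null t x Vx)).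
  exists (maxn N1 N2) => // N /=; rewrite geq_max => /andP[NN1 NN2].
  have := congr1 (eval_sd N (ldeg (S t))) zE.
  rewrite eval_sdB eval_sdD eval_sd_boundary HN1 // HN2 // addr0 => /eqP.
  rewrite subr_eq0 => /eqP ->; rewrite eval_sdU.
  have vS := @vertices_simplex R 4.
  rewrite -(@sperner R N 4 (fun x => label (sheet_point (f t) (orientation_simplex (to_simplex x))))).
    apply: (eq_sdN_in N (@std_simplex_bary_convex R 4) vS) => y _ yS.
    rewrite local_degree_in.
      by rewrite -map_comp; congr perm_sign.
    move=> x /InP/mapP[w _ ->] /=.
    have w1 := orientation_polydisc (to_simplex w).
    have [fi fj] := fij t (orientation_simplex (to_simplex w)).
    have [Vw Ww] := fV t _ w1; split=> //; split=> //.
    exact: sheet_box.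
  by move=> x xS; apply: label_orientation.
have [N1 HN1] : exists N1, forall N, (N1 <= N)%N ->
    eval_sd N (fun y => ldeg bx y - \sum_(t <- enum 'I_m) ldeg (S t) y) z = 0.
  apply: (eval_sd_local zV) => x Vx.
  have [[xi xj]|xq] := pselect (x i = aff true q.1 /\ x j = aff true q.2); last first.
    have [k [k5 nk]] := label_avoid e0 xq.
    exists [set y | bx y -> label y <> k] => // y sy yO.
    rewrite (local_degree_avoid sy k5) => [|a /yO[]] //.
    rewrite big1 ?subrr // => t _; apply: (local_degree_avoid sy k5) => a /yO[Va Oa] [_ [ba _]].
    exact: Oa.
  have [bxx [t' [Wx xE]]] := overP x Vx xi xj.
  exists (bx `&` W t'); first exact: nO.
  move=> y sy yO; rewrite (bigD1_seq t') ?mem_enum ?enum_uniq //= big1 ?addr0; last first.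
    move=> t tt; apply: (local_degree_avoid sy (isT : 0 < 5)%N) => a /yO[Va Oa].
    by move=> /(St' t t' _ a Va Oa) H; case: H => tt'; rewrite tt' eqxx in tt.
  rewrite !local_degree_in ?subrr // => a /yO[Va Oa] //.
  by case: Oa.
have all1 : \forall N \near \oo, forall t, eval_sd N (ldeg (S t)) z = 1.
  exact: filter_forall.
near=> N; have /eqP : eval_sd N (fun y => ldeg bx y - \sum_(t <- enum 'I_m) ldeg (S t) y) z = 0.
  by apply: HN1; near: N; exact: nbhs_infty_ge.
rewrite eval_sdBf eval_sd_sum subr_eq0 => /eqP ->.
under eq_bigr => t _ do rewrite (near all1 N) //.
by rewrite big_enum /= sumr_const card_ord natz.
Unshelve. all: by end_near. Qed.

End Degree.

Lemma coordinate_surfaceC (i j : 'I_4) : @coordinate_surface R i j = @coordinate_surface R j i.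
Proof. by apply/seteqP; split=> x xk k ki kj; apply: xk. Qed.

Lemma coordinate_surface_sheeted (i j : 'I_4) (q : C R * C R) (e : C R) :
    i != j ->
  exists f W, @sheeted R i j q e (@coordinate_surface R i j) 1 f W.
Proof.
move=> ij; pose f (k : 'I_4) (z : C R * C R) :=
  if k == i then q.1 + e * z.1 else if k == j then q.2 + e * z.2 else 0.
exists (fun=> f), (fun=> setT).
have fi z : f i z = q.1 + e * z.1 by rewrite /f eqxx.
have fj z : f j z = q.2 + e * z.2 by rewrite /f eqxx eq_sym (negbTE ij).
split=> //.
- move=> _ k z _; rewrite /f; have [_|_] := eqVneq k i.
    exact: (@ex_diff _ _ _ _ _ _ _ (is_diff_affine1 q.1 e z)).
  have [_|_] := eqVneq k j.
    exact: (@ex_diff _ _ _ _ _ _ _ (is_diff_affine2 q.2 e z)).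
  exact: differentiable_cst.
- by split=> [t|t t' *]; [exact: openT|rewrite !ord1].
- move=> x xk [z [z1 xi xj]]; exists ord0, z; split=> //.
  apply/funext => k; rewrite /sheet_point /param.
  have [->|ki] := eqVneq k i; first by rewrite fi.
  have [->|kj] := eqVneq k j; first by rewrite fj.
  by rewrite xk // /f (negbTE ki) (negbTE kj).
- move=> _ z _; split=> // k ki kj.
  by rewrite /sheet_point /param /f (negbTE ki) (negbTE kj).
Qed.

Lemma off_box_sheeted (i j : 'I_4) (q : C R * C R) (e : C R) V :
    (forall x, V x -> ~ box i j q e x) ->
  exists f W, @sheeted R i j q e V 0 f W.
Proof.
move=> Vb; exists (fun=> fun=> fun=> 0), (fun=> setT); split=> //; try by case.
- by split; case.
- by move=> x /Vb.
Qed.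

(** Both sides are values of the same cochain on homologous cycles.  The bounds
    on [e] keep the coordinates of the box away from zero, where the coordinate
    surfaces in other directions lie. *)
Theorem eta_sheets (p : 'I_4 -> 'I_4 -> int) (V : set (P1x4 R)) c z
    (i j : 'I_4) (q : C R * C R) (e : C R) m f W :
    (forall a b, p a b = p b a) ->
    represents_eta p c -> fundamental_cycle V z -> homologous setT set0 c z ->
    i != j -> 0 < e -> e <= `|q.1| -> e <= `|q.2| ->
    @sheeted R i j q e V m f W ->
  p i j = m%:Z.
Proof.
move=> psym [l lf cE] Vz [d [b [dT b0 czE]]] ij e0 eq1 eq2 sh.
pose mt (a b : 'I_4) := ((a == i) && (b == j)) || ((a == j) && (b == i)).
(* the coordinate surface in the directions [i, j] has one sheet, and the others
   miss the box *)
have cs (a b' : 'I_4) : (a < b')%N -> \forall N \near \oo,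
    eval_sd N (local_degree i j q e (box i j q e)) (l a b') = (mt a b')%:R.
  move=> ab; have fl := lf a b' ab; case h : (mt a b'); rewrite /mt in h.
    have {h}E : @coordinate_surface R a b' = @coordinate_surface R i j.
      by case/orP: h => /andP[/eqP-> /eqP->] //; rewrite coordinate_surfaceC.
    rewrite E in fl; have [g [W' sh']] := @coordinate_surface_sheeted i j q e ij.
    exact: (sheeted_degree e0 sh' fl).
  have off x : @coordinate_surface R a b' x -> ~ box i j q e x.
    move=> xk [w [[w1 w2] xi xj]].
    have z0 (k : 'I_4) (u v : C R) : e <= `|u| -> `|v| < 1 -> k != a -> k != b' ->
        x k <> aff true (u + e * v).
      move=> eu v1 ka kb; rewrite xk // => /aff_true_inj/esym/eqP.
      rewrite addr_eq0 => /eqP uE; move: eu.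
      by rewrite uE normrN normrM gtr0_norm // ler_pMr // => /le_lt_trans/(_ v1); rewrite ltxx.
    have [ia|ia] := eqVneq a i; last first.
      have [ib|ib] := eqVneq b' i; last by apply: (z0 i q.1 w.1) => //; rewrite eq_sym.
      have [ja|ja] := eqVneq a j; first by rewrite ib ja !eqxx orbT in h.
      by apply: (z0 j q.2 w.2) => //; rewrite eq_sym // ib.
    have [jb|jb] := eqVneq b' j; first by rewrite ia jb !eqxx in h.
    by apply: (z0 j q.2 w.2) => //; rewrite eq_sym // ia.
  have [g [W' sh']] := off_box_sheeted off.
  exact: (sheeted_degree e0 sh' fl).
have goodT x : setT x -> good_at i j q e (box i j q e) setT x.
  move=> _; have [[xi xj]|xq] := pselect (x i = aff true q.1 /\ x j = aff true q.2).
    left; exists (box i j q e); split=> //; apply: open_nbhs_nbhs; split.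
      by apply: open_over => //; exact: open_polydisc.
    exact: over_center_box.
  by right; apply: null_at_off.
have [N1 HN1] := eval_sd_local dT (fun x Tx => local_degree_good (goodT x Tx)).
have [N2 HN2] := @eval_sd_local _ _ _ (local_degree i j q e (box i j q e)) _ _ b0
  (fun x (x0 : set0 x) => False_ind _ x0).
have cs_all : \forall N \near \oo, forall ab : 'I_4 * 'I_4, (ab.1 < ab.2)%N ->
    eval_sd N (local_degree i j q e (box i j q e)) (l ab.1 ab.2) = (mt ab.1 ab.2)%:R.
  apply: filter_forall => -[a b'] /=; have [ab|ab] := boolP (a < b')%N.
    by have H := cs a b' ab; apply: filterS H => N E _.
  by near=> N.
near \oo => N.
have := congr1 (eval_sd N (local_degree i j q e (box i j q e))) czE.
rewrite eval_sdB eval_sdD eval_sd_boundary HN1 ?HN2; first last.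
- by near: N; exact: nbhs_infty_ge.
- by near: N; exact: nbhs_infty_ge.
have -> : eval_sd N (local_degree i j q e (box i j q e)) z = m%:Z.
  by near: N; exact: (sheeted_degree e0 sh Vz).
have evs (I : Type) (r : seq I) P (F : I -> singular_chain R (P1x4 R) 4) :
    eval_sd N (local_degree i j q e (box i j q e)) (\sum_(a <- r | P a) F a) =
    \sum_(a <- r | P a) eval_sd N (local_degree i j q e (box i j q e)) (F a).
  exact: chain_eval_sum.
rewrite addr0 cE evs => /eqP; rewrite subr_eq0 => /eqP <-.
have csN : forall ab : 'I_4 * 'I_4, (ab.1 < ab.2)%N ->
    eval_sd N (local_degree i j q e (box i j q e)) (l ab.1 ab.2) = (mt ab.1 ab.2)%:R.
  by near: N; exact: cs_all.
rewrite (eq_bigr (fun a : 'I_4 => \sum_(b1 < 4 | (a < b1)%N) p a b1 * (mt a b1)%:R)); last first.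
  move=> a _; rewrite evs; apply: eq_bigr => b' ab; rewrite eval_sdZ.
  by have /= -> := csN (a, b') ab.
rewrite pair_big_dep /=.
have main (a b' : 'I_4) : (a < b')%N -> mt a b' ->
    \sum_(ab : 'I_4 * 'I_4 | (ab.1 < ab.2)%N) p ab.1 ab.2 * (mt ab.1 ab.2)%:R = p a b'.
  move=> ab mab; rewrite (bigD1 (a, b')) //= mab mulr1 big1 ?addr0 // => -[c1 c2] /= /andP[c12 ne].
  have [mc|] := boolP (mt c1 c2); last by rewrite mulr0.
  suff /andP[/eqP c1a /eqP c2b] : (c1 == a) && (c2 == b') by rewrite c1a c2b eqxx in ne.
  move: mab mc ab c12; rewrite /mt -!val_eqE /=; lia.
have [ijl|jil|ije] := ltngtP i j.
- by rewrite (main i j) // /mt !eqxx.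
- by rewrite (main j i) // /mt !eqxx orbT.
- by case/eqP: ij; apply: val_inj.
Unshelve. all: by end_near. Qed.
End SheetedDegree.

(** * Prime ideals of iterated polynomial rings *)

Section PrimeIdeals.

Record prime_ideal (A : idomainType) (I : A -> Prop) : Prop := PrimeIdeal {
  prime_ideal0 : I 0;
  prime_idealD : forall a b, I a -> I b -> I (a + b);
  prime_idealMl : forall a b, I b -> I (a * b);
  prime_ideal1 : ~ I 1;
  prime_idealP : forall a b, I (a * b) -> I a \/ I b }.

Variables (A : idomainType) (I : A -> Prop).
Hypothesis pI : prime_ideal I.

Lemma prime_idealMr a b : I a -> I (a * b).
Proof. by rewrite mulrC; apply: (prime_idealMl pI). Qed.

Lemma prime_idealN a : I a -> I (- a).
Proof. by rewrite -mulN1r; apply: (prime_idealMl pI). Qed.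

Lemma prime_idealB a b : I a -> I b -> I (a - b).
Proof. by move=> Ia Ib; apply: (prime_idealD pI) => //; apply: prime_idealN. Qed.

Lemma prime_idealX a n : I (a ^+ n) -> I a.
Proof.
elim: n => [/(prime_ideal1 pI) //|n IH]; rewrite exprS.
by case/(prime_idealP pI) => //; exact: IH.
Qed.

Lemma prime_ideal_sum (J : Type) (r : seq J) (P : pred J) (F : J -> A) :
  (forall k, P k -> I (F k)) -> I (\sum_(k <- r | P k) F k).
Proof. by move=> IF; elim/big_ind: _ => //; [exact: prime_ideal0|exact: prime_idealD]. Qed.

End PrimeIdeals.

Lemma size_sub_lead (A : idomainType) (f : {poly A}) : f != 0 ->
  (size (f - lead_coef f *: 'X^((size f).-1))%R < size f)%N.
Proof.
move=> f0; rewrite [ltnRHS](polySpred f0) ltnS; apply/leq_sizeP => a ka.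
rewrite coefB coefZ coefXn; move: ka; rewrite leq_eqVlt => /orP[/eqP <-|ka].
  by rewrite eqxx mulr1 lead_coefE subrr.
by rewrite gtn_eqF // mulr0 subr0 nth_default // (polySpred f0).
Qed.

Section PolynomialStep.
Variables (A : idomainType) (I : {poly A} -> Prop).
Hypothesis pI : prime_ideal I.

Definition contract (c : A) : Prop := I c%:P.

Lemma prime_contract : prime_ideal contract.
Proof.
split; rewrite /contract.
- exact: (prime_ideal0 pI).
- by move=> a b Ia Ib; rewrite polyCD; apply: (prime_idealD pI).
- by move=> a b Ib; rewrite polyCM; apply: (prime_idealMl pI).
- exact: (prime_ideal1 pI).
- by move=> a b; rewrite polyCM; apply: (prime_idealP pI).
Qed.

Lemma ideal_coefs (p : {poly A}) : (forall k, contract p`_k) -> I p.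
Proof.
move=> pc; rewrite -[p]coefK poly_def; apply: (prime_ideal_sum pI) => // k _.
rewrite -mul_polyC; apply: (prime_idealMr pI); exact: pc.
Qed.

(** An element of least degree among those of [I] whose leading coefficient
    survives modulo the contraction: over the residue field of the contraction
    it is a minimal polynomial of the last variable. *)
Definition min_poly (g : {poly A}) : Prop :=
  [/\ I g, ~ contract (lead_coef g) &
      forall f, I f -> ~ contract (lead_coef f) -> (size g <= size f)%N].

Lemma min_poly_exists (f : {poly A}) k : I f -> ~ contract f`_k -> exists g, min_poly g.
Proof.
move=> If fk.
have [f1 [If1 lf1]] : exists f1, I f1 /\ ~ contract (lead_coef f1).
  have [n] := ubnP (size f); elim: n f If fk => [//|n IH] f If fk sf.
  have [lf|lf] := pselect (contract (lead_coef f)); last by exists f.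
  have f0 : f != 0.
    by apply: contra_notN fk => /eqP ->; rewrite coef0; exact: prime_ideal0 prime_contract.
  apply: (IH (f - lead_coef f *: 'X^((size f).-1))).
  - apply: (prime_idealB pI) => //; rewrite -mul_polyC; exact: (prime_idealMr pI).
  - rewrite coefB coefZ coefXn; case: eqP => [kE|_]; last by rewrite mulr0 subr0.
    by move=> _; apply: fk; rewrite kE.
  - exact: leq_trans (size_sub_lead f0) _.
have ex : exists n, `[< exists f, [/\ I f, ~ contract (lead_coef f) & size f = n] >].
  by exists (size f1); apply/asboolP; exists f1.
case: (ex_minnP ex) => n /asboolP[g [Ig lg sg]] gmin.
exists g; split=> // h Ih lh; rewrite sg; apply: gmin.
by apply/asboolP; exists h.
Qed.

Variable g : {poly A}.
Hypothesis gmin : min_poly g.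

(** An element of smaller degree loses its leading term modulo the contraction,
    and then the next one. *)
Lemma min_poly_small (f : {poly A}) : I f -> (size f < size g)%N -> forall k, contract f`_k.
Proof.
move=> If sf k; apply: contrapT => fk.
have [n] := ubnP (size f); elim: n f If fk sf => [//|n IH] f If fk sf sn.
have [_ _ gm] := gmin.
have [lf|lf] := pselect (contract (lead_coef f)); last first.
  by have := gm f If lf; rewrite leqNgt sf.
have f0 : f != 0.
  by apply: contra_notN fk => /eqP ->; rewrite coef0; exact: prime_ideal0 prime_contract.
have sm : (size (f - lead_coef f *: 'X^((size f).-1))%R < size f)%N.
  exact: size_sub_lead.
apply: (IH (f - lead_coef f *: 'X^((size f).-1))) => //.
- by apply: (prime_idealB pI) => //; rewrite -mul_polyC; exact: (prime_idealMr pI).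
- rewrite coefB coefZ coefXn; case: eqP => [kE|_]; last by rewrite mulr0 subr0.
  by move=> _; apply: fk; rewrite kE.
- exact: ltn_trans sf.
- exact: leq_trans sm _.
Qed.

Lemma min_poly_neq0 : g != 0.
Proof.
have [_ lg _] := gmin; apply: contra_notN lg => /eqP ->.
by rewrite lead_coef0; exact: prime_ideal0 prime_contract.
Qed.

Lemma min_poly_size : (1 < size g)%N.
Proof.
have [Ig lg _] := gmin; rewrite ltnNge; apply/negP => s1; apply: lg.
by move: Ig; rewrite (size1_polyC s1) lead_coefC.
Qed.

(** Pseudo-division by the minimal polynomial leaves a remainder that is zero
    over the residue field. *)
Lemma min_poly_reduce (f : {poly A}) : exists (n : nat) (h r : {poly A}),
  [/\ lead_coef g ^+ n *: f = h * g + r, (size r < size g)%N &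
      I f -> forall k, contract r`_k].
Proof.
exists (scalp f g), (f %/ g)%R, (f %% g)%R.
have E := Pdiv.Idomain.divp_eq f g; have s : (size (f %% g)%R < size g)%N.
  by rewrite Pdiv.Idomain.ltn_modp min_poly_neq0.
split=> // If; apply: min_poly_small => //.
have -> : (f %% g)%R = lead_coef g ^+ scalp f g *: f - (f %/ g)%R * g.
  by rewrite E addrAC subrr add0r.
have [Ig _ _] := gmin.
by apply: (prime_idealB pI) => //; rewrite -?mul_polyC; exact: (prime_idealMl pI).
Qed.

(** Over a zero of the contraction where its leading coefficient survives, a
    root of the minimal polynomial is a zero of the whole ideal, because the
    remainders vanish there. *)
Lemma min_poly_zeros (F : idomainType) (phi : {rmorphism {poly A} -> F}) :
    (forall c, contract c -> phi c%:P = 0) -> phi (lead_coef g)%:P != 0 ->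
    phi g = 0 ->
  forall f, I f -> phi f = 0.
Proof.
move=> pc pl pg f If; have [n [h [r [E _ rc]]]] := min_poly_reduce f.
have r0 : phi r = 0.
  rewrite -[r]coefK poly_def rmorph_sum big1 // => k _ /=.
  by rewrite -mul_polyC rmorphM /= pc ?mul0r //; exact: rc.
have /eqP := congr1 phi E; rewrite -mul_polyC rmorphD !rmorphM /= pg mulr0 r0 addr0.
by rewrite !rmorphXn /= mulf_eq0 expf_eq0 (negbTE pl) andbF /= => /eqP.
Qed.

(** Among the multiples of [f] modulo [I] whose leading coefficient survives,
    one of least degree must be a constant, since otherwise dividing the minimal
    polynomial by it would produce a smaller one. *)
Lemma min_poly_invert f : ~ I f -> exists s c, ~ contract c /\ I (s * f - c%:P).
Proof.
move=> If.
pose P n := `[< exists s r, [/\ ~ I r, I (s * f - r), size r = n & ~ contract (lead_coef r)] >].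
have strip (s r : {poly A}) : ~ I r -> I (s * f - r) ->
    exists2 n, (n <= size r)%N & P n.
  have [n] := ubnP (size r); elim: n r => [//|n IH] r sr Ir sfr.
  have [lr|lr] := pselect (contract (lead_coef r)); last first.
    by exists (size r) => //; apply/asboolP; exists s, r.
  have r0 : r != 0 by apply: contra_notN Ir => /eqP ->; exact: (prime_ideal0 pI).
  have Il : I (lead_coef r *: 'X^((size r).-1)) by rewrite -mul_polyC; exact: (prime_idealMr pI).
  have sm : (size (r - lead_coef r *: 'X^((size r).-1))%R < size r)%N.
    exact: size_sub_lead.
  have [||m mr Pm] := IH (r - lead_coef r *: 'X^((size r).-1)) (leq_trans sm sr).
  - by move=> H; apply: Ir; rewrite -[r](subrK (lead_coef r *: 'X^((size r).-1))); exact: (prime_idealD pI).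
  - rewrite opprB addrCA addrC.
    by apply: (prime_idealD pI).
  by exists m => //; apply: leq_trans mr (ltnW sm).
have ex : exists n, P n by have [|n _ Pn] := strip 1 f If; [rewrite mul1r subrr; exact: (prime_ideal0 pI)|exists n].
case: (ex_minnP ex) => n /asboolP[s [r [Ir sfr sr lr]]] nmin.
have r0 : r != 0 by apply: contra_notN Ir => /eqP ->; exact: (prime_ideal0 pI).
have [Ig lg gm] := gmin.
have [s1|s1] := leqP (size r) 1.
  have rE := size1_polyC s1; exists s, r`_0; split; last by rewrite -rE.
  by move: lr; rewrite {1}rE lead_coefC.
exfalso.
have E := Pdiv.Idomain.divp_eq g r; set l := lead_coef r ^+ _ in E.
set h := (g %/ r)%R in E; set r' := (g %% r)%R in E.
have sr' : (size r' < size r)%N by rewrite Pdiv.Idomain.ltn_modp.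
have r'E : r' = l *: g - h * r by rewrite E addrAC subrr add0r.
have Ilg : I (l *: g) by rewrite -mul_polyC; exact: (prime_idealMl pI).
have Ir' : ~ I r'.
  move=> Ir'; have /(prime_idealP pI)[Ih|//] : I (h * r).
    have -> : h * r = l *: g - r' by rewrite E addrK.
    exact: (prime_idealB pI).
  (* otherwise the remainder of [r] modulo [g], again a multiple of [f], is
     smaller *)
  have srg : (size r < size g)%N.
    have [k [h2 [r2 [E2 s2 _]]]] := min_poly_reduce r.
    have Ir2 : ~ I r2.
      move=> Ir2; have : I (lead_coef g ^+ k *: r).
        by rewrite E2; apply: (prime_idealD pI) => //; exact: (prime_idealMl pI).
      rewrite -mul_polyC rmorphXn /= => /(prime_idealP pI)[/(prime_idealX pI)/lg|/Ir] //.
    have [|m mr2 Pm] := strip (lead_coef g ^+ k *: s) r2 Ir2.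
      have -> : lead_coef g ^+ k *: s * f - r2 = lead_coef g ^+ k *: (s * f - r) + h2 * g.
        by rewrite scalerBr E2 -scalerAl; ring.
      apply: (prime_idealD pI); last exact: (prime_idealMl pI).
      by rewrite -mul_polyC; exact: (prime_idealMl pI).
    have := nmin m Pm; rewrite -sr => mr.
    by rewrite (leq_ltn_trans (leq_trans mr mr2)).
  have l0 : l != 0 by rewrite expf_neq0 // lead_coef_eq0.
  have slg : size (l *: g) = size g by rewrite size_scale.
  have hrE : h * r = l *: g - r' by rewrite E addrK.
  have sr'g : (size (- r')%R < size (l *: g)%R)%N by rewrite size_polyN slg (ltn_trans sr').
  have lh : lead_coef h * lead_coef r = l * lead_coef g.
    by rewrite -lead_coefM hrE lead_coefDl // lead_coefZ.
  have lhI : ~ contract (lead_coef h).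
    move=> Ilh; have : contract (l * lead_coef g).
      by rewrite -lh; exact: (prime_idealMr prime_contract).
    by case/(prime_idealP prime_contract) => // /(prime_idealX prime_contract).
  have h0 : h != 0.
    by apply: contra_notN lhI => /eqP ->; rewrite lead_coef0; exact: prime_ideal0 prime_contract.
  have := gm h Ih lhI; rewrite -slg -(size_polyDl sr'g) -hrE size_mul //.
  by move: s1; lia.
have [|m mr Pm] := strip (- h * s) r' Ir'.
  have -> : - h * s * f - r' = - h * (s * f - r) - l *: g.
    by rewrite r'E; ring.
  by apply: (prime_idealB pI) => //; exact: (prime_idealMl pI).
have := nmin m Pm; rewrite -sr leqNgt.
by rewrite (leq_ltn_trans mr sr').
Qed.

End PolynomialStep.

(** * Extension of zeros *)

Section IteratedPolynomials.
Variable F : numClosedFieldType.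

(** Iterated rather than simultaneous variables: what holds for polynomials in
    one variable over a domain applies to the last variable. *)
Fixpoint mp (n : nat) : idomainType :=
  if n is n'.+1 then {poly (mp n')} : idomainType else F.

Section Evaluation.
Variables (A : comNzRingType) (iota : {rmorphism F -> A}) (x : nat -> A).

Definition ev_commr n (f : {rmorphism mp n -> A}) : commr_rmorph f (x n) :=
  fun a => mulrC (x n) (f a).

Fixpoint evM (n : nat) : {rmorphism mp n -> A} :=
  match n return {rmorphism mp n -> A} with
  | 0 => iota
  | n'.+1 => horner_morph (ev_commr (evM n')) : {rmorphism {poly (mp n')} -> A}
  end.

Lemma evMC n (c : mp n) : evM n.+1 c%:P = evM n c.
Proof. exact: horner_morphC. Qed.

Lemma evMX n : evM n.+1 'X = x n.
Proof. exact: horner_morphX. Qed.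

Lemma evMS n (f : mp n.+1) : evM n.+1 f = (map_poly (evM n) f).[x n].
Proof. by []. Qed.

Lemma evM_coef n (f : mp n.+1) :
  evM n.+1 f = \sum_(k < size (f : {poly mp n})) evM n (f : {poly mp n})`_k * x n ^+ k.
Proof.
rewrite -{1}[f : {poly mp n}]coefK poly_def rmorph_sum; apply: eq_bigr => k _ /=.
by rewrite -mul_polyC rmorphM rmorphXn /= evMC evMX.
Qed.

End Evaluation.

Lemma eq_evM (A : comNzRingType) (iota : {rmorphism F -> A}) (x y : nat -> A) n (f : mp n) :
  (forall k, (k < n)%N -> x k = y k) -> evM iota x n f = evM iota y n f.
Proof.
elim: n f => [//|n IH] f xy; rewrite !evM_coef; apply: eq_bigr => k _.
by rewrite IH => [|m mn]; [rewrite xy|apply: xy; rewrite ltnW].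
Qed.

Definition ev (x : nat -> F) n : {rmorphism mp n -> F} := evM idfun x n.

Definition set_var (x : nat -> F) n y k := if k == n then y else x k.

Lemma ev_set_var x n y (f : mp n) : ev (set_var x n y) n f = ev x n f.
Proof. by apply: eq_evM => k kn; rewrite /set_var ltn_eqF. Qed.

Lemma ev_set_varS x n y (f : mp n.+1) :
  ev (set_var x n y) n.+1 f = (map_poly (ev x n) (f : {poly mp n})).[y].
Proof.
rewrite /ev evMS /set_var eqxx; congr (_.[_]); apply/polyP => k.
by rewrite !coef_map; exact: ev_set_var.
Qed.

Lemma ev_coefs0 x n (f : mp n.+1) :
  (forall k, ev x n (f : {poly mp n})`_k = 0) -> ev x n.+1 f = 0.
Proof. by move=> f0; rewrite /ev evM_coef big1 // => k _; rewrite f0 mul0r. Qed.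

Lemma closed_root (p : {poly F}) : (1 < size p)%N -> exists y, p.[y] = 0.
Proof.
move=> sp; have /closed_rootP[y /eqP ry] : size p != 1 by rewrite gtn_eqF.
by exists y.
Qed.

Lemma exists_nonroot (p : {poly F}) : p != 0 -> exists y, p.[y] != 0.
Proof.
move=> p0; pose s := [seq k%:R : F | k <- iota 0 (size p)].
have us : uniq s.
  by rewrite map_inj_uniq ?iota_uniq // => a b /eqP; rewrite eqr_nat => /eqP.
have : ~~ all (root p) s.
  by apply/negP => /(max_poly_roots p0) /(_ us); rewrite size_map size_iota ltnn.
by move=> /allPn[y _ ry]; exists y.
Qed.

Lemma exists_nonzero n (f : mp n) : f != 0 -> exists x, ev x n f != 0.
Proof.
elim: n f => [|n IH] f f0; first by exists (fun=> 0).
have lf : lead_coef (f : {poly mp n}) != 0 by rewrite lead_coef_eq0.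
have [x xl] := IH _ lf.
have pf : map_poly (ev x n) (f : {poly mp n}) != 0.
  by apply: contra_neq xl => p0; rewrite lead_coefE -coef_map p0 coef0.
have [y yp] := exists_nonroot pf.
by exists (set_var x n y); rewrite ev_set_varS.
Qed.

Definition zeros n (I : mp n -> Prop) (x : nat -> F) := forall f, I f -> ev x n f = 0.

Fixpoint emb d r (h : mp r) : mp (d + r) :=
  if d is d'.+1 then (emb d' h)%:P else h.

Lemma ev_emb x d r (h : mp r) : ev x (d + r) (emb d h) = ev x r h.
Proof. by elim: d => [//|d IH]; rewrite -IH; exact: evMC. Qed.

(** Induction on the number of variables to be extended over: above a zero of
    the contraction the last coordinate is a root of the minimal polynomial, or
    arbitrary when the ideal comes from the contraction.  The condition on [f]
    is first pushed down to the coefficients. *)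
Lemma extend_zero d r (I : mp (d + r) -> Prop) (f : mp (d + r)) :
    prime_ideal I -> (forall h : mp r, I (emb d h) -> h = 0) -> ~ I f ->
  exists2 h : mp r, h != 0 & forall b, ev b r h != 0 ->
    exists x, [/\ forall k, (k < r)%N -> x k = b k, zeros I x & ev x (d + r) f != 0].
Proof.
elim: d I f => [|d IH] I f pI Ir If.
  exists f; first by apply: contra_notN If => /eqP ->; exact: prime_ideal0 pI.
  by move=> b bf; exists b; split=> // g /Ir ->; rewrite rmorph0.
have pI' := prime_contract pI.
have [[g0 [k [Ig0 g0k]]]|nog] := pselect (exists g0 k, I g0 /\ ~ contract I (g0 : {poly mp (d + r)})`_k).
  have [g gmin] := min_poly_exists pI Ig0 g0k.
  have [s [c [Ic Isc]]] := min_poly_invert pI gmin If.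
  have [Ig lg _] := gmin.
  have lcI : ~ contract I (lead_coef g * c) by case/(prime_idealP pI').
  have [h h0 hP] := IH (contract I) (lead_coef g * c) pI' Ir lcI.
  exists h => // b /hP[x [xb xI]]; rewrite rmorphM mulf_eq0 negb_or => /andP[xl xc].
  have [y yg] : exists y, (map_poly (ev x (d + r)) g).[y] = 0.
    apply: closed_root; rewrite size_map_poly_id0 // ; exact: min_poly_size gmin.
  have xdr a : ev (set_var x (d + r) y) (d + r).+1 (a%:P : mp (d + r).+1) = ev x (d + r) a.
    by rewrite /ev evMC; exact: ev_set_var.
  have zI : zeros I (set_var x (d + r) y).
    apply: (min_poly_zeros pI gmin) => [a Ia||]; rewrite ?xdr //; first exact: xI.
    exact: etrans (@ev_set_varS x (d + r) y g) yg.
  exists (set_var x (d + r) y); split=> //.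
    by move=> a ar; rewrite /set_var ltn_eqF ?xb // ltn_addl.
  have := zI _ Isc; rewrite rmorphB rmorphM /= xdr => /eqP; rewrite subr_eq0 => /eqP E.
  by apply: contra_neq xc => E'; rewrite -E E' mulr0.
have nog' g k : I g -> contract I (g : {poly mp (d + r)})`_k.
  by move=> Ig; apply: contrapT => H; apply: nog; exists g, k.
have [k fk] : exists k, ~ contract I (f : {poly mp (d + r)})`_k.
  by apply/existsNP => H; apply: If; exact: (ideal_coefs pI).
have [h h0 hP] := IH (contract I) _ pI' Ir fk.
exists h => // b /hP[x [xb xI xf]].
have pf : map_poly (ev x (d + r)) (f : {poly mp (d + r)}) != 0.
  by apply: contra_neq xf => p0; rewrite -coef_map p0 coef0.
have [y yp] := exists_nonroot pf.
exists (set_var x (d + r) y); split.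
- by move=> a ar; rewrite /set_var ltn_eqF ?xb // ltn_addl.
- move=> g Ig; apply: (@ev_coefs0 _ (d + r)) => m; rewrite ev_set_var.
  by apply: xI; exact: nog'.
- by rewrite (@ev_set_varS x (d + r)).
Qed.

(** The weak form of the theorem of zeros, from the extension of points over no
    variables at all. *)
Lemma prime_zero n (I : mp n -> Prop) (f : mp n) : prime_ideal I -> ~ I f ->
  exists2 x, zeros I x & ev x n f != 0.
Proof.
rewrite -[n]addn0 in I f * => pI If.
(* a nonzero constant is invertible *)
have I0 (h : mp 0) : I (emb n h) -> h = 0.
  move=> Ih; apply/eqP; apply: contrapT => /negP h0; apply: (prime_ideal1 pI).
  have emb1 m (a b : mp 0) : emb m (a * b) = emb m a * emb m b.
    by elim: m => [//|m IH] /=; rewrite IH polyCM.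
  have emb11 m : emb m (1 : mp 0) = 1 by elim: m => [//|m IH] /=; rewrite IH.
  by rewrite -(emb11 n) -(@mulVf F h) // emb1; exact: (prime_idealMl pI).
have [h h0 hP] := extend_zero pI I0 If.
have [x [_ xI xf]] := hP (fun=> 0) h0.
by exists x.
Qed.

End IteratedPolynomials.

(** * Chains of prime ideals *)

Section Avoiding.
Variables (A : idomainType) (J S : A -> Prop).
Hypotheses (J0 : J 0) (JD : forall a b, J a -> J b -> J (a + b))
  (JM : forall a b, J b -> J (a * b)).
Hypotheses (S1 : S 1) (SM : forall a b, S a -> S b -> S (a * b))
  (JS : forall a, J a -> ~ S a).

(** An ideal maximal among those avoiding a multiplicative set is prime. *)
Lemma prime_avoiding : exists I, [/\ prime_ideal I, forall a, J a -> I a &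
  forall a, I a -> ~ S a].
Proof.
(* the elements of [J] are added by hand so that the empty chain has an upper
   bound *)
pose ideal (Y : A -> Prop) := [/\ forall a b, Y a -> Y b -> Y (a + b),
  forall a b, Y b -> Y (a * b) & forall a, Y a -> ~ S a].
pose P (X : set A) := ideal (fun a => X a \/ J a).
have [|I [PI Imax]] := @Zorn_bigcup _ P.
  move=> F FP tot; split.
  - move=> a b [[X FX Xa]|Ja] [[Y FY Yb]|Jb].
    + have [XY|YX] := tot X Y FX FY.
        have [D _ _] := FP Y FY; have [Yab|] := D a b (or_introl (XY a Xa)) (or_introl Yb).
          by left; exists Y.
        by right.
      have [D _ _] := FP X FX; have [Xab|] := D a b (or_introl Xa) (or_introl (YX b Yb)).
        by left; exists X.
      by right.
    + have [D _ _] := FP X FX; have [Xab|] := D a b (or_introl Xa) (or_intror Jb).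
        by left; exists X.
      by right.
    + have [D _ _] := FP Y FY; have [Yab|] := D a b (or_intror Ja) (or_introl Yb).
        by left; exists Y.
      by right.
    + by right; apply: JD.
  - move=> a b [[X FX Xb]|Jb]; last by right; apply: JM.
    have [_ M _] := FP X FX; have [Xab|] := M a b (or_introl Xb); last by right.
    by left; exists X.
  - move=> a [[X FX Xa]|]; last exact: JS.
    by have [_ _] := FP X FX; apply; left.
have [ID IM IS] := PI; pose I' a := I a \/ J a.
exists I'; split; [|by right|exact: IS].
split=> //.
- by right.
- by move=> /IS.
move=> a b Iab; apply: contrapT => /not_orP[Ia Ib].
have ext c : ~ I' c -> exists x r, I' x /\ S (x + r * c).
  move=> Ic; apply: contrapT => noS.
  pose B : set A := fun t => exists x r, I' x /\ t = x + r * c.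
  have cB : B c by exists 0, 1; split; [right|rewrite mul1r add0r].
  have IB t : I' t -> B t by exists t, 0; rewrite mul0r addr0.
  have BE t : B t \/ J t -> B t by case=> // Jt; apply: IB; right.
  apply: (Imax B).
    split; first by move=> t It; apply: IB; left.
    by move=> BI; apply: Ic; left; apply: BI.
  split.
  - move=> s t /BE[x [r [Ix ->]]] /BE[y [u [Iy ->]]]; left.
    by exists (x + y), (r + u); split; [exact: ID|ring].
  - move=> s t /BE[x [r [Ix ->]]]; left.
    by exists (s * x), (s * r); split; [exact: IM|ring].
  - by move=> t /BE[x [r [Ix ->]]] St; apply: noS; exists x, r.
have [x [r [Ix Sx]]] := ext a Ia; have [y [u [Iy Sy]]] := ext b Ib.
apply: (IS _ _ (SM Sx Sy)).
have -> : (x + r * a) * (y + u * b) = (y + u * b) * x + (r * a) * y + (r * u) * (a * b) by ring.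
by apply: (ID _ _ (ID _ _ (IM _ _ Ix) (IM _ _ Iy)) (IM _ _ Iab)).
Qed.

End Avoiding.

Section PrimeChains.
Variable F : numClosedFieldType.
Local Notation mp := (mp F).

(** This replaces the inclusions between polynomial rings in different numbers
    of variables, which would require casts. *)
Definition same_ev n r (f : mp n) (g : mp r) := forall x, ev x n f = ev x r g.

Definition free n r (I : mp n -> Prop) := forall f (g : mp r), I f -> same_ev f g -> g = 0.

Lemma same_ev_lift n r (g : mp r) : (r <= n)%N -> exists f : mp n, same_ev f g.
Proof.
move=> rn; rewrite -(subnK rn); exists (emb (n - r) g) => x.
exact: ev_emb.
Qed.

Lemma same_ev_var n r : (r < n)%N -> exists f : mp n, forall x, ev x n f = x r.
Proof.
move=> rn; have [f fX] := same_ev_lift (n := n) ('X : mp r.+1) rn.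
by exists f => x; rewrite fX; exact: evMX.
Qed.

Lemma extend_free n r (I : mp n -> Prop) (f : mp n) : (r <= n)%N ->
    prime_ideal I -> free r I -> ~ I f ->
  exists2 h : mp r, h != 0 & forall b, ev b r h != 0 ->
    exists x, [/\ forall k, (k < r)%N -> x k = b k, zeros I x & ev x n f != 0].
Proof.
move=> rn; move: I f; rewrite -(subnK rn) => I f pI Ir If.
by apply: extend_zero => // h Ih; apply: (Ir _ h Ih) => x; exact: ev_emb.
Qed.

(** Specializing the last free variable to a general constant: the ideal
    generated by [I] and the corresponding linear polynomial meets the
    polynomials in the remaining free variables only in zero, because a zero of
    [I] exists over almost every point of the slice. *)
Lemma prime_slice n r (I : mp n -> Prop) (X : mp n) : (r < n)%N ->
    (forall x, ev x n X = x r) -> prime_ideal I -> free r.+1 I ->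
  exists c (K : mp n -> Prop) (Y : mp n), [/\ prime_ideal K, free r K,
    (forall f, I f -> K f), (forall x, ev x n Y = x r - c) & K Y /\ ~ I Y].
Proof.
move=> rn Xr pI fI; have I1 : ~ I 1 by apply: prime_ideal1.
have [h h0 hP] := extend_free rn pI fI I1.
have [b bh] := exists_nonzero h0; pose c := b r.
have [cn cnE] := @same_ev_lift n 0 (c : mp 0) isT.
have Yr x : ev x n (X - cn) = x r - c by rewrite rmorphB /= Xr cnE.
have [hc hcE] : exists hc : mp r, forall x, ev x r hc = ev (set_var x r c) r.+1 h.
  have [cr crE] := @same_ev_lift r 0 (c : mp 0) isT.
  exists (h : {poly mp r}).[cr] => x; rewrite ev_set_varS -horner_map; congr (_.[_]).
  by rewrite crE.
pose J (f : mp n) := exists u v : mp n, I u /\ f = u + v * (X - cn).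
pose S (f : mp n) := exists2 g : mp r, g != 0 & same_ev f g.
have hc0 : hc != 0.
  apply/eqP => hc0; have := hcE b; rewrite hc0 rmorph0 => /esym/eqP.
  rewrite (_ : ev _ _ h = ev b r.+1 h) ?(negbTE bh) //.
  by apply: eq_evM => k _; rewrite /set_var; case: eqP => // ->.
have [||||||K [pK JK KS]] := @prime_avoiding (mp n) J S.
- by exists 0, 0; split; [exact: prime_ideal0 pI|ring].
- move=> f g [u [v [Iu ->]]] [u' [v' [Iu' ->]]]; exists (u + u'), (v + v').
  by split; [exact: prime_idealD pI _ _ Iu Iu'|ring].
- move=> f g [u [v [Iu ->]]]; exists (f * u), (f * v).
  by split; [exact: prime_idealMl pI _ _ Iu|ring].
- by exists 1; [exact: oner_neq0|move=> x; rewrite !rmorph1].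
- move=> f g [f' f'0 ff'] [g' g'0 gg']; exists (f' * g'); first by rewrite mulf_neq0.
  by move=> x; rewrite !rmorphM /= ff' gg'.
- move=> f [u [v [Iu fE]]] [g g0 fg].
  have [|b' ] := @exists_nonzero F r (g * hc); first by rewrite mulf_neq0.
  rewrite rmorphM mulf_eq0 negb_or => /andP[gb]; rewrite hcE => /hP[x [xb xI _]].
  case/eqP: gb; have -> : ev b' r g = ev x n f; last first.
    by rewrite fE rmorphD rmorphM /= xI // Yr xb // /set_var eqxx subrr mulr0 addr0.
  rewrite fg; apply: eq_evM => k kr; rewrite xb ?ltnS 1?ltnW //.
  by rewrite /set_var ltn_eqF.
exists c, K, (X - cn); split=> //.
- by move=> f g Kf fg; apply/eqP; apply: contrapT => /negP g0; apply: (KS f Kf); exists g.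
- by move=> f If; apply: JK; exists f, 0; split=> //; ring.
split; first by apply: JK; exists 0, 1; split; [exact: prime_ideal0 pI|ring].
move=> IY; have [cr crE] := @same_ev_lift r 0 (c : mp 0) isT.
suff same : same_ev (X - cn) (('X - cr%:P : {poly mp r}) : mp r.+1).
  by have /eqP := fI _ _ IY same; rewrite polyXsubC_eq0.
move=> x.
have XE : ev x r.+1 ('X : {poly mp r}) = x r by exact: evMX.
have CE : ev x r.+1 (cr%:P : {poly mp r}) = c by rewrite /ev evMC -/(ev x r) crE.
by rewrite Yr -[in LHS]XE -[in LHS]CE -rmorphB.
Qed.

Lemma prime_chain n r (I : mp n -> Prop) : (r <= n)%N -> prime_ideal I -> free r I ->
  exists K : nat -> mp n -> Prop,
    [/\ forall k, prime_ideal (K k), forall f, I f <-> K r f &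
        forall k, (k < r)%N -> [/\ forall f, K k.+1 f -> K k f &
          exists Y, K k Y /\ ~ K k.+1 Y]].
Proof.
elim: r I => [|r IH] I rn pI fI; first by exists (fun=> I).
have [X XE] := same_ev_var rn.
have [c [K0 [Y [pK fK IK _ [KY IY]]]]] := prime_slice rn XE pI fI.
have [K [pK' K0K Kc]] := IH K0 (ltnW rn) pK fK.
exists (fun k => if (k <= r)%N then K k else I); split.
- by move=> k; case: ifP.
- by move=> f; rewrite ltnn.
move=> k; rewrite ltnS => kr; rewrite kr; case: ltnP => kr'; first exact: Kc.
have -> : k = r by apply/eqP; rewrite eqn_leq kr.
split; first by move=> f /IK/K0K.
by exists Y; split=> //; exact/K0K.
Qed.

End PrimeChains.

(** * Affine charts and homogenization *)

Lemma clear_denominator (K : fieldType) (a b c d e : K) : d != 0 ->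
  a * b * c * e = (d * e * a) * (b * (c / d)).
Proof. by move=> d0; field. Qed.

Section Multihomogeneous.
Variable R : realType.
Implicit Types (v : 'I_4 -> hvec R) (e : 'I_4 -> nat).
Local Notation poly8 := (mpoly (4 * 2) (C R)).

Definition den v t : C R := (set_val (v t)).1.
Definition num v t : C R := (set_val (v t)).2.

Definition dvar (t : 'I_4) : 'I_(4 * 2) := mxvec_index t (ord0 : 'I_2).
Definition nvar (t : 'I_4) : 'I_(4 * 2) := mxvec_index t (ord_max : 'I_2).

Lemma hcoords_dvar v t : hcoords v (dvar t) = den v t.
Proof. by rewrite /hcoords mxvecE mxE eqxx. Qed.

Lemma hcoords_nvar v t : hcoords v (nvar t) = num v t.
Proof. by rewrite /hcoords mxvecE mxE. Qed.

Lemma prod_vars (G : 'I_(4 * 2) -> C R) :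
  \prod_k G k = \prod_t (G (dvar t) * G (nvar t)).
Proof.
rewrite (reindex _ (curry_mxvec_bij 4 2)) /=.
rewrite (eq_bigr (fun p : 'I_4 * 'I_2 => G (mxvec_index p.1 p.2))); last by case.
rewrite -(pair_bigA _ (fun t b => G (mxvec_index t b))) /=.
apply: eq_bigr => t _; rewrite big_ord_recl big_ord1; congr (_ * G (mxvec_index t _)).
exact: val_inj.
Qed.

Lemma sum_vars (m : multinom (4 * 2)) (t : 'I_4) :
  (\sum_(b < 2) m (mxvec_index t b))%N = (m (dvar t) + m (nvar t))%N.
Proof.
rewrite big_ord_recl big_ord1; congr (_ + m (mxvec_index t _))%N.
exact: val_inj.
Qed.

Definition mhom e (H : poly8) :=
  forall m, m \in msupp H -> forall t, (m (dvar t) + m (nvar t) = e t)%N.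

Lemma mhom_multihomogeneous e H : mhom e H -> multihomogeneous H.
Proof. by move=> h; exists e => m mH t; rewrite sum_vars h. Qed.

Lemma multihomogeneous_mhom (H : poly8) : multihomogeneous H -> exists e, mhom e H.
Proof. by move=> [e h]; exists e => m mH t; rewrite -sum_vars h. Qed.

Lemma mhom_scale e H v v' (l : 'I_4 -> C R) : mhom e H ->
    (forall t, den v' t = l t * den v t /\ num v' t = l t * num v t) ->
  meval (hcoords v') H = \prod_t l t ^+ e t * meval (hcoords v) H.
Proof.
move=> h vl; rewrite !mevalE mulr_sumr big_seq [RHS]big_seq.
apply: eq_bigr => m mH; rewrite mulrCA; congr (_ * _).
rewrite !prod_vars -big_split /=; apply: eq_bigr => t _.
have [d n] := vl t; rewrite !hcoords_dvar !hcoords_nvar d n !exprMn -(h m mH t) exprD.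
exact: mulrACA.
Qed.

Lemma mhom0 e : mhom e 0.
Proof. by move=> m; rewrite msupp0. Qed.

Lemma mhomD e H1 H2 : mhom e H1 -> mhom e H2 -> mhom e (H1 + H2).
Proof. by move=> h1 h2 m /msuppD_le; rewrite mem_cat => /orP[/h1|/h2]. Qed.

Lemma mhom_sum e I (r : seq I) (G : I -> poly8) : (forall k, mhom e (G k)) ->
  mhom e (\sum_(k <- r) G k).
Proof. by move=> hG; elim/big_ind: _ => //; [exact: mhom0|exact: mhomD]. Qed.

Lemma mhomC (c : C R) : mhom (fun=> 0%N) (mpolyC (4 * 2) c).
Proof. by move=> m; rewrite msuppC; case: eqP => // _; rewrite inE => /eqP -> t; rewrite !mnm0E. Qed.

Lemma mhomM e1 e2 H1 H2 : mhom e1 H1 -> mhom e2 H2 ->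
  mhom (fun t => e1 t + e2 t)%N (H1 * H2).
Proof.
move=> h1 h2 m /msuppM_le/allpairsP[[m1 m2] /= [/h1 e1t /h2 e2t ->]] t.
by rewrite !mnmDE -e1t -e2t addnACA.
Qed.

Lemma mxvec_index_eq (t u : 'I_4) (b c : 'I_2) :
  (mxvec_index t b == mxvec_index u c) = (t == u) && (b == c).
Proof. by rewrite /mxvec_index (inj_eq (@cast_ord_inj _ _ _)) (inj_eq enum_rank_inj). Qed.

Lemma mhom_dvar t : mhom (fun u => (u == t) : nat) (mpolyX (C R) (mnm1 (dvar t))).
Proof.
move=> m; rewrite msuppX inE => /eqP -> u; rewrite !mnm1E !mxvec_index_eq andbT andbF addn0.
by rewrite eq_sym.
Qed.

Lemma mhom_nvar t : mhom (fun u => (u == t) : nat) (mpolyX (C R) (mnm1 (nvar t))).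
Proof.
move=> m; rewrite msuppX inE => /eqP -> u; rewrite !mnm1E !mxvec_index_eq andbT andbF add0n.
by rewrite eq_sym.
Qed.

Lemma mhomX e H n : mhom e H -> mhom (fun t => n * e t)%N (H ^+ n).
Proof.
move=> h; elim: n => [|n IH].
  by rewrite expr0 => m; rewrite msupp1 inE => /eqP -> t; rewrite !mnm0E.
by rewrite exprS => m /(mhomM h IH) mE t; rewrite mE mulSn.
Qed.

Lemma eq_mhom e e' H : (forall t, e t = e' t) -> mhom e H -> mhom e' H.
Proof. by move=> ee h m /h mE t; rewrite -ee mE. Qed.

Lemma hom_step e (t : 'I_4) n d (Hc : nat -> poly8) : (n <= d.+1)%N ->
    (forall c, mhom e (Hc c)) ->
  exists2 H, mhom (fun u => e u + d * (u == t))%N H &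
    forall v, meval (hcoords v) H =
      \sum_(c < n) meval (hcoords v) (Hc c) * num v t ^+ c * den v t ^+ (d - c).
Proof.
move=> nd hc.
exists (\sum_(c < n) Hc c * (mpolyX (C R) (mnm1 (nvar t)) ^+ c *
    mpolyX (C R) (mnm1 (dvar t)) ^+ (d - c))).
  have H (c : 'I_n) : mhom (fun u => e u + d * (u == t))%N
      (Hc c * (mpolyX (C R) (mnm1 (nvar t)) ^+ c * mpolyX (C R) (mnm1 (dvar t)) ^+ (d - c))).
    have h := mhomM (hc c) (mhomM (@mhomX _ _ c (@mhom_nvar t)) (@mhomX _ _ (d - c) (@mhom_dvar t))).
    apply: eq_mhom h => u; rewrite -mulnDl subnKC // -ltnS.
    exact: leq_trans (ltn_ord c) nd.
  exact: mhom_sum.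
move=> v; rewrite raddf_sum; apply: eq_bigr => c _.
rewrite /= !mevalM !rmorphXn /= !mevalXU hcoords_dvar hcoords_nvar.
by rewrite mulrA.
Qed.

Variable s : seq 'I_4.
Hypotheses (us : uniq s) (ss : size s = 4%N).

Local Notation o k := (nth ord0 s k).

Lemma mem_order t : t \in s.
Proof.
have [||_ ->] := @uniq_min_size _ s (enum 'I_4) us; last by rewrite mem_enum.
  by move=> u _; rewrite mem_enum.
by rewrite size_enum_ord ss.
Qed.

Lemma index_lt4 t : (index t s < 4)%N.
Proof. by have := mem_order t; rewrite -index_mem ss. Qed.

Lemma order_index t : o (index t s) = t.
Proof. by rewrite nth_index // mem_order. Qed.

Lemma index_order k : (k < 4)%N -> index (o k) s = k.
Proof. by move=> k4; rewrite index_uniq // ss. Qed.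

Lemma order_eq a b : (a < 4)%N -> (b < 4)%N -> (o a == o b) = (a == b).
Proof. by move=> a4 b4; rewrite nth_uniq // ss. Qed.

Definition affine v k : C R := num v (o k) / den v (o k).

(** The multidegree is left free above a bound so that the coefficients of a
    polynomial in one more variable can be given the same one. *)
Lemma homogenize n (f : mp (C R) n) : (n <= 4)%N -> exists E : nat, forall e : 'I_4 -> nat,
    (forall k, (k < n)%N -> (E <= e (o k))%N) ->
    (forall k, (n <= k < 4)%N -> e (o k) = 0%N) ->
  exists2 H, mhom e H & forall v, (forall k, (k < n)%N -> den v (o k) != 0) ->
    meval (hcoords v) H = \prod_t den v t ^+ e t * ev (affine v) n f.
Proof.
elim: n f => [|n IH] f n4.
  exists 0%N => e _ e0.
  have e00 t : e t = 0%N by rewrite -(order_index t) e0 // index_lt4.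
  exists (mpolyC _ (f : C R)); first by apply: eq_mhom (@mhomC f) => t; rewrite e00.
  by move=> v _; rewrite mevalC big1 ?mul1r // => t _; rewrite e00 expr0.
have ec c : exists E : nat, forall e : 'I_4 -> nat,
    (forall k, (k < n)%N -> (E <= e (o k))%N) ->
    (forall k, (n <= k < 4)%N -> e (o k) = 0%N) ->
  exists2 H, mhom e H & forall v, (forall k, (k < n)%N -> den v (o k) != 0) ->
    meval (hcoords v) H = \prod_t den v t ^+ e t * ev (affine v) n (f : {poly mp (C R) n})`_c.
  by apply: IH; exact: ltnW.
have [Ec EcP] := choice ec.
pose N := size (f : {poly mp (C R) n}).
exists (maxn N (\max_(c < N) Ec c))%N => e eE e0.
pose e' t := if t == o n then 0%N else e t.
have e'k k : (k < n)%N -> e' (o k) = e (o k).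
  by move=> kn; rewrite /e' order_eq ?(ltn_eqF kn) // (ltn_trans kn).
have hc (c : nat) : exists Hc, mhom e' Hc /\ ((c < N)%N -> forall v, (forall k, (k < n)%N -> den v (o k) != 0) ->
    meval (hcoords v) Hc = \prod_t den v t ^+ e' t * ev (affine v) n (f : {poly mp (C R) n})`_c).
  have [cN|cN] := ltnP c N; last by exists 0; split; [exact: mhom0|].
  have [||Hc hHc HcE] := EcP c e'; last by exists Hc.
  - move=> k kn; rewrite e'k //; apply: leq_trans (eE k _); last exact: ltnW.
    rewrite leq_max; apply/orP; right.
    exact: (leq_bigmax (Ordinal cN)).
  - move=> k /andP[nk k4]; rewrite /e' order_eq //; case: eqP => // /eqP kn.
    by apply: e0; rewrite k4 andbT ltn_neqAle eq_sym kn.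
have [Hc HcP] := choice hc.
have Nd : (N <= (e (o n)).+1)%N.
  apply: leqW; apply: leq_trans (eE n _) => //; exact: leq_maxl.
have [H hH HE] := hom_step (o n) Nd (fun c => (HcP c).1).
exists H.
  apply: eq_mhom hH => t; rewrite /e'; case: eqP => [->|]; first by rewrite muln1.
  by rewrite muln0 addn0.
move=> v dv; rewrite HE /ev evM_coef mulr_sumr; apply: eq_bigr => c _.
rewrite (HcP c).2 //; last by move=> k kn; apply: dv; exact: ltnW.
have dn : den v (o n) != 0 by apply: dv.
rewrite (bigD1 (o n)) //= [in RHS](bigD1 (o n)) //= /e' eqxx expr0 mul1r.
rewrite (eq_bigr (fun t => den v t ^+ e t)) => [|t /negbTE ->] //.
rewrite [X in _ * (_ * X ^+ _)](_ : _ = num v (o n) / den v (o n)) // expr_div_n.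
have -> : den v (o n) ^+ e (o n) = den v (o n) ^+ c * den v (o n) ^+ (e (o n) - c).
  by rewrite -exprD subnKC // -ltnS (leq_trans _ Nd).
by apply: clear_denominator; rewrite expf_neq0.
Qed.

End Multihomogeneous.

(** * The ideal of a subvariety in an affine chart *)

Section AffineVariety.
Variable R : realType.
Variable s : seq 'I_4.
Hypotheses (us : uniq s) (ss : size s = 4%N).
Local Notation o k := (nth ord0 s k).
Local Notation mp := (mp (C R)).
Local Notation poly8 := (mpoly (4 * 2) (C R)).
Implicit Types (v : 'I_4 -> hvec R) (x y : nat -> C R).

Definition hv y (t : 'I_4) : hvec R :=
  exist (fun w => w \in @nonzero_vec R) _ (aff_nonzero true (y (index t s))).

Definition apt y : P1x4 R := fun t => aff true (y (index t s)).

Lemma apt_hv y t : hpoint (hv y t) = apt y t. Proof. by []. Qed.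

Lemma den_hv y t : den (hv y) t = 1. Proof. by []. Qed.
Lemma num_hv y t : num (hv y) t = y (index t s). Proof. by []. Qed.

Lemma apt_order y k : (k < 4)%N -> apt y (o k) = aff true (y k).
Proof. by move=> k4; rewrite /apt index_order. Qed.

Lemma hpoint_surj (x : P1x4 R) : exists v, forall t, hpoint (v t) = x t.
Proof.
by have [v vP] := choice (fun t => hpoint_repr (x t)); exists v => t; rewrite vP.
Qed.

Lemma apt_surj (x : P1x4 R) : (forall t, x t <> aff false 0) -> exists y, x = apt y.
Proof.
move=> xf; have fin t : exists z, x t = aff true z.
  by have [|/xf] := P1_cases (x t).
have [z zP] := choice fin; exists (fun k => z (o k)).
by apply/funext => t; rewrite /apt order_index.
Qed.

Lemma dehomogenize (H : poly8) : exists f : mp 4, forall y, ev y 4 f = meval (hcoords (hv y)) H.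
Proof.
have cst (c : C R) : exists f : mp 4, forall y, ev y 4 f = c.
  by have [f fE] := @same_ev_lift (C R) 4 0 c isT; exists f => y; rewrite fE.
elim/mpolyind: H => [|c m p _ _ [f fE]].
  by exists 0 => y; rewrite rmorph0 meval0.
have var k : exists f : mp 4, forall y, ev y 4 f = hcoords (hv y) k.
  case/mxvec_indexP: k => t b; have [f0 f0E] := @same_ev_var (C R) 4 _ (index_lt4 us ss t).
  have [f1 f1E] := cst 1.
  exists (if b == 0 then f1 else f0) => y; rewrite /hcoords mxvecE mxE.
  by case: eqP.
have [g gE] := choice var; have [a aE] := cst c.
exists (a * \prod_k g k ^+ m k + f) => y.
rewrite mevalD mevalZ mevalX rmorphD rmorphM /= aE fE rmorph_prod.
by congr (_ * _ + _); apply: eq_bigr => k _; rewrite rmorphXn /= gE.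
Qed.

Lemma hpoint_scale v w : (forall t, hpoint (v t) = hpoint (w t)) ->
  exists2 l : 'I_4 -> C R, forall t, l t != 0 &
    forall t, den w t = l t * den v t /\ num w t = l t * num v t.
Proof.
move=> vw; have sc t : exists l : C R, set_val (w t) = l *: set_val (v t) by apply/hpointP.
have [l lE] := choice sc; exists l => t.
  apply/eqP => l0; have := hvec_neq0 (w t); rewrite lE l0 scale0r /=.
  by rewrite eqxx.
by rewrite /den /num lE.
Qed.

Lemma mhom_vanish e (H : poly8) v w : mhom e H -> (forall t, hpoint (v t) = hpoint (w t)) ->
  meval (hcoords v) H = 0 -> meval (hcoords w) H = 0.
Proof.
move=> hH /hpoint_scale[l _ lE] H0.
by rewrite (mhom_scale hH lE) H0 mulr0.
Qed.

Definition hyper (H : poly8) : set (P1x4 R) := zero_locus [set H].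

Lemma hyper_closed e (H : poly8) : mhom e H -> zariski_closed (hyper H).
Proof.
move=> hH; exists [set H]; split=> // f /= ->; exact: mhom_multihomogeneous hH.
Qed.

Lemma hyperP e (H : poly8) v : mhom e H ->
  hyper H (fun t => hpoint (v t)) <-> meval (hcoords v) H = 0.
Proof.
move=> hH; split=> [|H0 f /= -> w wv]; first by apply.
by apply: (mhom_vanish hH) H0.
Qed.

Lemma zariski_closedU (A B : set (P1x4 R)) :
  zariski_closed A -> zariski_closed B -> zariski_closed (A `|` B).
Proof.
move=> [SA [hA ->]] [SB [hB ->]].
exists [set H | exists f g, [/\ SA f, SB g & H = f * g]]; split.
  move=> _ [f [g [/hA/multihomogeneous_mhom[e hf] /hB/multihomogeneous_mhom[e' hg] ->]]].
  exact: mhom_multihomogeneous (mhomM hf hg).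
apply/seteqP; split=> x.
  move=> [xA|xB] _ [f [g [fA gB ->]]] v vx; rewrite mevalM.
    by rewrite (xA f fA v vx) mul0r.
  by rewrite (xB g gB v vx) mulr0.
move=> xAB; apply: contrapT => /not_orP[xA xB].
have [v vx] := hpoint_surj x.
have nz (S : set poly8) : (forall f, S f -> multihomogeneous f) -> ~ zero_locus S x ->
    exists2 f, S f & meval (hcoords v) f != 0.
  move=> hS xS; apply: contrapT => no; apply: xS => f Sf w wx.
  have [e hf] := multihomogeneous_mhom (hS f Sf).
  apply: (mhom_vanish hf (v := v)) => [t|]; first by rewrite vx wx.
  by apply: contrapT => /eqP f0; apply: no; exists f.
have [f fA f0] := nz SA hA xA; have [g gB g0] := nz SB hB xB.
have /eqP : meval (hcoords v) (f * g) = 0 by apply: xAB => //; exists f, g.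
by rewrite mevalM mulf_eq0 (negbTE f0) (negbTE g0).
Qed.

Lemma infty_closed (t : 'I_4) : zariski_closed [set x : P1x4 R | x t = aff false 0].
Proof.
have hH := @mhom_dvar R t.
suff -> : [set x : P1x4 R | x t = aff false 0] = hyper (mpolyX (C R) (mnm1 (dvar t))).
  exact: hyper_closed hH.
have inf v : hpoint (v t) = aff false 0 <-> den v t = 0.
  split=> [vi|v0].
    apply: contrapT => /eqP v0; have := aff_infty (t := num v t / den v t); apply.
    by rewrite -vi; apply/esym/hpoint_aff.
  have [[z /hpoint_aff[]]|//] := P1_cases (hpoint (v t)).
  by rewrite -/(den v t) v0 eqxx.
apply/seteqP; split=> x /=; have [v vx] := hpoint_surj x.
  move=> xt f /= -> w wx; rewrite mevalXU hcoords_dvar; apply/inf; by rewrite wx.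
move=> xH; rewrite -vx; apply/inf; rewrite -hcoords_dvar -(@mevalXU _ _ (hcoords v)).
exact: xH.
Qed.

Variable V : set (P1x4 R).
Hypothesis sV : subvariety V.
Hypothesis finV : forall t, ~ (V `<=` [set x | x t = aff false 0]).

Let infty : set (P1x4 R) := [set x | exists t, x t = aff false 0].

Lemma infty_all_closed : zariski_closed infty.
Proof.
pose A t : set (P1x4 R) := [set x | x t = aff false 0].
have -> : infty = A (inord 0) `|` (A (inord 1) `|` (A (inord 2) `|` A (inord 3))).
  apply/seteqP; split=> x; last first.
    by case=> [|[|[|]]] xt; eexists; exact: xt.
  move=> [t xt]; have tE : t = inord t by rewrite inord_val.
  rewrite /A /setU /=; rewrite tE in xt.
  by move: (ltn_ord t) xt; case: (t : nat) => [|[|[|[|//]]]] _; tauto.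
by do 3!(apply: zariski_closedU; first exact: infty_closed); exact: infty_closed.
Qed.

Lemma V_not_infty : ~ (V `<=` infty).
Proof.
have [cV _ irr] := sV; pose A t : set (P1x4 R) := [set x | x t = aff false 0].
have -> : infty = A (inord 0) `|` (A (inord 1) `|` (A (inord 2) `|` A (inord 3))).
  apply/seteqP; split=> x; last first.
    by case=> [|[|[|]]] xt; eexists; exact: xt.
  move=> [t xt]; have tE : t = inord t by rewrite inord_val.
  rewrite /A /setU /=; rewrite tE in xt.
  by move: (ltn_ord t) xt; case: (t : nat) => [|[|[|[|//]]]] _; tauto.
have cA t : zariski_closed (A t) by exact: infty_closed.
move=> /irr H; case: H => // [|/finV//|].
  by do 2!(apply: zariski_closedU => //).
by move=> /irr H; case: H => // [|/finV//|/irr H]; [exact: zariski_closedU|case: H => // /finV].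
Qed.

(** By irreducibility it suffices to look at the affine part of [V], which is
    not empty. *)
Lemma V_sub_closed (A : set (P1x4 R)) : zariski_closed A ->
  (forall y, V (apt y) -> A (apt y)) -> V `<=` A.
Proof.
move=> cA VA; have [_ _ irr] := sV.
case: (irr A infty cA infty_all_closed) => // [x Vx|/V_not_infty//].
have [xi|xi] := pselect (infty x); [by right|left].
have [|y xE] := @apt_surj x; first by move=> t xt; apply: xi; exists t.
by rewrite xE; apply: VA; rewrite -xE.
Qed.

(** The ideals for all [n] at once: a polynomial in the first [n] coordinates
    may be tested at points with all four. *)
Definition IV n (f : mp n) := forall y, V (apt y) -> ev y n f = 0.

Lemma V_affine_point : exists y, V (apt y).
Proof.
apply: contrapT => no; apply: V_not_infty => x Vx; apply: contrapT => xi; apply: no.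
have [|y xE] := @apt_surj x; first by move=> t xt; apply: xi; exists t.
by exists y; rewrite -xE.
Qed.

(** Vanishing of a polynomial in some of the affine coordinates is a closed
    condition on all points that are finite in these coordinates, whatever their
    other coordinates. *)
Lemma poly_hyper n (f : mp n) : (n <= 4)%N -> exists2 A : set (P1x4 R), zariski_closed A &
  forall (x : P1x4 R) y, (forall k, (k < n)%N -> x (o k) = aff true (y k)) -> A x <-> ev y n f = 0.
Proof.
move=> n4; have [E EP] := homogenize us ss f n4.
have [||H hH HE] := EP (fun t => if (index t s < n)%N then E else 0%N).
- by move=> k kn; rewrite index_order ?kn // (leq_trans kn).
- by move=> k /andP[nk k4]; rewrite index_order // ltnNge nk.
exists (hyper H); first exact: hyper_closed hH.
move=> x y xy; have [v vx] := hpoint_surj x.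
have -> : x = (fun t => hpoint (v t)) by apply/funext => t; rewrite vx.
have vy k : (k < n)%N -> den v (o k) != 0 /\ y k = affine s v k.
  by move=> kn; apply/hpoint_aff; rewrite vx xy.
rewrite (hyperP v hH) HE; last by move=> k /vy[].
have -> : ev y n f = ev (affine s v) n f by apply: eq_evM => k /vy[].
split=> [/eqP|->]; last by rewrite mulr0.
rewrite mulf_eq0 => /orP[/prodf_eq0[t _]|/eqP//].
case: ifP => [tn|]; last by rewrite expr0 oner_eq0.
by rewrite -(order_index us ss t) expf_eq0 (negbTE (vy _ tn).1) andbF.
Qed.

Lemma IV_relation n (f : mp n) (x : P1x4 R) y : (n <= 4)%N -> IV f -> V x ->
  (forall k, (k < n)%N -> x (o k) = aff true (y k)) -> ev y n f = 0.
Proof.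
move=> n4 If Vx xy; have [A cA AP] := poly_hyper f n4.
apply/(AP x y xy); apply: (V_sub_closed cA) => // z Vz.
by apply/(AP (apt z) z); [move=> k kn; rewrite apt_order // (leq_trans kn)|exact: If].
Qed.

Lemma IV_prime n : (n <= 4)%N -> prime_ideal (@IV n).
Proof.
move=> n4; split.
- by move=> y _; rewrite rmorph0.
- by move=> f g If Ig y Vy; rewrite rmorphD /= If // Ig // addr0.
- by move=> f g Ig y Vy; rewrite rmorphM /= Ig // mulr0.
- have [y Vy] := V_affine_point; move=> /(_ y Vy)/eqP; rewrite rmorph1.
  by rewrite oner_eq0.
move=> f g Ifg; have [A cA AP] := poly_hyper f n4; have [B cB BP] := poly_hyper g n4.
have aptn y k : (k < n)%N -> apt y (o k) = aff true (y k).
  by move=> kn; rewrite apt_order // (leq_trans kn).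
have VAB : V `<=` A `|` B.
  apply: V_sub_closed => [|y Vy]; first exact: zariski_closedU.
  have /eqP := Ifg y Vy; rewrite rmorphM mulf_eq0 => /orP[] /eqP E.
    by left; apply/(AP _ y); [exact: aptn|].
  by right; apply/(BP _ y); [exact: aptn|].
have [_ _ irr] := sV; case: (irr A B cA cB VAB) => VA; [left|right] => y Vy.
  by apply/(AP _ y); [exact: aptn|exact: VA].
by apply/(BP _ y); [exact: aptn|exact: VA].
Qed.

(** Multiplied out, the relation is homogeneous in the coordinates of the factor
    [n]; at infinity only its leading term remains. *)
Lemma IV_infty n (f : mp n.+1) (x : P1x4 R) y : (n < 4)%N -> IV f -> V x ->
  (forall k, (k < n)%N -> x (o k) = aff true (y k)) -> x (o n) = aff false 0 ->
  ev y n (lead_coef (f : {poly mp n})) = 0.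
Proof.
move=> n4 If Vx xy xinf.
pose N := size (f : {poly mp n}).
have [->|f0] := eqVneq (f : {poly mp n}) 0; first by rewrite lead_coef0 rmorph0.
have ec c : exists E : nat, forall e : 'I_4 -> nat,
    (forall k, (k < n)%N -> (E <= e (o k))%N) ->
    (forall k, (n <= k < 4)%N -> e (o k) = 0%N) ->
  exists2 H, mhom e H & forall v, (forall k, (k < n)%N -> den v (o k) != 0) ->
    meval (hcoords v) H = \prod_t den v t ^+ e t * ev (affine s v) n (f : {poly mp n})`_c.
  by apply: homogenize => //; exact: ltnW.
have [Ec EcP] := choice ec.
pose E := (\max_(c < N) Ec c)%N.
(* a common multidegree for all coefficients *)
pose e (t : 'I_4) := if (index t s < n)%N then E else 0%N.
have hc (c : nat) : exists Hc, mhom e Hc /\ ((c < N)%N -> forall v, (forall k, (k < n)%N -> den v (o k) != 0) ->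
    meval (hcoords v) Hc = \prod_t den v t ^+ e t * ev (affine s v) n (f : {poly mp n})`_c).
  have [cN|cN] := ltnP c N; last by exists 0; split; [exact: mhom0|].
  have [||Hc hHc HcE] := EcP c e; last by exists Hc.
  - move=> k kn; rewrite /e index_order ?kn ?(ltn_trans kn) //.
    exact: (leq_bigmax (Ordinal cN)).
  - by move=> k /andP[nk k4]; rewrite /e index_order // ltnNge nk.
have [Hc HcP] := choice hc.
have Nd : (N <= N.-1.+1)%N by exact: leqSpred.
have [H hH HE] := hom_step (o n) Nd (fun c => (HcP c).1).
have VH : V `<=` hyper H.
  apply: (V_sub_closed (hyper_closed hH)) => z Vz.
  apply/(hyperP (hv z) hH); rewrite HE.
  rewrite (eq_bigr (fun c : 'I_N => ev z n (f : {poly mp n})`_c * z n ^+ c)).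
    by have := If z Vz; rewrite /ev evM_coef.
  move=> c _; have dz k : (k < n)%N -> den (hv z) (o k) != 0 by rewrite den_hv oner_neq0.
  rewrite ((HcP c).2 (ltn_ord c) (hv z) dz) big1 => [|t _]; last exact: expr1n.
  rewrite mul1r num_hv den_hv expr1n mulr1 index_order //; congr (_ * _).
  by apply: eq_evM => k kn; rewrite /affine num_hv den_hv divr1 index_order // (ltn_trans kn).
have [v vx] := hpoint_surj x.
have vy k : (k < n)%N -> den v (o k) != 0 /\ y k = affine s v k.
  by move=> kn; apply/hpoint_aff; rewrite vx xy.
have dn : den v (o n) = 0.
  apply: contrapT => /eqP v0; apply: (aff_infty (t := num v (o n) / den v (o n))).
  by rewrite -xinf -vx; apply/esym/hpoint_aff.
have nn : num v (o n) != 0 by have := hvec_neq0 (v (o n)); rewrite -/(den v _) dn eqxx.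
have /(hyperP v hH) : hyper H (fun t => hpoint (v t)).
  by have -> : (fun t => hpoint (v t)) = x; [apply/funext => t; rewrite vx|exact: VH].
have Npos : (0 < N)%N by rewrite size_poly_gt0.
have last : (N.-1 < N)%N by rewrite ltn_predL.
rewrite HE (bigD1 (Ordinal last)) //= big1 => [|c cl]; last first.
  rewrite dn expr0n subn_eq0 leqNgt.
  have -> : (c < N.-1)%N by rewrite ltn_neqAle -ltnS prednK // ltn_ord andbT -(inj_eq val_inj) /= in cl *.
  by rewrite mulr0.
rewrite addr0 subnn expr0 mulr1 (HcP _).2 //; last by move=> k /vy[].
move=> /eqP; rewrite mulf_eq0 expf_eq0 (negbTE nn) andbF orbF mulf_eq0 => /orP[/prodf_eq0[t _]|/eqP E0].
  rewrite /e; case: ifP => [tn|]; last by rewrite expr0 oner_eq0.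
  by rewrite -(order_index us ss t) expf_eq0 (negbTE (vy _ tn).1) andbF.
rewrite lead_coefE -[RHS]E0; apply: eq_evM => k /vy[] //.
Qed.

Lemma IV_zeros y : zeros (@IV 4) y -> V (apt y).
Proof.
have [[S [hS VE]] _ _] := sV; move=> yI; rewrite VE => f Sf v vy.
have [g gE] := dehomogenize f.
have : ev y 4 g = 0.
  apply: yI => z Vz; rewrite gE; move: Vz; rewrite VE; apply=> //.
rewrite gE; have [e hf] := multihomogeneous_mhom (hS f Sf); apply: (mhom_vanish hf).
by move=> t; rewrite vy.
Qed.

End AffineVariety.

(** * Dimension *)

Section Dimension.
Variable R : realType.
Variable s : seq 'I_4.
Hypotheses (us : uniq s) (ss : size s = 4%N).
Local Notation mp := (mp (C R)).
Local Notation poly8 := (mpoly (4 * 2) (C R)).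

(** The closure in the product of the affine zero set of [K], defined by the
    multihomogeneous polynomials that restrict to elements of [K]. *)
Definition ideal_locus (K : mp 4 -> Prop) : set (P1x4 R) :=
  zero_locus [set H : poly8 | multihomogeneous H /\
    exists2 f, K f & forall y, ev y 4 f = meval (hcoords (hv s y)) H].

Lemma ideal_locus_zero K y : zeros K y -> ideal_locus K (apt s y).
Proof.
move=> yK H [hH [f Kf fE]] v vy; have := yK f Kf; rewrite fE.
have [e he] := multihomogeneous_mhom hH; apply: (mhom_vanish he).
by move=> t; rewrite vy.
Qed.

Lemma ideal_locusP K (f : mp 4) y : K f -> ideal_locus K (apt s y) -> ev y 4 f = 0.
Proof.
move=> Kf yK; have [E EP] := homogenize us ss f (leqnn 4).
have [||H hH HE] := EP (fun=> E) => //.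
  by move=> k /andP[k4]; rewrite ltnNge k4.
have gE z : ev z 4 f = meval (hcoords (hv s z)) H.
  rewrite HE => [|k _]; last by rewrite den_hv oner_neq0.
  rewrite big1 ?mul1r => [|t _]; last by rewrite den_hv expr1n.
  by apply: eq_evM => k k4; rewrite /affine num_hv den_hv divr1 index_order.
rewrite gE; apply: (yK H) => [|t]; last exact: apt_hv.
by split; [exact: mhom_multihomogeneous hH|exists f].
Qed.

(** Irreducibility is primality, read at a zero of the ideal where a product of
    two polynomials does not vanish. *)
Lemma ideal_locus_subvariety K : prime_ideal K -> subvariety (ideal_locus K).
Proof.
move=> pK; split.
- by eexists; split; [|reflexivity] => H [].
- have [y yK _] := prime_zero pK (prime_ideal1 pK).
  by exists (apt s y); exact: ideal_locus_zero.
move=> A B [SA [hA ->]] [SB [hB ->]] KAB; apply: contrapT => /not_orP[KA KB].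
have nz S : (forall f, S f -> multihomogeneous f) -> ~ (ideal_locus K `<=` zero_locus S) ->
    exists f : mp 4, exists2 H, S H & ~ K f /\ forall y, ev y 4 f = meval (hcoords (hv s y)) H.
  move=> hS KS; apply: contrapT => no; apply: KS => x xK H SH v vx.
  have [f fE] := dehomogenize us ss H.
  apply: xK => //; split; first exact: hS.
  exists f => //; apply: contrapT => Kf; apply: no.
  by exists f, H.
have [f [G SG [Kf fE]]] := nz SA hA KA; have [g [H SH [Kg gE]]] := nz SB hB KB.
have [|y yK] := @prime_zero _ 4 K (f * g) pK; first by case/(prime_idealP pK).
rewrite rmorphM mulf_eq0 negb_or => /andP[/eqP fy /eqP gy].
have [yA|yB] := KAB _ (ideal_locus_zero yK).
  by apply: fy; rewrite fE; apply: (yA G) => // t; exact: apt_hv.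
by apply: gy; rewrite gE; apply: (yB H) => // t; exact: apt_hv.
Qed.

Variable V : set (P1x4 R).
Hypothesis sV : subvariety V.
Hypothesis finV : forall t, ~ (V `<=` [set x | x t = aff false 0]).
Local Notation IV := (@IV R s V).

(** Three free coordinates would give a chain of four prime ideals, hence of
    four subvarieties inside [V]. *)
Lemma three_dependent : ~ subvariety_chain V 3 -> exists2 P : mp 3, P != 0 & IV P.
Proof.
move=> nchain; apply: contrapT => no; apply: nchain.
have fr : free 3 (IV (n := 4)).
  move=> f g If fg; apply/eqP; apply: contrapT => /negP g0; apply: no; exists g => //.
  by move=> y Vy; rewrite -fg; exact: If.
have [K [pK KI Kc]] := prime_chain (isT : 3 <= 4)%N (IV_prime us ss sV finV (leqnn 4)) fr.
exists (fun i => ideal_locus (K i)); split=> [i|i j ij].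
  split; first exact: ideal_locus_subvariety.
  have KiI f : IV f -> K i f.
    move/KI; have i3 : (i <= 3)%N by rewrite -ltnS.
    suff H m : (m <= 3)%N -> K 3 f -> K (3 - m)%N f by rewrite -(subKn i3); apply: H; exact: leq_subr.
    elim: m => [//|m IH] m3 /(IH (ltnW m3)).
    have -> : (3 - m = (3 - m.+1).+1)%N by rewrite subnSK.
    have m3' : (3 - m.+1 < 3)%N by rewrite ltn_subrL.
    by have [KK _] := Kc _ m3'; exact: KK.
  move=> x xK; have [[S [hS VE]] _ _] := sV; rewrite VE => H SH v vx.
  have [f fE] := dehomogenize us ss H; apply: xK => //; split; first exact: hS.
  exists f => //; apply: KiI => y Vy; rewrite fE; rewrite VE in Vy.
  by apply: Vy => // t; exact: apt_hv.
have sub k m : (k <= m <= 3)%N -> ideal_locus (K k) `<=` ideal_locus (K m).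
  elim: m => [|m IH]; first by rewrite leqn0 => /andP[/eqP-> _] x.
  rewrite leq_eqVlt => /andP[/orP[/eqP-> _ x //|km] m3].
  apply: (subset_trans (IH _)); first by rewrite -ltnS km ltnW.
  have [KK _] := Kc m m3; move=> x xK H [hH [f Kf fE]] v vx.
  by apply: xK => //; split=> //; exists f => //; exact: KK.
have [i3 j3] : (i < 3)%N /\ (j <= 3)%N by split; [rewrite (leq_trans ij) // -ltnS|rewrite -ltnS].
split; first by apply: sub; rewrite (ltnW ij).
have [_ [Y [KY nKY]]] := Kc i i3.
move=> KjKi; have [y yK yY] := prime_zero (pK i.+1) nKY.
case/eqP: yY; apply: (ideal_locusP KY); apply: KjKi; apply: (sub i.+1); first by rewrite ij.
exact: ideal_locus_zero.
Qed.

End Dimension.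

(** * Simple roots depend holomorphically on the coefficients *)

Section VanishingProduct.
Variables (K : numFieldType) (V : normedModType K).

(** A function that vanishes at a point may be multiplied by a merely continuous
    one without losing differentiability there. *)
Lemma differentiable_mul0 (N D : V -> K) (x : V) :
    differentiable N x -> N x = 0 -> {for x, continuous D} ->
  differentiable (fun z => N z * D z) x.
Proof.
move=> dN Nx cD.
have cdN : continuous ('d N x) by have /diff_locallyP[] := dN.
have [k k0 kP] := linear_lipschitz cdN.
have H : (fun z => N z * D z) \o shift x =
    cst (N x * D x) + (D x \*: 'd N x) +o_ (0 : V) id.
  apply/eqaddoP => /= eps eps0.
  have /eqaddoP oN := diff_locally dN.
  have D1 : 0 < `|D x| + 1 by rewrite ltr_wpDl.
  pose eps1 := eps / 2 / (`|D x| + 1); pose eps2 := eps / 2 / k.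
  have e1 : 0 < eps1 by rewrite !divr_gt0.
  have e2 : 0 < eps2 by rewrite !divr_gt0.
  have cD0 : D (h + x) @[h --> (0 : V)] --> D x.
    have := cD; rewrite /continuous_at /prop_for -{1}(add0r x) -cvg_comp_shift.
    exact.
  have B1 := oN eps1 e1.
  have /cvgrPdist_le/(_ _ e2) B2 := cD0.
  have /cvgrPdist_le/(_ _ ltr01) B3 := cD0.
  move: B1 B2 B3; apply: filterS3 => h h1 h2 h3.
  have {}h1 : `|N (h + x) - 'd N x h| <= eps1 * `|h|.
    by move: h1; rewrite /= !fctE /= Nx add0r.
  rewrite !fctE /= Nx mul0r add0r.
  have -> : N (h + x) * D (h + x) - D x *: 'd N x h =
      (N (h + x) - 'd N x h) * D (h + x) - 'd N x h * (D x - D (h + x)).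
    by rewrite /GRing.scale /=; ring.
  apply: (le_trans (ler_normB _ _)); rewrite !normrM.
  have -> : eps * `|h| = eps1 * `|h| * (`|D x| + 1) + k * `|h| * eps2.
    rewrite /eps1 /eps2; field.
    by rewrite (gt_eqF k0) (gt_eqF D1).
  apply: lerD; apply: ler_pM => //.
  rewrite -[D (h + x)](subrK (D x)) addrC; apply: (le_trans (ler_normD _ _)).
  by rewrite lerD2l distrC.
apply/diff_locallyP; have cl : continuous (D x \*: 'd N x).
  by move=> v; apply: cvgZr; exact: cdN.
by rewrite (diff_unique cl H).
Qed.

Lemma near_eq_differentiable (f g : V -> K) (x : V) :
  (\forall z \near x, f z = g z) -> differentiable g x -> differentiable f x.
Proof.
move=> fg dg; have cdg : continuous ('d g x) by have /diff_locallyP[] := dg.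
have fgx : f x = g x by exact: nbhs_singleton fg.
have H : f \o shift x = cst (f x) + 'd g x +o_ (0 : V) id.
  apply/eqaddoP => /= eps eps0; have /eqaddoP/(_ eps eps0) := diff_locally dg.
  have fg0 : \forall h \near (0 : V), f (h + x) = g (h + x).
    by move: fg; rewrite (near_shift 0 x) subr0.
  by move: fg0; apply: filterS2 => h; rewrite !fctE /= fgx => ->.
by apply/diff_locallyP; rewrite (diff_unique cdg H).
Qed.

End VanishingProduct.

Lemma positive_lower_bound (K : numFieldType) (s : seq K) : all (fun x => 0 < x) s ->
  exists2 d : K, 0 < d & forall x, x \in s -> d <= x.
Proof.
elim: s => [|a s IH] /=; first by exists 1.
move=> /andP[a0 /IH[d d0 ds]].
have [ad|/negP ad] := boolP (a <= d).
  exists a => // x; rewrite inE => /orP[/eqP->//|/ds]; exact: le_trans.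
exists d => // x; rewrite inE => /orP[/eqP->|/ds//].
have := real_leVge (gtr0_real a0) (gtr0_real d0).
by case/orP => // /ad.
Qed.

Lemma distinct_distance (K : numFieldType) (T : finType) (r : T -> K) : injective r ->
  exists2 d : K, 0 < d & forall t u, t != u -> d + d <= `|r t - r u|.
Proof.
move=> rinj.
pose s := [seq `|r p.1 - r p.2| | p <- enum [pred p : T * T | p.1 != p.2]].
have [|d d0 ds] := @positive_lower_bound _ s.
  apply/allP => x /mapP[[t u]]; rewrite mem_enum /= inE /= => tu ->.
  by rewrite normr_gt0 subr_eq0; apply: contra_neq tu; exact: rinj.
exists (d / 2); first by rewrite divr_gt0.
move=> t u tu; rewrite -splitr; apply: ds; apply/mapP; exists (t, u) => //.
by rewrite mem_enum.
Qed.

Section RootFunctions.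
Variables (K : numClosedFieldType) (V : normedModType K).
Implicit Types (z : V) (y : K).

Lemma cts_sum (J : Type) (r : seq J) (G : J -> V -> K) z :
  (forall k, {for z, continuous (G k)}) ->
  {for z, continuous (fun w => \sum_(k <- r) G k w)}.
Proof.
move=> cG; elim: r => [|a r IH].
  rewrite (_ : (fun _ => _) = (fun=> 0)); first exact: cst_continuous.
  by apply/funext => w; rewrite big_nil.
rewrite (_ : (fun _ => _) = (fun w => G a w + \sum_(k <- r) G k w)).
  exact: continuousD.
by apply/funext => w; rewrite big_cons.
Qed.

Lemma cts_exp (f : V -> K) n z : {for z, continuous f} ->
  {for z, continuous (fun w => f w ^+ n)}.
Proof.
move=> cf; elim: n => [|n IH].
  rewrite (_ : (fun _ => _) = (fun=> 1)); first exact: cst_continuous.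
  by apply/funext => w; rewrite expr0.
rewrite (_ : (fun _ => _) = (fun w => f w * f w ^+ n)); first exact: continuousM.
by apply/funext => w; rewrite exprS.
Qed.

Variables (n : nat) (c : nat -> V -> K).

Definition fam z : {poly K} := \poly_(k < n.+1) c k z.

Definition regular z := (forall k, (k <= n)%N -> differentiable (c k) z) /\ c n z != 0.

Lemma size_fam z : c n z != 0 -> size (fam z) = n.+1.
Proof. by move=> cz; rewrite size_poly_eq. Qed.

Lemma lead_fam z : c n z != 0 -> lead_coef (fam z) = c n z.
Proof. by move=> cz; rewrite lead_coefE size_fam // coef_poly ltnSn. Qed.

Lemma fam_differentiable z y : regular z -> differentiable (fun w => (fam w).[y]) z.
Proof.
move=> [dc _].
rewrite (_ : (fun w => _) = \sum_(k < n.+1) (y ^+ k *: c k)).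
  by apply: differentiable_sum => k; apply: differentiableZ; apply: dc; rewrite -ltnS.
apply/funext => w; rewrite horner_poly fct_sumE; apply: eq_bigr => k _.
by rewrite fctE /GRing.scale /= mulrC.
Qed.

(** The value of a polynomial at [y] is, up to the leading coefficient, the
    product of the distances from [y] to the roots, so it cannot be small if all
    of these are large. *)
Lemma root_near z y (d : K) : regular z -> root (fam z) y -> 0 < d ->
  \forall w \near z, exists2 y', root (fam w) y' & `|y - y'| < d.
Proof.
move=> rz ry d0; have [dc cz] := rz.
have cc : {for z, continuous (c n)} by apply: differentiable_continuous; exact: dc.
have cf : {for z, continuous (fun w => (fam w).[y] / c n w)}.
  apply: continuousM; first exact/differentiable_continuous/fam_differentiable.
  exact: (@cvgV _ _ _ _ _ _ cz cc).
have near0 : \forall w \near z, c n w != 0 by exact: cvgr_neq0 cc cz.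
have dn : 0 < d ^+ n by rewrite exprn_gt0.
have /cvgrPdist_lt/(_ _ dn) neard := cf.
move: near0 neard; apply: filterS2 => w cw.
rewrite (rootP ry) mul0r sub0r normrN => small.
have [s sE] := closed_field_poly_normal (fam w).
rewrite lead_fam // in sE.
have ss : size s = n.
  have := size_fam cw; rewrite sE size_scale // size_prod_XsubC => -[].
  by [].
suff [r rs rd] : exists2 r, r \in s & `|y - r| < d.
  exists r => //; rewrite sE rootZ // root_prod_XsubC //.
apply: contrapT => no; move: small; rewrite sE hornerZ mulrC mulKf //.
rewrite horner_prod; apply/negP; rewrite -(real_leNgt (gtr0_real dn) (normr_real _)).
rewrite normr_prod -ss; have {}no r : r \in s -> d <= `|y - r|.
  move=> r_s; rewrite (real_leNgt (gtr0_real d0) (normr_real _)).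
  by apply/negP => rd; apply: no; exists r.
elim: (s) no => [|a s' IH] no; first by rewrite big_nil.
rewrite big_cons exprS; apply: ler_pM; [exact: ltW|by rewrite exprn_ge0 // ltW| |].
  by rewrite hornerXsubC; apply: no; rewrite mem_head.
by apply: IH => r rs'; apply: no; rewrite inE rs' orbT.
Qed.

Variables (z0 : V) (rs : seq K).
Hypotheses (reg : \forall z \near z0, regular z) (urs : uniq rs) (srs : size rs = n)
  (rts : all (root (fam z0)) rs).

(** The functions follow the roots within disjoint discs.  They are continuous
    because roots depend continuously on the coefficients; dividing the
    polynomial by the linear factor of a root then expresses the increment of
    the root as the value of the polynomial there times a continuous function,
    which suffices by [differentiable_mul0]. *)
Lemma root_functions : exists phi : 'I_n -> V -> K,
  (forall t, phi t z0 = nth 0 rs t) /\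
  \forall z \near z0, [/\ forall t, differentiable (phi t) z, injective (phi^~ z) &
    forall y, root (fam z) y <-> exists t, y = phi t z].
Proof.
pose r (t : 'I_n) := nth 0 rs t.
have rinj t u : r t = r u -> t = u.
  by move=> /eqP; rewrite /r nth_uniq ?srs // => /eqP/val_inj.
have [d d0 dr] : exists2 d : K, 0 < d & forall t u, t != u -> d + d <= `|r t - r u|.
  exact: distinct_distance.
have regz0 : regular z0 by exact: nbhs_singleton reg.
have rroot t : root (fam z0) (r t) by apply: (allP rts); rewrite mem_nth // srs.
pose good z := regular z /\ forall t, exists2 y, root (fam z) y & `|r t - y| < d.
have ngood : \forall z \near z0, good z.
  have nr : \forall z \near z0, forall t, exists2 y, root (fam z) y & `|r t - y| < d.
    by apply: filter_forall => t; exact: root_near regz0 (rroot t) d0.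
  by move: reg nr; apply: filterS2 => z rz nz; split.
pose phi t z := xget 0 [set y | root (fam z) y /\ `|r t - y| < d].
have phiP z t : good z -> root (fam z) (phi t z) /\ `|r t - phi t z| < d.
  move=> [_ /(_ t)[y ry yd]]; rewrite /phi; case: xgetP => [y' _ []|/(_ y)] // H.
  by case: H.
have disc t u y : `|r t - y| < d -> `|r u - y| < d -> t = u.
  move=> ty uy; apply: contrapT => /eqP /dr.
  have : `|r t - r u| < d + d.
    have -> : r t - r u = (r t - y) - (r u - y) by rewrite opprB addrA subrK.
    by apply: le_lt_trans (ler_normB _ _) _; rewrite ltrD.
  by move=> /lt_le_trans H /H; rewrite ltxx.
have phi_inj z : good z -> injective (phi^~ z).
  move=> gz t u tu; have [_ td] := phiP z t gz; have [_ ud] := phiP z u gz.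
  by apply: (disc _ _ (phi t z)) => //; rewrite tu.
have phi_root z y : good z -> root (fam z) y -> exists t, y = phi t z.
  move=> gz ry; apply: contrapT => no; have [[_ cz] _] := gz.
  have f0 : fam z != 0 by rewrite -size_poly_gt0 size_fam.
  have /max_poly_roots : fam z != 0 by [].
  move=> /(_ (y :: [seq phi t z | t <- enum 'I_n])); rewrite /= ry /=.
  rewrite size_map size_enum_ord size_fam // ltnn map_inj_uniq ?enum_uniq; last exact: phi_inj.
  rewrite andbT => H; have : false; last by [].
  apply: H.
    by apply/allP => _ /mapP[t _ ->]; have [] := phiP z t gz.
  by apply/negP => /mapP[t _ yE]; apply: no; exists t.
have phi_uniq z t y : good z -> root (fam z) y -> `|r t - y| < d -> y = phi t z.
  move=> gz ry yd; have [u yE] := phi_root z y gz ry; rewrite yE; congr phi.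
  by have [_ ud] := phiP z u gz; apply/esym/(disc t u y yd); rewrite yE.
have phi_cont z t : (\forall w \near z, good w) -> {for z, continuous (phi t)}.
  move=> ng; have gz := nbhs_singleton ng; have [rz _] := gz; have [rp pd] := phiP z t gz.
  apply/cvgrPdist_lt => eps eps0.
  (* a disc of this radius around [phi t z] stays inside the one around [r t] *)
  pose e := Num.min eps (d - `|r t - phi t z|).
  have dz0 : 0 < d - `|r t - phi t z| by rewrite subr_gt0.
  have [e0 e1 e2] : [/\ 0 < e, e <= eps & e <= d - `|r t - phi t z|].
    have cmp : eps >=< d - `|r t - phi t z| by apply: real_comparable; exact: gtr0_real.
    by rewrite /e comparable_lt_min // comparable_ge_min // comparable_ge_min // !lexx orbT eps0.
  move: ng (root_near rz rp e0); apply: filterS2 => w gw [y ry yd].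
  have <- : y = phi t w.
    apply: phi_uniq => //.
    have -> : r t - y = (r t - phi t z) + (phi t z - y) by rewrite addrA subrK.
    apply: le_lt_trans (ler_normD _ _) _; rewrite addrC -ltrBrDr.
    exact: lt_le_trans yd e2.
  exact: lt_le_trans yd e1.
have phi_diff z t : (\forall w \near z, good w) -> differentiable (phi t) z.
  move=> ng; have gz := nbhs_singleton ng; have [rz _] := gz; have [rp pd] := phiP z t gz.
  have [dc cz] := rz.
  set y1 := phi t z.
  have rp' : root (fam z) y1 by [].
  pose q w : {poly K} := \sum_(k < n.+1) c k w *: \sum_(a < k) y1 ^+ a *: 'X^(k.-1 - a).
  have qE w : fam w - (fam w).[y1]%:P = ('X - y1%:P) * q w.
    rewrite /fam horner_poly poly_def rmorph_sum /= -sumrB mulr_sumr.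
    apply: eq_bigr => k _; rewrite -scalerAr polyCM -mul_polyC.
    rewrite -mulrBr mul_polyC; congr (_ *: _).
    rewrite polyC_exp subrXX; congr (_ * _); apply: eq_bigr => a _.
    by rewrite mulrC -polyC_exp mul_polyC.
  have q1 : (q z).[y1] != 0.
    apply/eqP => q0; have f0 := qE z; rewrite (rootP rp') subr0 in f0.
    have fz0 : fam z != 0 by rewrite -size_poly_gt0 size_fam.
    have qz0 : q z != 0 by apply: contra_neq fz0 => qz0; rewrite f0 qz0 mulr0.
    have sq : size (q z) = n.
      have := size_fam cz; rewrite f0 mulrC size_Mmonic ?monicXsubC // size_XsubC.
      by rewrite addn2 => -[].
    have /max_poly_roots : q z != 0 by [].
    move=> /(_ [seq phi u z | u <- enum 'I_n]); rewrite sq size_map size_enum_ord ltnn.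
    rewrite map_inj_uniq ?enum_uniq; last exact: phi_inj.
    move=> H; have : false; last by []; apply: H => //; apply/allP => _ /mapP[u _ ->].
    have [->|ut] := eqVneq u t; first exact/eqP.
    have [ru _] := phiP z u gz; move: ru; rewrite f0 rootM root_XsubC => /orP[/eqP/(phi_inj z gz)|//].
    by move=> /eqP; rewrite (negbTE ut).
  have qc : {for z, continuous (fun w => (q w).[phi t w])}.
    rewrite (_ : (fun w => _) = (fun w => \sum_(k < n.+1) c k w * \sum_(a < k) y1 ^+ a * phi t w ^+ (k.-1 - a))).
      apply: cts_sum => k; apply: continuousM.
        by apply: differentiable_continuous; apply: dc; rewrite -ltnS.
      apply: cts_sum => a; apply: continuousM; first exact: cst_continuous.
      by apply: cts_exp; exact: phi_cont.
    apply/funext => w; rewrite horner_sum; apply: eq_bigr => k _; rewrite hornerZ; congr (_ * _).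
    by rewrite horner_sum; apply: eq_bigr => a _; rewrite hornerZ hornerXn.
  have near_eq : \forall w \near z, phi t w = y1 + (fam w).[y1] * - ((q w).[phi t w])^-1.
    have qn0 : \forall w \near z, (q w).[phi t w] != 0 by exact: cvgr_neq0 qc q1.
    move: ng qn0; apply: filterS2 => w gw qw; have [rw _] := phiP w t gw.
    have := congr1 (fun p => p.[phi t w]) (qE w).
    rewrite !hornerE (rootP rw) sub0r => E.
    by rewrite mulrN -mulNr E mulfK // addrC subrK.
  have D : differentiable (fun w => y1 + (fam w).[y1] * - ((q w).[phi t w])^-1) z.
    apply: (@differentiableD _ _ _ (fun=> y1)); first exact: differentiable_cst.
    apply: differentiable_mul0; first exact: fam_differentiable.
      exact/rootP.
    apply: continuousN; exact: (@cvgV _ _ _ _ _ _ q1 qc).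
  exact: near_eq_differentiable near_eq D.
exists phi; split.
  have g0 := nbhs_singleton ngood.
  by move=> t; apply/esym/(phi_uniq z0 t _ g0 (rroot t)); rewrite subrr normr0.
have : \forall z \near z0, \forall w \near z, good w by exact: nbhs_interior ngood.
apply: filterS => z ng; have gz := nbhs_singleton ng; split.
- by move=> t; exact: phi_diff.
- exact: phi_inj.
move=> y; split; first exact: phi_root.
by move=> [t ->]; have [] := phiP z t gz.
Qed.

End RootFunctions.

(** * General fibres over a coordinate plane *)

Section SeparableRoots.
Variable K : numClosedFieldType.

Lemma separable_roots (p : {poly K}) : p != 0 -> (forall y, root p y -> p^`().[y] != 0) ->
  exists rs, [/\ uniq rs, size rs = (size p).-1 & forall y, root p y = (y \in rs)].
Proof.
move=> p0 sp; have [rs pE] := closed_field_poly_normal p.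
have lp : lead_coef p != 0 by rewrite lead_coef_eq0.
exists rs; split; first last.
- by move=> y; rewrite pE rootZ // root_prod_XsubC.
- by rewrite pE size_scale // size_prod_XsubC.
apply: contrapT => /negP nu.
have [x [t rsx]] : exists x t, perm_eq rs [:: x, x & t].
  elim: (rs) nu => [//|a r IH] /=; rewrite negb_and negbK => /orP[ar|/IH[x [t rt]]].
    by exists a, (rem a r); rewrite perm_cons perm_to_rem.
  exists x, (a :: t); rewrite -(perm_cons a) in rt; apply: (perm_trans rt).
  by rewrite (perm_catCA [:: a] [:: x; x] t).
have rx : root p x by rewrite pE rootZ // root_prod_XsubC (perm_mem rsx) mem_head.
case/eqP: (sp x rx); rewrite pE (perm_big _ rsx) !big_cons /=.
by rewrite derivZ !derivM !derivXsubC !hornerE subrr !mul0r addr0 mulr0.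
Qed.

End SeparableRoots.

Definition fpt (K : numClosedFieldType) (b : nat -> K) (y2 y3 : K) :=
  set_var (set_var b 2 y2) 3 y3.

Section Tower.
Variable R : realType.
Variable s : seq 'I_4.
Hypotheses (us : uniq s) (ss : size s = 4%N).
Local Notation o k := (nth ord0 s k).
Local Notation mp := (mp (C R)).
Variable V : set (P1x4 R).
Hypothesis sV : subvariety V.
Hypothesis finV : forall t, ~ (V `<=` [set x | x t = aff false 0]).
Local Notation JV := (@IV R s V).
Hypothesis indep : forall G : mp 2, JV G -> G = 0.

Lemma ev_C x n (c : mp n) : ev x n.+1 (c%:P : {poly mp n}) = ev x n c.
Proof. exact: evMC. Qed.

Lemma contract_IV n (c : mp n) : contract (JV (n := n.+1)) c <-> JV c.
Proof. by split=> Ic y Vy; have := Ic y Vy; rewrite /ev evMC. Qed.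

Lemma indep_neq0 (G : mp 2) : ~ JV G -> G != 0.
Proof. by move=> IG; apply: contra_notN IG => /eqP -> y _; rewrite rmorph0. Qed.

Let p3 : prime_ideal (JV (n := 3)) := IV_prime us ss sV finV (isT : 3 <= 4)%N.
Let p4 : prime_ideal (JV (n := 4)) := IV_prime us ss sV finV (isT : 4 <= 4)%N.

(** In characteristic zero the derivative has smaller degree and a nonzero
    leading coefficient. *)
Lemma min_poly_deriv n (g : mp n.+1) : (n < 4)%N -> min_poly (JV (n := n.+1)) g ->
  ~ JV ((g : {poly mp n})^`() : mp n.+1).
Proof.
move=> n4 gm Ig'; have pn := IV_prime us ss sV finV n4; have [_ lg _] := gm.
have s1 := min_poly_size gm; apply: lg; apply/contract_IV => y Vy.
have small : (size (g : {poly mp n})^`() < size (g : {poly mp n}))%N.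
  by apply: lt_size_deriv; exact: min_poly_neq0 pn _ gm.
have /contract_IV/(_ y Vy) := min_poly_small pn gm Ig' small (size (g : {poly mp n})).-2.
rewrite coef_deriv rmorphMn /= prednK -/(lead_coef _); last by case: (size _) s1 => [|[]].
by move=> /eqP; rewrite mulrn_eq0 => /orP[|/eqP//]; case: (size _) s1 => [|[]].
Qed.

Section Norms.
Variable g2 : mp 3.
Hypothesis gm2 : min_poly (JV (n := 3)) g2.

(** An inverse modulo the ideal up to a factor [h] from the coefficients plays
    the role of the norm. *)
Lemma norm3 (f : mp 3) : ~ JV f -> exists2 h : mp 2, h != 0 &
  forall x, ev x 2 h != 0 -> zeros (JV (n := 3)) x -> ev x 3 f != 0.
Proof.
move=> If; have [u [c [Ic Iu]]] := min_poly_invert p3 gm2 If.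
exists c; first by apply: indep_neq0 => /contract_IV.
move=> x cx /(_ _ Iu); rewrite rmorphB rmorphM ev_C => /eqP.
rewrite subr_eq0 => /eqP E; apply: contra_neq cx => f0.
by rewrite -E f0 mulr0.
Qed.

Lemma zeros3 b y2 : ev b 2 (lead_coef (g2 : {poly mp 2})) != 0 ->
  root (map_poly (ev b 2) (g2 : {poly mp 2})) y2 -> zeros (JV (n := 3)) (set_var b 2 y2).
Proof.
move=> lb /rootP r2; apply: (min_poly_zeros p3 gm2 (phi := ev (set_var b 2 y2) 3)).
- by move=> c /contract_IV/indep ->; rewrite rmorph0.
- by rewrite ev_C ev_set_var.
- by rewrite (@ev_set_varS _ b 2).
Qed.

Variable g3 : mp 4.
Hypothesis gm3 : min_poly (JV (n := 4)) g3.

Lemma norm4 (f : mp 4) : ~ JV f -> exists2 h : mp 2, h != 0 &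
  forall x, ev x 2 h != 0 -> zeros (JV (n := 4)) x -> ev x 4 f != 0.
Proof.
move=> If; have [u [c [Ic Iu]]] := min_poly_invert p4 gm3 If.
have [|h h0 hP] := norm3 (f := c); first by move/contract_IV.
exists h => // x hx xI; have x3 : zeros (JV (n := 3)) x.
  by move=> a /contract_IV/xI; rewrite ev_C.
have cx := hP x hx x3; have := xI _ Iu; rewrite rmorphB rmorphM ev_C => /eqP.
by rewrite subr_eq0 => /eqP E; apply: contra_neq cx => f0; rewrite -E f0 mulr0.
Qed.

Lemma zeros4 x y3 : zeros (JV (n := 3)) x -> ev x 3 (lead_coef (g3 : {poly mp 3})) != 0 ->
  root (map_poly (ev x 3) (g3 : {poly mp 3})) y3 -> zeros (JV (n := 4)) (set_var x 3 y3).
Proof.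
move=> x3 lb /rootP r3; apply: (min_poly_zeros p4 gm3 (phi := ev (set_var x 3 y3) 4)).
- by move=> c /contract_IV/x3; rewrite ev_C ev_set_var.
- by rewrite ev_C ev_set_var.
- by rewrite (@ev_set_varS _ x 3).
Qed.
End Norms.

(** In this order the relation between three coordinates shows that the fourth
    coordinate, too, stays finite over general points. *)
Definition swapped : seq 'I_4 := [:: o 0; o 1; o 3; o 2].

Lemma swapped_uniq : uniq swapped.
Proof. by rewrite /swapped /= !inE !(order_eq us ss). Qed.

Hypothesis dep2 : exists2 P : mp 3, P != 0 & JV P.
Hypothesis dep3 : exists2 P : mp 3, P != 0 & @IV R swapped V 3 P.

(** A triangular description of the fibres of [V] over the points where [h] does
    not vanish: the third coordinate is a simple root of [g2], and over each
    such root the fourth is a simple root of [g3]. *)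
Record tower (g2 : mp 3) (g3 : mp 4) (h : mp 2) : Prop := Tower {
  tower_min : min_poly (JV (n := 3)) g2;
  tower_h : h != 0;
  tower_nz : forall b, ev b 2 h != 0 -> b 0%N != 0 /\ b 1%N != 0;
  tower_lead2 : forall b, ev b 2 h != 0 -> ev b 2 (lead_coef (g2 : {poly mp 2})) != 0;
  tower_lead3 : forall b y2, ev b 2 h != 0 -> root (map_poly (ev b 2) (g2 : {poly mp 2})) y2 ->
    ev (set_var b 2 y2) 3 (lead_coef (g3 : {poly mp 3})) != 0;
  tower_size3 : (1 < size (g3 : {poly mp 3}))%N;
  tower_fin : forall b x, ev b 2 h != 0 -> V x -> x (o 0) = aff true (b 0%N) ->
    x (o 1) = aff true (b 1%N) -> exists y2 y3, x = apt s (fpt b y2 y3);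
  tower_roots : forall b y2 y3, ev b 2 h != 0 -> V (apt s (fpt b y2 y3)) <->
    root (map_poly (ev b 2) (g2 : {poly mp 2})) y2 /\
    root (map_poly (ev (set_var b 2 y2) 3) (g3 : {poly mp 3})) y3;
  tower_sep2 : forall b y2, ev b 2 h != 0 -> root (map_poly (ev b 2) (g2 : {poly mp 2})) y2 ->
    (map_poly (ev b 2) (g2 : {poly mp 2}))^`().[y2] != 0;
  tower_sep3 : forall b y2 y3, ev b 2 h != 0 -> root (map_poly (ev b 2) (g2 : {poly mp 2})) y2 ->
    root (map_poly (ev (set_var b 2 y2) 3) (g3 : {poly mp 3})) y3 ->
    (map_poly (ev (set_var b 2 y2) 3) (g3 : {poly mp 3}))^`().[y3] != 0 }.

Lemma apt_swapped (y : nat -> C R) : apt swapped (set_var (set_var y 2 (y 3%N)) 3 (y 2%N)) = apt s y.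
Proof.
apply/funext => t; rewrite -(order_index us ss t).
have o' k : (k < 4)%N -> nth ord0 swapped k = o (nth 0%N [:: 0; 1; 3; 2]%N k).
  by case: k => [|[|[|[|]]]].
move: (index_lt4 us ss t); case: (index t s) => [|[|[|[|//]]]] _.
- by rewrite apt_order // -(o' 0%N) // apt_order ?swapped_uniq.
- by rewrite apt_order // -(o' 1%N) // apt_order ?swapped_uniq.
- by rewrite apt_order // -(o' 3%N) // apt_order ?swapped_uniq.
- by rewrite apt_order // -(o' 2%N) // apt_order ?swapped_uniq.
Qed.

(** The two polynomials are minimal polynomials.  The polynomial [h] collects
    the conditions: nonzero coordinates, the leading coefficients of two
    relations that keep the points finite, the leading coefficients of [g2] and
    [g3], and their derivatives at their roots. *)
Lemma tower_exists : exists g2 g3 h, tower g2 g3 h.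
Proof.
have [P P0 IP] := dep2; have [P' P'0 IP'] := dep3.
have [g2 gm2] : exists g2 : mp 3, min_poly (JV (n := 3)) g2.
  apply: (min_poly_exists p3 IP (k := (size (P : {poly mp 2})).-1)).
  move=> /contract_IV/indep/eqP; rewrite -lead_coefE lead_coef_eq0; exact/negP.
have [g3 gm3] : exists g3 : mp 4, min_poly (JV (n := 4)) g3.
  pose Q : {poly mp 3} := map_poly (polyC : mp 2 -> mp 3) (P' : {poly mp 2}).
  have IQ : JV (Q : mp 4).
    move=> y Vy; set y' := set_var (set_var y 2 (y 3%N)) 3 (y 2%N).
    have Vy' : V (apt swapped y') by rewrite apt_swapped.
    rewrite -(IP' _ Vy') /ev !evMS -/(ev y 3) -/(ev y' 2) /y' /=; congr (_.[_]).
    apply/polyP => k; rewrite !coef_map; apply: etrans (ev_C y _) _.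
    by apply: eq_evM => -[|[|]].
  apply: (min_poly_exists p4 IQ (k := (size (P' : {poly mp 2})).-1)).
  move=> /contract_IV; rewrite coef_map /= => /contract_IV/indep/eqP.
  by rewrite -lead_coefE lead_coef_eq0; exact/negP.
have [_ lg2 _] := gm2; have [_ lg3 _] := gm3.
have [Ig2 Ig3] : JV (n := 3) g2 /\ JV (n := 4) g3 by have [? _ _] := gm2; have [? _ _] := gm3.
have lgJ2 : ~ JV (n := 2) (lead_coef (g2 : {poly mp 2})) by move/contract_IV.
have lgJ3 : ~ JV (n := 3) (lead_coef (g3 : {poly mp 3})) by move/contract_IV.
have [n3 n30 n3P] := norm3 gm2 lgJ3.
have [d2 d20 d2P] := norm3 gm2 (min_poly_deriv (isT : 2 < 4)%N gm2).
have [d3 d30 d3P] := norm4 gm2 gm3 (min_poly_deriv (isT : 3 < 4)%N gm3).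
have [x0 x0E] := @same_ev_var (C R) 2 0 isT; have [x1 x1E] := @same_ev_var (C R) 2 1 isT.
have nz (z : mp 2) k : (forall x, ev x 2 z = x k) -> z != 0.
  by move=> zE; apply/eqP => z0; have := zE (fun=> 1); rewrite z0 rmorph0 => /esym/eqP; rewrite oner_eq0.
have lP : lead_coef (P : {poly mp 2}) != 0 by rewrite lead_coef_eq0.
have lP' : lead_coef (P' : {poly mp 2}) != 0 by rewrite lead_coef_eq0.
(* the coordinates are made nonzero because the boxes have to stay away from
   zero *)
pose h : mp 2 := x0 * x1 * (lead_coef (P : {poly mp 2}) * lead_coef (P' : {poly mp 2})) *
  (lead_coef (g2 : {poly mp 2}) * n3) * (d2 * d3).
have hE b : ev b 2 h != 0 -> [/\ b 0%N != 0, b 1%N != 0,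
    ev b 2 (lead_coef (P : {poly mp 2})) != 0 /\ ev b 2 (lead_coef (P' : {poly mp 2})) != 0,
    ev b 2 (lead_coef (g2 : {poly mp 2})) != 0 /\ ev b 2 n3 != 0 & ev b 2 d2 != 0 /\ ev b 2 d3 != 0].
  by rewrite /h !rmorphM /= x0E x1E !mulf_eq0 !negb_or -!andbA; do 7!(case/andP=> ->).
have z3 b y2 : ev b 2 h != 0 -> root (map_poly (ev b 2) (g2 : {poly mp 2})) y2 ->
    zeros (JV (n := 3)) (set_var b 2 y2).
  by move=> /hE[_ _ _ [l2 _] _]; exact: zeros3.
have lead3 b y2 : ev b 2 h != 0 -> root (map_poly (ev b 2) (g2 : {poly mp 2})) y2 ->
    ev (set_var b 2 y2) 3 (lead_coef (g3 : {poly mp 3})) != 0.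
  move=> hb r2; apply: n3P; last exact: z3.
  by rewrite ev_set_var; have [_ _ _ [_ ->] _] := hE b hb.
exists g2, g3, h; split=> //.
- by rewrite /h !mulf_neq0 // ?(nz _ _ x0E) ?(nz _ _ x1E) // lead_coef_eq0 (min_poly_neq0 p3 gm2).
- by move=> b /hE[].
- by move=> b /hE[_ _ _ []].
- exact: min_poly_size gm3.
- move=> b x hb Vx xb0 xb1; have [_ _ [lPb lPb'] _ _] := hE b hb.
  have [y2 xE2] : exists y2, x (o 2) = aff true y2.
    have [//|xi] := P1_cases (x (o 2)); case/eqP: lPb.
    by apply: (IV_infty us ss sV finV _ IP Vx) => // -[|[|]].
  have [y3 xE3] : exists y3, x (o 3) = aff true y3.
    have [//|xi] := P1_cases (x (o 3)); case/eqP: lPb'.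
    by apply: (IV_infty swapped_uniq _ sV finV _ IP' Vx) => // -[|[|]].
  exists y2, y3; apply/funext => t; rewrite -(order_index us ss t).
  by move: (index_lt4 us ss t); case: (index t s) => [|[|[|[|//]]]] _; rewrite apt_order.
- move=> b y2 y3 hb; split=> [Vy|[r2 r3]].
    split; apply/rootP.
      by have := Ig2 _ Vy; rewrite /fpt ev_set_var ev_set_varS.
    by have := Ig3 _ Vy; rewrite /fpt ev_set_varS.
  apply: (IV_zeros us ss sV); apply: (zeros4 gm3) => //; first exact: z3.
  exact: lead3.
- move=> b y2 hb r2; have [_ _ _ _ [d2b _]] := hE b hb.
  have := d2P (set_var b 2 y2); rewrite ev_set_var => /(_ d2b (z3 _ _ hb r2)).
  by rewrite ev_set_varS -deriv_map.
move=> b y2 y3 hb r2 r3; have [_ _ _ _ [_ d3b]] := hE b hb.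
have := d3P (set_var (set_var b 2 y2) 3 y3).
have -> : ev (set_var (set_var b 2 y2) 3 y3) 2 d3 = ev b 2 d3.
  by apply: eq_evM => -[|[|]].
move=> /(_ d3b); rewrite ev_set_varS -deriv_map; apply.
by apply: (zeros4 gm3) => //; [exact: z3|exact: lead3].
Qed.

End Tower.

(** * Sheets over general points *)

Section TowerSheets.
Variable K : numClosedFieldType.

Lemma ev_differentiable (E : normedModType K) n (f : mp K n) (x : nat -> E -> K) z :
  (forall k, (k < n)%N -> differentiable (x k) z) ->
  differentiable (fun w => ev (x^~ w) n f) z.
Proof.
elim: n f => [|n IH] f dx; first exact: differentiable_cst.
rewrite (_ : (fun w => _) = \sum_(k < size (f : {poly mp K n}))
    ((fun w => ev (x^~ w) n (f : {poly mp K n})`_k) * (fun w => x n w ^+ k))).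
  apply: differentiable_sum => k; apply: differentiableM.
    by apply: IH => m mn; apply: dx; rewrite ltnW.
  case: (k : nat) => [|m]; first exact: differentiable_cst.
  rewrite (_ : (fun w => _) = x n ^+ m.+1); first by apply: differentiableX; exact: dx.
  by apply/funext => w; rewrite fctE.
apply/funext => w; rewrite /ev evM_coef fct_sumE; apply: eq_bigr => k _.
by rewrite fctE.
Qed.

Definition pt (w : K * K) (k : nat) : K :=
  if k is 0%N then w.1 else if k is 1%N then w.2 else 0.

Lemma pt_differentiable k (w : K * K) : differentiable (pt^~ k) w.
Proof.
case: k => [|[|k]]; last exact: differentiable_cst.
  have [D _] := is_diff_affine1 0 1 w; move: D; congr (differentiable _ _).
  by apply/funext => v; rewrite add0r mul1r.
have [D _] := is_diff_affine2 0 1 w; move: D; congr (differentiable _ _).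
by apply/funext => v; rewrite add0r mul1r.
Qed.

Lemma near_nonzero (f : mp K 2) w0 : ev (pt w0) 2 f != 0 ->
  \forall w \near w0, ev (pt w) 2 f != 0.
Proof.
move=> fw0; have df : differentiable (fun w => ev (pt w) 2 f) w0.
  by apply: (@ev_differentiable _ _ f (fun k w => pt w k)) => k _; exact: pt_differentiable.
have cf : {for w0, continuous (fun w => ev (pt w) 2 f)} by exact: differentiable_continuous df.
exact: cvgr_neq0 cf fw0.
Qed.

Variables (g2 : mp K 3) (g3 : mp K 4) (h : mp K 2).
Let n2 := (size (g2 : {poly mp K 2})).-1.
Let n3 := (size (g3 : {poly mp K 3})).-1.
Let r2 w := map_poly (ev (pt w) 2) (g2 : {poly mp K 2}).
Let r3 w y := map_poly (ev (set_var (pt w) 2 y) 3) (g3 : {poly mp K 3}).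

Hypothesis lead2 : forall w, ev (pt w) 2 h != 0 -> ev (pt w) 2 (lead_coef (g2 : {poly mp K 2})) != 0.
Hypothesis lead3 : forall w y2, ev (pt w) 2 h != 0 -> root (r2 w) y2 ->
  ev (set_var (pt w) 2 y2) 3 (lead_coef (g3 : {poly mp K 3})) != 0.
Hypothesis sep2 : forall w y2, ev (pt w) 2 h != 0 -> root (r2 w) y2 -> (r2 w)^`().[y2] != 0.
Hypothesis sep3 : forall w y2 y3, ev (pt w) 2 h != 0 -> root (r2 w) y2 -> root (r3 w y2) y3 ->
  (r3 w y2)^`().[y3] != 0.

Lemma fam_map n (f : mp K n.+1) (x : nat -> K * K -> K) w : (0 < size (f : {poly mp K n}))%N ->
  fam (size (f : {poly mp K n})).-1 (fun k w => ev (x^~ w) n (f : {poly mp K n})`_k) w =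
  map_poly (ev (x^~ w) n) (f : {poly mp K n}).
Proof.
by move=> f0; rewrite /fam prednK.
Qed.

(** Simple roots are followed twice, the second time with coefficients that
    depend on the first root. *)
Lemma tower_functions w0 : ev (pt w0) 2 h != 0 ->
  exists (phi2 : 'I_n2 -> K * K -> K) (phi3 : 'I_n2 -> 'I_n3 -> K * K -> K),
  \forall w \near w0, [/\ forall t, differentiable (phi2 t) w,
    forall t u, differentiable (phi3 t u) w, injective (phi2^~ w),
    forall t, injective (fun u => phi3 t u w) &
    ev (pt w) 2 h != 0 /\ forall y2 y3, root (r2 w) y2 /\ root (r3 w y2) y3 <->
      exists t u, y2 = phi2 t w /\ y3 = phi3 t u w].
Proof.
move=> hw0.
have nearh := near_nonzero hw0.
have g20 : (0 < size (g2 : {poly mp K 2}))%N.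
  by rewrite size_poly_gt0; apply: contra_neq (lead2 hw0) => ->; rewrite lead_coef0 rmorph0.
pose c2 k w := ev (pt w) 2 (g2 : {poly mp K 2})`_k.
have f2 w : fam n2 c2 w = r2 w by exact: (fam_map (fun k w => pt w k)).
have reg2 : \forall w \near w0, regular n2 c2 w.
  move: nearh; apply: filterS => w hw; split; last exact: lead2.
  move=> k _; apply: (@ev_differentiable _ _ _ (fun k w => pt w k)) => m _.
  exact: pt_differentiable.
have r20 : r2 w0 != 0.
  by apply: contra_neq (lead2 hw0) => r20; rewrite lead_coefE -coef_map -/(r2 w0) r20 coef0.
have [rs2 [urs2 srs2 rts2]] := separable_roots r20 (fun y => sep2 hw0).
have sr2 : size (r2 w0) = size (g2 : {poly mp K 2}).
  by rewrite size_map_poly_id0 // lead2.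
have rt2 : all (root (fam n2 c2 w0)) rs2.
  by apply/allP => y; rewrite f2 -rts2.
rewrite sr2 in srs2; have [phi2 [phi20 near2]] := root_functions reg2 urs2 srs2 rt2.
have [diff0 inj0 roots0] := nbhs_singleton near2.
pose x t k w := set_var (pt w) 2 (phi2 t w) k.
pose c3 t k w := ev (x t ^~ w) 3 (g3 : {poly mp K 3})`_k.
have rt0 t : root (r2 w0) (phi2 t w0) by rewrite -f2; apply/roots0; exists t.
have ex3 t : exists phi : 'I_n3 -> K * K -> K, \forall w \near w0,
    [/\ forall u, differentiable (phi u) w, injective (phi^~ w) &
      forall y, root (r3 w (phi2 t w)) y <-> exists u, y = phi u w].
  have l3 := lead3 hw0 (rt0 t).
  have g30 : (0 < size (g3 : {poly mp K 3}))%N.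
    by rewrite size_poly_gt0; apply: contra_neq l3 => ->; rewrite lead_coef0 rmorph0.
  have f3 w : fam n3 (c3 t) w = r3 w (phi2 t w) by exact: (fam_map (x t)).
  have r30 : r3 w0 (phi2 t w0) != 0.
    by apply: contra_neq l3 => r30; rewrite lead_coefE -coef_map -/(r3 w0 _) r30 coef0.
  have [rs3 [urs3 srs3 rts3]] := separable_roots r30 (fun y => sep3 hw0 (rt0 t)).
  have sr3 : size (r3 w0 (phi2 t w0)) = size (g3 : {poly mp K 3}).
    by rewrite size_map_poly_id0.
  have reg3 : \forall w \near w0, regular n3 (c3 t) w.
    move: nearh near2; apply: filterS2 => w hw [dw _ rw]; split; last first.
      by apply: lead3 => //; rewrite -f2; apply/rw; exists t.
    move=> k _; apply: ev_differentiable => m _; rewrite /x /set_var.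
    by case: eqP => _; [exact: dw|exact: pt_differentiable].
  have rt3 : all (root (fam n3 (c3 t) w0)) rs3.
    by apply/allP => y; rewrite f3 -rts3.
  rewrite sr3 in srs3; have [phi [_ near3]] := root_functions reg3 urs3 srs3 rt3.
  by exists phi; move: near3; apply: filterS => w [dw iw rw]; split=> // y; rewrite -f3.
have [phi3 phi3P] := choice ex3; exists phi2, phi3.
have near3' : \forall w \near w0, forall t, [/\ forall u, differentiable (phi3 t u) w,
    injective ((phi3 t)^~ w) & forall y, root (r3 w (phi2 t w)) y <-> exists u, y = phi3 t u w].
  refine (@filter_forall _ _ _ _ (nbhs_filter w0) _); exact: phi3P.
move: nearh near2 near3'; apply: filterS3 => w hw [dw iw rw] near3; split=> //.
- by move=> t u; have [] := near3 t.
- by move=> t; have [] := near3 t.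
split=> // y2 y3; split=> [[]|[t [u [-> ->]]]].
  rewrite -f2 => /rw[t ->]; have [_ _ r] := near3 t; move=> /r[u ->].
  by exists t, u.
split; first by rewrite -f2; apply/rw; exists t.
by have [_ _ r] := near3 t; apply/r; exists u.
Qed.

End TowerSheets.

Lemma small_box (K : numFieldType) (P : set (K * K)) (q : K * K) : q.1 != 0 -> q.2 != 0 ->
  nbhs q P -> exists e : K, [/\ 0 < e, e <= `|q.1|, e <= `|q.2| &
    forall z : K * K, `|z.1| < 1 -> `|z.2| < 1 -> P (q.1 + e * z.1, q.2 + e * z.2)].
Proof.
move=> q1 q2 /nbhs_ballP[r /= r0 rP].
have [|e e0 eP] := @positive_lower_bound _ [:: r; `|q.1|; `|q.2|].
  by rewrite /= r0 !normr_gt0 q1 q2.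
have near (c t : K) : `|t| < 1 -> ball c r (c + e * t).
  move=> t1; rewrite -ball_normE /ball_ /= opprD addNKr normrN normrM gtr0_norm //.
  apply: (@lt_le_trans _ _ e); last by apply: eP; rewrite mem_head.
  by rewrite gtr_pMr.
exists e; split=> //; try by apply: eP; rewrite !inE eqxx ?orbT.
by move=> z z1 z2; apply: rP; split; exact: near.
Qed.

Lemma open_rectangle (K : numFieldType) (a b d d' : K) :
  open [set y : K * K | `|a - y.1| < d /\ `|b - y.2| < d'].
Proof.
rewrite openE => -[y1 y2] /= [n1 n2]; exists (ball a d, ball b d') => /=.
  by split; apply: open_nbhs_nbhs; split; rewrite -?ball_normE //; exact: ball_open.
by move=> [c1 c2] [/= ]; rewrite -!ball_normE.
Qed.

Section FibreCount.
Variable R : realType.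
Variable s : seq 'I_4.
Hypotheses (us : uniq s) (ss : size s = 4%N).
Local Notation o k := (nth ord0 s k).
Local Notation mp := (mp (C R)).
Variable V : set (P1x4 R).

Variables (g2 : mp 3) (g3 : mp 4) (h : mp 2).
Hypothesis T : tower s V g2 g3 h.

(** A small box around the point is chosen on which all the functions are
    defined and stay close to their values at the centre; the sheets are then
    separated by disjoint rectangles in the last two coordinates. *)
Lemma tower_sheets (q : C R * C R) : ev (pt q) 2 h != 0 ->
  exists L : seq (C R * C R), [/\ uniq L, ((size (g2 : {poly mp 2})).-1 <= size L)%N,
    forall y, y \in L <-> V (apt s (fpt (pt q) y.1 y.2)) &
    exists e f W, [/\ 0 < e, e <= `|q.1|, e <= `|q.2| &
      @sheeted R (o 0) (o 1) q e V (size L) f W]].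
Proof.
move=> hq; have [q1 q2] := tower_nz T hq.
have [phi2 [phi3 near_q]] := tower_functions (fun w => @tower_lead2 _ _ _ _ _ _ T (pt w))
  (fun w => @tower_lead3 _ _ _ _ _ _ T (pt w)) (fun w => @tower_sep2 _ _ _ _ _ _ T (pt w))
  (fun w => @tower_sep3 _ _ _ _ _ _ T (pt w)) hq.
set n2 := (size (g2 : {poly mp 2})).-1 in phi2 phi3 near_q.
set n3 := (size (g3 : {poly mp 3})).-1 in phi3 near_q.
have n3pos : (0 < n3)%N by have := tower_size3 T; rewrite /n3; case: (size _) => [|[]].
have [dphi2 dphi3 inj2 inj3 [_ rts]] := nbhs_singleton near_q.
pose I := ('I_n2 * 'I_n3)%type.
pose F w (a : I) := (phi2 a.1 w, phi3 a.1 a.2 w).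
have Finj w : injective (phi2^~ w) -> (forall t, injective (fun u => phi3 t u w)) -> injective (F w).
  move=> i2 i3 [t u] [t' u'] [] /= /i2 tt; rewrite -tt => /i3 -> //.
pose L := [seq F q a | a <- enum {: I}].
have sL : size L = #|{: I}| by rewrite size_map -cardE.
have [d2 d20 d2P] := distinct_distance inj2.
have d3ex t : exists d : C R, 0 < d /\ forall u u', u != u' -> d + d <= `|phi3 t u q - phi3 t u' q|.
  by have [d d0 dP] := distinct_distance (inj3 t); exists d.
have [d3 d3P] := choice d3ex.
pose close w := forall a : I, `|phi2 a.1 q - phi2 a.1 w| < d2 /\ `|phi3 a.1 a.2 q - phi3 a.1 a.2 w| < d3 a.1.
have near_close : \forall w \near q, close w.
  apply: (@filter_forall _ _ (fun a w => _) _ (nbhs_filter q)) => a.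
  have c2 : {for q, continuous (phi2 a.1)} by exact: differentiable_continuous.
  have c3 : {for q, continuous (phi3 a.1 a.2)} by exact: differentiable_continuous.
  have [d30 _] := d3P a.1.
  move/cvgrPdist_lt/(_ _ d20): c2 => c2; move/cvgrPdist_lt/(_ _ d30): c3 => c3.
  by move: c2 c3; apply: filterS2.
pose P w := [/\ ev (pt w) 2 h != 0, forall a : I, differentiable (phi2 a.1) w /\ differentiable (phi3 a.1 a.2) w,
  close w & forall y2 y3, V (apt s (fpt (pt w) y2 y3)) <-> exists a : I, F w a = (y2, y3)].
have nearP : nbhs q P.
  move: near_q near_close; apply: filterS2 => w [dw2 dw3 _ _ [hw rw]] cw; split=> // y2 y3.
  rewrite (tower_roots T) // rw; split=> [[t [u [-> ->]]]|[[t u] [<- <-]]]; first by exists (t, u).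
  by exists t, u.
have [e [e0 e1 e2 eP']] := small_box q1 q2 nearP.
have eP z (zd : polydisc z) := eP' z (proj1 zd) (proj2 zd).
exists L; split.
- by rewrite map_inj_uniq ?enum_uniq //; exact: Finj.
- by rewrite sL card_prod !card_ord leq_pmulr.
- have [_ _ _ Vq] := nbhs_singleton nearP; move=> [y2 y3]; rewrite Vq; split.
    by move=> /mapP[a _ aE]; exists a.
  by move=> [a aE]; apply/mapP; exists a; rewrite ?mem_enum.
pose at_ (z : C R * C R) := (q.1 + e * z.1, q.2 + e * z.2).
pose a_ (t : 'I_(size L)) : I := enum_val (cast_ord sL t).
pose f (t : 'I_(size L)) (k : 'I_4) (z : C R * C R) :=
  fpt (pt (at_ z)) (F (at_ z) (a_ t)).1 (F (at_ z) (a_ t)).2 (index k s).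
pose U (t : 'I_(size L)) : set (C R * C R) :=
  [set y | `|phi2 (a_ t).1 q - y.1| < d2 /\ `|phi3 (a_ t).1 (a_ t).2 q - y.2| < d3 (a_ t).1].
exists e, f, (fun t => over (o 2) (o 3) 0 1 (U t)); split=> //.
have fapt t z : sheet_point (f t) z = apt s (fpt (pt (at_ z)) (F (at_ z) (a_ t)).1 (F (at_ z) (a_ t)).2).
  by [].
split.
- move=> t k z zd; have [_ dz _ _] := eP z zd.
  have [d2z d3z] := dz (a_ t).
  have dat : differentiable at_ z.
    have [d1 _] := is_diff_affine1 q.1 e z; have [d1' _] := is_diff_affine2 q.2 e z.
    exact: differentiable_pair.
  pose G w := fpt (pt w) (F w (a_ t)).1 (F w (a_ t)).2 (index k s).
  suff dG : differentiable G (at_ z) by exact: (differentiable_comp dat dG).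
  rewrite /G /fpt /set_var; case: eqP => _; first exact: d3z.
  by case: eqP => _; [exact: d2z|exact: pt_differentiable].
- by move=> t z; rewrite /f !index_order.
- split=> [t|t t' x].
    by apply: open_over => //; exact: open_rectangle.
  move=> [y [[y2 y3] xy2 xy3]] [y' [[y2' y3'] xy2' xy3']].
  have E1 : y'.1 = y.1 by have := aff_true_inj (etrans (esym xy2') xy2); rewrite !add0r !mul1r.
  have E2 : y'.2 = y.2 by have := aff_true_inj (etrans (esym xy3') xy3); rewrite !add0r !mul1r.
  rewrite E1 in y2'; rewrite E2 in y3'.
  (* discs around points at distance at least [d + d] are disjoint *)
  have far (c c' y0 d : C R) : `|c - y0| < d -> `|c' - y0| < d -> ~ (d + d <= `|c - c'|).
    move=> cd cd' H; suff lt : `|c - c'| < d + d by have := le_lt_trans H lt; rewrite ltxx.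
    by apply: le_lt_trans (ler_distD y0 _ _) _; rewrite ltrD // distrC.
  apply: contrapT => /eqP tt; have aa : a_ t != a_ t'.
    by apply: contra_neq tt => /enum_val_inj/cast_ord_inj.
  have [e12|n12] := eqVneq (a_ t).1 (a_ t').1; last exact: far y2 y2' (d2P _ _ n12).
  have e22 : (a_ t).2 != (a_ t').2.
    by apply: contra_neq aa; move: e12; case: (a_ t) => ? ?; case: (a_ t') => ? ? /= -> ->.
  rewrite -e12 in y3'; have [_ d3t] := d3P (a_ t).1.
  exact: far y3 y3' (d3t _ _ e22).
- move=> x Vx [z [zd xi xj]]; have [hz _ _ Vz] := eP z zd.
  have [y2 [y3 xE]] := tower_fin T hz Vx xi xj; rewrite xE in Vx.
  have [a aE] := (Vz y2 y3).1 Vx.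
  exists (cast_ord (esym sL) (enum_rank a)), z; split=> //.
  by rewrite fapt xE /a_ cast_ordKV enum_rankK aE.
move=> t z zd; have [hz dz cz Vz] := eP z zd; rewrite fapt; split.
  by apply/Vz; exists (a_ t); case: (F _ _).
exists (F (at_ z) (a_ t)); rewrite !apt_order //; split; first exact: cz.
  by rewrite /fpt /set_var /= add0r mul1r.
by rewrite /fpt /set_var /= add0r mul1r.
Qed.
End FibreCount.

(** * Intersection numbers as numbers of points *)

Section Realized.
Variables (R : realType) (p : 'I_4 -> 'I_4 -> int) (V : set (P1x4 R)).
Variables (c z : singular_chain R (P1x4 R) 4).
Hypothesis psym : forall a b, p a b = p b a.
Hypotheses (sV : subvariety V) (dimV : ~ subvariety_chain V 3).
Hypotheses (pc : represents_eta p c) (Vz : fundamental_cycle V z)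
  (cz : homologous setT set0 c z).
Local Notation mp := (mp (C R)).

Lemma off_box_zero i j (q : C R * C R) (e : C R) : i != j -> 0 < e -> e <= `|q.1| -> e <= `|q.2| ->
  (forall x, V x -> ~ box i j q e x) -> p i j = 0.
Proof.
move=> ij e0 e1 e2 /off_box_sheeted[f [W sh]].
exact: (eta_sheets psym pc Vz cz ij e0 e1 e2 sh).
Qed.

Lemma infinite_number i j : i != j -> V `<=` [set x | x i = aff false 0] -> p i j = 0.
Proof.
move=> ij Vi; apply: (@off_box_zero i j (1, 1) 1) => //; rewrite ?normr1 //.
by move=> x /Vi xi [y [_ ]]; rewrite xi => /esym/aff_infty.
Qed.

Hypothesis finV : forall t, ~ (V `<=` [set x | x t = aff false 0]).

Section Order.
Variable s : seq 'I_4.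
Hypotheses (us : uniq s) (ss : size s = 4%N).
Local Notation o k := (nth ord0 s k).

Let o01 : o 0 != o 1. Proof. by rewrite (order_eq us ss). Qed.

Lemma ev_pt (x : nat -> C R) (f : mp 2) : ev x 2 f = ev (pt (x 0%N, x 1%N)) 2 f.
Proof. by apply: eq_evM => -[|[|]]. Qed.

(** Where the relation does not vanish there are no points of [V], so that a
    small box misses [V]. *)
Lemma dependent_number (G : mp 2) : G != 0 -> IV s V G -> p (o 0) (o 1) = 0.
Proof.
move=> G0 IG.
have [x0 x0E] := @same_ev_var (C R) 2 0 isT; have [x1 x1E] := @same_ev_var (C R) 2 1 isT.
have nz (f : mp 2) k : (forall x, ev x 2 f = x k) -> f != 0.
  by move=> fE; apply/eqP => f0; have := fE (fun=> 1); rewrite f0 rmorph0 => /esym/eqP; rewrite oner_eq0.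
have [|x] := @exists_nonzero _ _ (x0 * x1 * G).
  by rewrite !mulf_neq0 // ?(nz _ _ x0E) ?(nz _ _ x1E).
rewrite !rmorphM x0E x1E !mulf_eq0 !negb_or -andbA => /and3P[q1 q2].
rewrite ev_pt; set q := (x 0%N, x 1%N) => Gq.
have [e [e0 e1 e2 eP]] := @small_box (C R) _ q q1 q2 (near_nonzero Gq).
apply: (off_box_zero o01 e0 e1 e2) => y Vy [w [[w1 w2] y1 y2]].
have := eP w w1 w2; rewrite (IV_relation us ss sV finV _ IG Vy) ?eqxx // => -[|[|]] //.
Qed.

Lemma fibre_number : (forall G : mp 2, IV s V G -> G = 0) ->
  exists (g : mp 3) (h : mp 2), [/\ g != 0, IV s V g, h != 0,
    ((size (g : {poly mp 2})).-1%:Z <= p (o 0) (o 1))%R &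
    forall q, ev (pt q) 2 h != 0 -> exists L : seq (C R * C R), [/\ uniq L,
      p (o 0) (o 1) = (size L)%:Z & forall y, y \in L <-> V (apt s (fpt (pt q) y.1 y.2))]].
Proof.
move=> ind.
have dep2 := three_dependent us ss sV finV dimV.
have dep3 := three_dependent (swapped_uniq us ss) erefl sV finV dimV.
have [g2 [g3 [h T]]] := tower_exists us ss sV finV ind dep2 dep3.
have [g20 h0] := (min_poly_neq0 (IV_prime us ss sV finV (isT : 3 <= 4)%N) (tower_min T), tower_h T).
have fib q : ev (pt q) 2 h != 0 -> exists L : seq (C R * C R), [/\ uniq L,
      p (o 0) (o 1) = (size L)%:Z, ((size (g2 : {poly mp 2})).-1 <= size L)%N &
      forall y, y \in L <-> V (apt s (fpt (pt q) y.1 y.2))].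
  move=> hq; have [L [uL sL LV [e [f [W [e0 e1 e2 sh]]]]]] := tower_sheets us ss T hq.
  exists L; split=> //; exact: (eta_sheets psym pc Vz cz o01 e0 e1 e2 sh).
exists g2, h; split=> //.
- by have [] := tower_min T.
- have [x] := exists_nonzero h0; rewrite ev_pt => /fib[L [_ -> sL _]].
  by rewrite lez_nat.
by move=> q /fib[L [uL sL _ LV]]; exists L.
Qed.

(** The minimal polynomial of the third coordinate, as each of its roots lifts
    to a point of the fibre; or, if two coordinates are dependent, their
    relation. *)
Lemma degree_number : exists g : mp 3, [/\ g != 0, IV s V g &
  ((size (g : {poly mp 2})).-1%:Z <= p (o 0) (o 1))%R].
Proof.
have [ind|] := pselect (forall G : mp 2, IV s V G -> G = 0).
  by have [g [h [g0 Ig _ sg _]]] := fibre_number ind; exists g.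
move=> /existsNP[G /not_implyP[IG /eqP G0]]; exists (G%:P : {poly mp 2}); split.
- by rewrite polyC_eq0.
- by move=> y Vy; rewrite ev_C IG.
by rewrite size_polyC G0 (dependent_number G0 IG).
Qed.

End Order.
End Realized.

(** * Factorial domains *)

Section Divisibility.
Variable A : idomainType.
Implicit Types a b c : A.

Definition divides a b : Prop := exists c, b = c * a.

Definition prime_elt a : Prop := a != 0 /\ prime_ideal (divides a).

(** Kaplansky's criterion for unique factorization, taken as the definition: it
    passes to polynomial rings without any bookkeeping of factorizations. *)
Definition factorial : Prop := forall I : A -> Prop, prime_ideal I ->
  (exists2 a, I a & a != 0) -> exists2 a, I a & prime_elt a.

(** Divisors of products of primes; they form a saturated multiplicative set,
    which is what a prime ideal is made to avoid. *)
Definition prime_product a : Prop := exists2 ps : seq A,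
  (forall b, b \in ps -> prime_elt b) & divides a (\prod_(b <- ps) b).

(** Otherwise a prime ideal containing [a] avoids the set of these divisors; but
    it contains a prime element. *)
Lemma factorial_product a : factorial -> a != 0 -> prime_product a.
Proof.
move=> fA a0; apply: contrapT => na.
have [||||||I [pI aI SI]] := @prime_avoiding A (divides a) prime_product.
- by exists 0; rewrite mul0r.
- by move=> b c [d ->] [e ->]; exists (d + e); rewrite mulrDl.
- by move=> b c [d ->]; exists (b * d); rewrite mulrA.
- by exists [::] => //; exists 1; rewrite big_nil mulr1.
- move=> b c [ps psP [d dE]] [qs qsP [e eE]]; exists (ps ++ qs).
    by move=> x; rewrite mem_cat => /orP[/psP|/qsP].
  by exists (d * e); rewrite big_cat /= dE eE mulrACA.
- move=> b [d ->] [ps psP [e eE]]; apply: na; exists ps => //.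
  by exists (e * d); rewrite eE mulrA.
have [b Ib pb] : exists2 b, I b & prime_elt b.
  by apply: fA => //; exists a => //; apply: aI; exists 1; rewrite mul1r.
apply: (SI b Ib); exists [:: b]; first by move=> x; rewrite inE => /eqP ->.
by exists 1; rewrite big_seq1 mul1r.
Qed.

Lemma prime_ideal_factor (I : A -> Prop) (ps : seq A) : prime_ideal I ->
  I (\prod_(b <- ps) b) -> exists2 b, b \in ps & I b.
Proof.
move=> pI; elim: ps => [|b ps IH]; first by rewrite big_nil => /(prime_ideal1 pI).
rewrite big_cons => /(prime_idealP pI)[Ib|/IH[d dps Id]]; first by exists b; rewrite ?mem_head.
by exists d => //; rewrite inE dps orbT.
Qed.

Lemma prime_product_cancel a b ps : prime_elt a -> (forall x, x \in ps -> prime_elt x) ->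
  divides (a * b) (\prod_(x <- ps) x) -> exists qs : seq A,
  [/\ (size qs < size ps)%N, forall x, x \in qs -> prime_elt x & divides b (\prod_(x <- qs) x)].
Proof.
move=> [a0 pa] psP [d dE].
have [x xps [w wE]] : exists2 x, x \in ps & divides a x.
  by apply: (prime_ideal_factor pa); exists (d * b); rewrite dE mulrCA mulrC.
have [x0 px] := psP x xps.
have [v vE] : divides x a.
  have : divides x (w * a) by exists 1; rewrite mul1r.
  case/(prime_idealP px) => // -[v vE]; case: (prime_ideal1 pa).
  exists v; apply: (mulIf x0); rewrite mul1r {1}wE vE mulrAC.
  by [].
exists (rem x ps); split.
- by rewrite size_rem // prednK //; case: (ps) xps.
- by move=> y /mem_rem/psP.
have vw : v * w = 1 by apply: (mulIf a0); rewrite mul1r -mulrA -wE -vE.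
exists (v * d); apply: (mulfI x0).
have <- : \prod_(y <- ps) y = x * \prod_(y <- rem x ps) y.
  by rewrite (perm_big _ (perm_to_rem xps)) big_cons.
rewrite dE {1}wE.
have -> : w * a * (v * d * b) = v * w * (d * (a * b)) by ring.
by rewrite vw mul1r.
Qed.

End Divisibility.

Lemma field_factorial (F : fieldType) : factorial F.
Proof.
move=> I pI [a Ia a0]; case: (prime_ideal1 pI).
by rewrite -(mulVf a0); exact: (prime_idealMl pI).
Qed.

Section GaussLemma.
Variable A : idomainType.
Implicit Types (f g : {poly A}).

(** The product of the first coefficients outside [I] is a coefficient of the
    product modulo [I]. *)
Lemma coefficientwise_prime (I : A -> Prop) : prime_ideal I ->
  prime_ideal (fun f : {poly A} => forall k, I f`_k).
Proof.
move=> pI; split.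
- by move=> k; rewrite coef0; exact: prime_ideal0 pI.
- by move=> f g If Ig k; rewrite coefD; exact: prime_idealD pI _ _ _ _.
- move=> f g Ig k; rewrite coefM; apply: (prime_ideal_sum pI) => j _.
  exact: (prime_idealMl pI).
- by move=> /(_ 0%N); rewrite coef1; exact: prime_ideal1 pI.
move=> f g Ifg.
have [|/existsNP[k fk]] := pselect (forall k, I f`_k); [by left|right=> l]; apply: contrapT => gl.
  have least (h : {poly A}) m : ~ I h`_m -> exists n, ~ I h`_n /\ forall a, (a < n)%N -> I h`_a.
    move=> hm; have ex : exists n, `[< ~ I h`_n >] by exists m; apply/asboolP.
    case: (ex_minnP ex) => n /asboolP hn nmin; exists n; split=> // a an.
    by apply: contrapT => ha; have := nmin a (introT (asboolP _) ha); rewrite leqNgt an.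
  have [k' [fk' fmin]] := least f k fk; have [l' [gl' gmin]] := least g l gl.
  have := Ifg (k' + l')%N; rewrite coefM.
  have kl : (k' < (k' + l').+1)%N by rewrite ltnS leq_addr.
  rewrite (bigD1 (Ordinal kl)) //= addKn => H.
  suff : I (f`_k' * g`_l') by case/(prime_idealP pI).
  rewrite -[X in I X](addrK (\sum_(j < (k' + l').+1 | j != Ordinal kl) f`_j * g`_(k' + l' - j))).
  apply: (prime_idealB pI) => //; apply: (prime_ideal_sum pI) => j jk.
  have [jk'|jk'|jk'] := ltngtP j k'.
  - by apply: (prime_idealMr pI); exact: fmin.
  - apply: (prime_idealMl pI); apply: gmin; have := ltn_ord j.
    by move: jk'; lia.
  - by case/eqP: jk; apply: val_inj.
Qed.

Lemma divides_polyC (a : A) f : divides a%:P f <-> forall k, divides a f`_k.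
Proof.
split=> [[h ->] k|fk]; first by exists h`_k; rewrite coefMC.
have [c cE] := choice fk; exists (\poly_(k < size f) c k).
apply/polyP => k; rewrite coefMC coef_poly; case: ltnP => // kf.
by rewrite mul0r nth_default.
Qed.

Lemma prime_polyC (a : A) : prime_elt a -> prime_elt a%:P.
Proof.
move=> [a0 pa]; split; first by rewrite polyC_eq0.
suff -> : divides a%:P = (fun f => forall k, divides a f`_k) by exact: coefficientwise_prime.
by apply/funext => f; apply/propext; exact: divides_polyC.
Qed.

Hypothesis fA : factorial A.

Definition primitive f : Prop := forall a, prime_elt a -> ~ divides a%:P f.

(** The process of dividing by prime elements ends because it removes a factor
    from a product of primes that the leading coefficient divides. *)
Lemma primitive_part f : f != 0 -> exists (c : A) g, f = c%:P * g /\ primitive g.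
Proof.
move=> f0; have lf : lead_coef f != 0 by rewrite lead_coef_eq0.
have [ps psP dv] := factorial_product fA lf.
have [n] := ubnP (size ps); elim: n f f0 {lf} ps psP dv => [//|n IH] f f0 ps psP dv sn.
have [pf|] := pselect (primitive f); first by exists 1, f; rewrite mul1r.
move=> /existsNP[a /not_implyP[pa /contrapT[h hE]]].
have h0 : h != 0 by apply: contra_neq f0 => h0; rewrite hE h0 mul0r.
have [|qs [sq qsP dq]] := @prime_product_cancel _ a (lead_coef h) ps pa psP.
  by move: dv; rewrite hE lead_coefM lead_coefC mulrC.
have [c [g [gE pg]]] := IH h h0 qs qsP dq (leq_trans sq sn).
by exists (c * a), g; split=> //; rewrite hE gE polyCM mulrAC.
Qed.

(** Gauss's lemma: a prime dividing a multiple of a primitive polynomial divides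
    the cofactor. *)
Lemma primitive_cancel f g ps : primitive g -> (forall x, x \in ps -> prime_elt x) ->
  divides g ((\prod_(x <- ps) x)%:P * f) -> divides g f.
Proof.
move=> pg; elim: ps f => [|a ps IH] f psP; first by rewrite big_nil mul1r.
rewrite big_cons polyCM -mulrA => -[h hE].
have pa : prime_elt a by apply: psP; rewrite mem_head.
have [_ pa'] := prime_polyC pa.
have : divides a%:P (h * g) by exists ((\prod_(x <- ps) x)%:P * f); rewrite -hE mulrC.
case/(prime_idealP pa') => [[h' h'E]|/(pg a pa)//].
apply: IH => [x xps|]; first by apply: psP; rewrite inE xps orbT.
exists h'; have a0 : a%:P != 0 by rewrite polyC_eq0; case: pa.
by apply: (mulfI a0); rewrite hE h'E mulrCA mulrA.
Qed.

(** A prime ideal lying over zero is principal: an element of least degree,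
    divided by its content, divides every element up to a factor from the
    coefficients, which a primitive polynomial can be relieved of. *)
Lemma principal_over_zero (I : {poly A} -> Prop) : prime_ideal I ->
    (forall a, I a%:P -> a = 0) -> (exists2 f, I f & f != 0) ->
  exists g, [/\ I g, g != 0 & forall f, I f -> divides g f].
Proof.
move=> pI I0 [f If f0].
have [g gm] : exists g, min_poly I g.
  apply: (min_poly_exists pI If (k := (size f).-1)) => /I0/eqP.
  by rewrite -lead_coefE lead_coef_eq0; exact/negP.
have g0 := min_poly_neq0 pI gm; have [Ig _ _] := gm.
have [c [g' [gE pg']]] := primitive_part g0.
have c0 : c != 0 by apply: contra_neq g0 => c0; rewrite gE c0 mul0r.
have g'0 : g' != 0 by apply: contra_neq g0 => g'0; rewrite gE g'0 mulr0.
have Ig' : I g'.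
  by move: Ig; rewrite gE => /(prime_idealP pI)[/I0/eqP|//]; rewrite (negbTE c0).
exists g'; split=> // h Ih.
have [n [q [r [E _ rI]]]] := min_poly_reduce pI gm h.
have r0 : r = 0 by apply/polyP => k; rewrite coef0; apply: I0; exact: rI.
have l0 : lead_coef g ^+ n != 0 by rewrite expf_neq0 // lead_coef_eq0.
have [ps psP [d dE]] := factorial_product fA l0.
apply: (primitive_cancel pg' psP); exists (d%:P * q * c%:P).
by rewrite dE polyCM -!mulrA; congr (_ * _); rewrite mul_polyC E r0 addr0 gE.
Qed.

(** A prime ideal meets the coefficients, and then contains a prime of the
    coefficients, or it is principal. *)
Lemma poly_factorial : factorial ({poly A} : idomainType).
Proof.
move=> I pI [f If f0].
have [[a Ia a0]|no] := pselect (exists2 a, I a%:P & a != 0).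
  have [b Ib pb] := fA (prime_contract pI) (ex_intro2 _ _ a Ia a0).
  by exists b%:P => //; exact: prime_polyC.
have [|g [Ig g0 gI]] := principal_over_zero pI _ (ex_intro2 _ _ f If f0).
  by move=> a Ia; apply/eqP; apply: contrapT => /negP a0; apply: no; exists a.
exists g => //; split=> //.
suff <- : I = divides g by [].
apply/funext => h; apply/propext; split; first exact: gI.
by move=> [d ->]; exact: (prime_idealMl pI).
Qed.

End GaussLemma.

Lemma mp_factorial (F : numClosedFieldType) n : factorial (mp F n).
Proof. by elim: n => [|n IH]; [exact: field_factorial|exact: poly_factorial]. Qed.

(** * Counting the common zeros of two plane curves *)

Section Bezout.
Variable K : numClosedFieldType.
Implicit Types (p q : {poly {poly K}}) (x y : K).

(** Curves in the plane are polynomials in the ordinate, outermost, over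
    polynomials in the abscissa; so this is what remains of the equation above
    the abscissa [x]. *)
Definition line x p : {poly K} := map_poly (horner_eval x) p.

Lemma lineM x p q : line x (p * q) = line x p * line x q.
Proof. exact: rmorphM. Qed.

Lemma size_line x p : (size (line x p) <= size p)%N.
Proof. exact: size_poly. Qed.

(** A vanishing resultant yields a common divisor, which Gauss's lemma turns
    into a common factor of positive degree; above [x] it keeps its degree and
    has a root. *)
Lemma resultant_neq0 p q x : (lead_coef p).[x] != 0 ->
  (forall y, root (line x p) y -> ~~ root (line x q) y) -> resultant p q != 0.
Proof.
move=> px nr; rewrite resultant_eq0; apply/negP => sg.
pose g := gcdp p q; have g0 : g != 0 by rewrite -size_poly_gt0 (ltn_trans _ sg).
have fK : factorial ({poly K} : idomainType) := poly_factorial (@field_factorial K).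
have [c [g' [gE pg']]] := primitive_part fK g0.
have c0 : c != 0 by apply: contra_neq g0 => c0; rewrite gE c0 mul0r.
have dv r : g %| r -> divides (g' : {poly {poly K}}) r.
  move=> /Pdiv.Idomain.dvdpP[[d h] /= d0 E].
  have [ps psP [e eE]] := factorial_product fK d0.
  apply: (primitive_cancel pg' psP); exists (e%:P * h * c%:P).
  by rewrite eE polyCM -!mulrA -gE; congr (_ * _); rewrite mul_polyC E.
have [[h hE] [h' h'E]] := (dv p (dvdp_gcdl _ _), dv q (dvdp_gcdr _ _)).
have sg' : (1 < size g')%N by move: sg; rewrite -/g gE mul_polyC size_scale.
have lg' : (lead_coef g').[x] != 0.
  by apply: contra_neq px => l0; rewrite hE lead_coefM hornerM l0 mulr0.
have [|y /rootP yg] := @closed_root _ (line x g').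
  by rewrite /line size_map_poly_id0.
have := nr y; rewrite hE h'E !lineM !rootM yg !orbT.
by move=> /(_ isT).
Qed.

Lemma size_prod_bound (I : finType) (F : I -> {poly K}) (d : I -> nat) :
  (forall i, size (F i) <= (d i).+1)%N -> (size (\prod_i F i)%R <= (\sum_i d i).+1)%N.
Proof.
move=> Fd; elim/big_rec2: _ => [|i n r _ IH]; first by rewrite size_poly1.
apply: leq_trans (size_polyMleq _ _) _; move: (Fd i) IH; lia.
Qed.

(** In every term of the determinant one entry is taken from each row. *)
Lemma size_resultant p q a b :
  (forall k, size (p`_k)%R <= a.+1)%N -> (forall k, size (q`_k)%R <= b.+1)%N ->
  (size (resultant p q) <= ((size q).-1 * a + (size p).-1 * b).+1)%N.
Proof.
move=> pa qb; rewrite /resultant /determinant.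
apply: leq_trans (size_sum _ _ _) _; apply/bigmax_leqP => u _; rewrite size_Msign.
pose d (i : 'I_((size q).-1 + (size p).-1)) := if fintype.split i is inl _ then a else b.
apply: (@leq_trans (\sum_i d i).+1).
  apply: size_prod_bound => i; rewrite Sylvester_mxE /d.
  by case: fintype.split => k; rewrite mulrb; case: ifP; rewrite ?size_poly0.
rewrite big_split_ord /=; have dl i : d (lshift _ i) = a by rewrite /d (unsplitK (inl i)).
have dr i : d (rshift _ i) = b by rewrite /d (unsplitK (inr i)).
under eq_bigr do rewrite dl; under [X in (_ + X)%N]eq_bigr do rewrite dr.
by rewrite !sum_nat_const !card_ord.
Qed.

Lemma extend_uniq (ys : seq K) n : uniq ys -> (size ys <= n)%N ->
  exists zs, uniq (ys ++ zs) /\ size (ys ++ zs) = n.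
Proof.
move=> uy /subnK <-; elim: (n - size ys)%N => [|m [zs [uz sz]]].
  by exists [::]; rewrite cats0.
pose r : {poly K} := \prod_(y <- ys ++ zs) ('X - y%:P).
have [|y yr] := @exists_nonroot _ r.
  by rewrite monic_neq0 // monic_prod_XsubC.
exists (rcons zs y); rewrite -rcons_cat rcons_uniq size_rcons uz sz andbT.
by split=> //; move: yr; rewrite -rootE root_prod_XsubC.
Qed.

(** Multiplying the Sylvester matrix by a Vandermonde matrix makes one column
    vanish above [x] for each of the common zeros. *)
Lemma resultant_multiplicity p q x (ys : seq K) : uniq ys ->
  (size ys <= (size q).-1 + (size p).-1)%N ->
  (forall y, y \in ys -> root (line x p) y /\ root (line x q) y) ->
  ('X - x%:P) ^+ size ys %| resultant p q.
Proof.
move=> uy sy pqy; pose n := ((size q).-1 + (size p).-1)%N.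
have [zs [uz sz]] := extend_uniq uy sy.
pose z (j : 'I_n) := nth 0 (ys ++ zs) j.
(* only the first [size ys] columns matter, the others make the matrix
   invertible *)
pose T : 'M[K]_n := Vandermonde n (\row_j z j).
have T0 : \det T != 0.
  rewrite det_Vandermonde; apply/prodf_neq0 => i _; apply/prodf_neq0 => j ij.
  by rewrite !mxE subr_eq0 nth_uniq ?sz ?ltn_ord // gtn_eqF.
pose S := Sylvester_mx p q.
have entry (i j : 'I_n) : (j < size ys)%N -> root ((S *m map_mx polyC T) i j) x.
  move=> jy; have [py qy] : root (line x p) (z j) /\ root (line x q) (z j).
    by apply: pqy; rewrite /z nth_cat jy mem_nth.
  have shift r (k : nat) : (size ('X^k * line x r)%R <= n)%N -> root (line x r) (z j) ->
      \sum_(c < n) ((r`_(c - k) *+ (k <= c)).[x] * z j ^+ c) = 0.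
    move=> sr /rootP ry; have := horner_coef_wide (z j) sr.
    rewrite hornerM ry mulr0 => E; rewrite [RHS]E; apply: eq_bigr => c _.
    by rewrite coefXnM coef_map mulrb ltnNge; case: (k <= c)%N; rewrite ?horner0.
  have bound r (k m : nat) : (k < m)%N -> (size ('X^k * line x r)%R <= m + (size r).-1)%N.
    move=> km; apply: leq_trans (size_polyMleq _ _) _; rewrite size_polyXn /=.
    move: km (size_line x r); case: (size r) => [|v]; last by move: (size _) => u; lia.
    by rewrite leqn0 => /ltnW km /eqP ->; rewrite !addn0.
  apply/rootP; rewrite mxE horner_sum.
  have Tc (c : 'I_n) : (map_mx polyC T) c j = (z j ^+ c)%:P by rewrite !mxE.
  under eq_bigr => c _ do rewrite Tc hornerM hornerC /S Sylvester_mxE.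
  case: (fintype.split i) => k; apply: shift => //; first exact: bound.
  by rewrite /n addnC; exact: bound.
pose d (j : 'I_n) : {poly K} := if (j < size ys)%N then 'X - x%:P else 1.
have [M ME] : exists M : 'M[{poly K}]_n, S *m map_mx polyC T = M *m diag_mx (\row_j d j).
  have H (i j : 'I_n) : exists m, (S *m map_mx polyC T) i j = m * d j.
    rewrite /d; case: ifP => [jy|_]; first exact/factor_theorem/entry.
    by exists ((S *m map_mx polyC T) i j); rewrite mulr1.
  have [M MP] := choice (fun ij : 'I_n * 'I_n => H ij.1 ij.2).
  exists (\matrix_(i, j) M (i, j)); apply/matrixP => i j.
  by rewrite (MP (i, j)) mul_mx_diag !mxE.
have := congr1 determinant ME; rewrite !det_mulmx det_map_mx det_diag /= => E.
have T0' : (\det T)%:P != 0 by rewrite polyC_eq0.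
have : ('X - x%:P) ^+ size ys %| \det S * (\det T)%:P.
  rewrite E dvdp_mull //.
  under eq_bigr do rewrite mxE.
  rewrite -big_mkcond /= prodr_const.
  rewrite (_ : #|_| = size ys) //.
  rewrite -sum1_card -(big_ord_widen_cond n xpredT (fun=> 1%N)) //.
  by rewrite sum1_card card_ord.
by rewrite mulrC mul_polyC dvdpZr.
Qed.

Lemma dvd_prod_roots (D : {poly K}) (rs : seq K) :
  (forall x, ('X - x%:P) ^+ count_mem x rs %| D) -> \prod_(x <- rs) ('X - x%:P) %| D.
Proof.
elim: rs D => [|x rs IH] D rD; first by rewrite big_nil dvd1p.
have x0 : 'X - x%:P != 0 :> {poly K} by rewrite polyXsubC_eq0.
have /dvdpP[D' DE] : 'X - x%:P %| D.
  by apply: dvdp_trans (rD x); rewrite /= eqxx exprS dvdp_mulr.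
rewrite big_cons DE mulrC dvdp_mul2r //; apply: IH => y.
have := rD y; rewrite DE /=; have [->|xy] := eqVneq x y.
  rewrite add1n exprSr dvdp_mul2r ?polyXsubC_eq0 // .
rewrite add0n Gauss_dvdpl // coprimep_expl // coprimep_XsubC2 //.
by rewrite subr_eq0.
Qed.

(** The resultant is divisible by the product of the linear factors belonging to
    the abscissas of all common zeros, repeated according to the number of zeros
    above them. *)
Lemma bezout p q a b x0 (L : seq (K * K)) :
    (forall k, size (p`_k)%R <= a.+1)%N -> (forall k, size (q`_k)%R <= b.+1)%N ->
    (lead_coef p).[x0] != 0 ->
    (forall y, root (line x0 p) y -> ~~ root (line x0 q) y) ->
    (forall x, line x p = 0 -> line x q != 0) ->
    uniq L -> (forall z, z \in L -> root (line z.1 p) z.2 /\ root (line z.1 q) z.2) ->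
  (size L <= (size q).-1 * a + (size p).-1 * b)%N.
Proof.
move=> pa qb px0 nr0 nz uL LP; have D0 := resultant_neq0 px0 nr0.
rewrite -ltnS; apply: leq_trans (size_resultant pa qb).
rewrite -(size_map fst L) -(size_prod_XsubC _ id); apply: dvdp_leq => //.
apply: dvd_prod_roots => x.
pose ys := [seq z.2 | z <- L & z.1 == x].
have -> : count_mem x [seq z.1 | z <- L] = size ys.
  by rewrite size_map size_filter count_map.
have uy : uniq ys.
  rewrite map_inj_in_uniq ?filter_uniq // => -[u1 u2] [v1 v2].
  by rewrite !mem_filter /= => /andP[/eqP -> _] /andP[/eqP -> _] ->.
have yr y : y \in ys -> root (line x p) y /\ root (line x q) y.
  by case/mapP => z; rewrite mem_filter => /andP[/eqP <- /LP] + -> .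
apply: resultant_multiplicity => //.
have bound r : line x r != 0 -> {subset ys <= root (line x r)} -> (size ys <= (size r).-1)%N.
  move=> r0 yr'; rewrite -ltnS; have := max_poly_roots r0 (introT allP yr') uy.
  move=> /leq_trans H; apply: (leq_trans (H _ (size_line x r))); exact: leqSpred.
have [p0|p0] := eqVneq (line x p) 0.
  apply: leq_trans (leq_addr _ _); apply: bound (nz x p0) _ => y /yr[] //.
by apply: leq_trans (leq_addl _ _); apply: bound p0 _ => y /yr[].
Qed.

End Bezout.

(** * Reordering the variables *)

Section Reordering.
Variable K : numClosedFieldType.

Lemma evS n (f : mp K n.+1) x :
  ev x n.+1 f = (map_poly (ev x n) (f : {poly mp K n})).[x n].
Proof. by []. Qed.

Lemma horner_line (u : {poly {poly K}}) c y : u.[c%:P].[y] = (line y u).[c].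
Proof. by rewrite /line -horner_swapXY horner2_swapXY. Qed.

Lemma ev_horner2 n (f : mp K n.+2) x :
  ev x n.+2 f = (map_poly (map_poly (ev x n)) (f : {poly {poly mp K n}})).[(x n.+1)%:P].[x n].
Proof.
rewrite horner_line /line evS -map_poly_comp.
by congr (_.[_]); apply: eq_map_poly.
Qed.

Definition exchange n (x : nat -> K) : nat -> K := set_var (set_var x n (x n.+1)) n.+1 (x n).

Lemma ev_swapXY n (f : mp K n.+2) x :
  ev x n.+2 (swapXY (f : {poly {poly mp K n}}) : mp K n.+2) = ev (exchange n x) n.+2 f.
Proof.
have E0 : exchange n x n = x n.+1 by rewrite /exchange /set_var ltn_eqF // eqxx.
have E1 : exchange n x n.+1 = x n by rewrite /exchange /set_var eqxx.
rewrite !ev_horner2 -swapXY_map horner2_swapXY E0 E1.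
congr (_.[_].[_]); apply/polyP => a; rewrite !coef_map; apply/polyP => b; rewrite !coef_map /=.
by apply: eq_evM => m mn; rewrite /exchange /set_var !ltn_eqF // ltnW.
Qed.

Lemma ev_map_swapXY n (f : mp K n.+3) x :
  ev x n.+3 (map_poly swapXY (f : {poly {poly {poly mp K n}}}) : mp K n.+3) =
  ev (exchange n x) n.+3 f.
Proof.
have E2 : exchange n x n.+2 = x n.+2 by rewrite /exchange /set_var !gtn_eqF.
rewrite !(@evS n.+2) E2.
congr (_.[_]); apply/polyP => a; rewrite !coef_map; exact: ev_swapXY.
Qed.

Lemma ev2 (u : mp K 2) x : ev x 2 u = (line (x 0%N) (u : {poly {poly K}})).[x 1%N].
Proof.
have ev1 (v : {poly K}) : ev x 1 v = v.[x 0%N].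
  by rewrite evS map_poly_id.
rewrite evS; congr (_.[_]); apply/polyP => a.
by rewrite !coef_map; exact: ev1.
Qed.

Lemma ev3 (f : mp K 3) x :
  ev x 3 f = (line (x 0%N) (f : {poly {poly {poly K}}}).[(x 2%N)%:P%:P]).[x 1%N].
Proof.
rewrite -ev2 -horner_map evS; congr (_.[_]).
by rewrite ev2 /line map_polyC hornerC /= horner_evalE hornerC.
Qed.

Lemma divides_size (A : idomainType) (g f : {poly A}) : f != 0 -> divides g f ->
  (size g <= size f)%N.
Proof.
move=> f0 [h hE]; have g0 : g != 0 by apply: contra_neq f0 => g0; rewrite hE g0 mulr0.
have h0 : h != 0 by apply: contra_neq f0 => h0; rewrite hE h0 mul0r.
rewrite hE size_mul //; move: h0; rewrite -size_poly_gt0.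
by case: (size h) => // m _; rewrite addSn leq_addl.
Qed.

End Reordering.

(** * The equation of a projection *)

Section Generators.
Variables (R : realType) (p : 'I_4 -> 'I_4 -> int) (V : set (P1x4 R)).
Variables (c z : singular_chain R (P1x4 R) 4).
Hypothesis psym : forall a b, p a b = p b a.
Hypotheses (sV : subvariety V) (dimV : ~ subvariety_chain V 3).
Hypotheses (pc : represents_eta p c) (Vz : fundamental_cycle V z)
  (cz : homologous setT set0 c z).
Hypothesis finV : forall t, ~ (V `<=` [set x | x t = aff false 0]).
Local Notation mp := (mp (C R)).

Lemma apt_reorder (s s' : seq 'I_4) (perm : nat -> nat) (y y' : nat -> C R) :
    uniq s -> size s = 4%N -> uniq s' -> size s' = 4%N ->
    (forall m, (m < 4)%N -> [/\ (perm m < 4)%N, nth ord0 s' m = nth ord0 s (perm m) & y' m = y (perm m)]) ->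
  apt s' y' = apt s y.
Proof.
move=> us ss us' ss' sp; apply/funext => t; rewrite -(order_index us' ss' t).
have [p4 sE yE] := sp _ (index_lt4 us' ss' t).
by rewrite apt_order // ?index_lt4 // sE apt_order // yE.
Qed.

Lemma IV_swapXY a b d e (f : mp 3) : uniq [:: a; b; d; e] ->
  IV [:: a; b; d; e] V f -> IV [:: a; d; b; e] V (swapXY (f : {poly {poly {poly C R}}}) : mp 3).
Proof.
move=> us If y Vy; rewrite (@ev_swapXY _ 1); apply: If; move: Vy; congr V.
apply/esym; apply: (@apt_reorder _ _ (fun m => nth 0%N [:: 0; 2; 1; 3]%N m)) => //.
  by apply: etrans us; apply: perm_uniq; rewrite (perm_cons a) (perm_catCA [:: d] [:: b] [:: e]).
by case=> [|[|[|[|]]]].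
Qed.

Lemma IV_map_swapXY a b d e (f : mp 3) : uniq [:: a; b; d; e] ->
  IV [:: a; b; d; e] V f ->
  IV [:: b; a; d; e] V (map_poly swapXY (f : {poly {poly {poly C R}}}) : mp 3).
Proof.
move=> us If y Vy; rewrite (@ev_map_swapXY _ 0); apply: If; move: Vy; congr V.
apply/esym; apply: (@apt_reorder _ _ (fun m => nth 0%N [:: 1; 0; 2; 3]%N m)) => //.
  by apply: etrans us; apply: perm_uniq; rewrite (perm_catCA [:: b] [:: a] [:: d; e]).
by case=> [|[|[|[|]]]].
Qed.

(** The degree in a variable is the size of the polynomial after this variable
    has been made the outermost one, and in that order the generator divides a
    polynomial of the size given by [degree_number]. *)
Lemma generator (i j k l : 'I_4) : uniq [:: i; j; k; l] ->
    (forall G : mp 2, IV [:: i; j; k; l] V G -> G = 0) ->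
  exists P : {poly {poly {poly C R}}}, [/\ IV [:: i; j; k; l] V (P : mp 3), P != 0,
    forall f : mp 3, IV [:: i; j; k; l] V f -> divides (P : {poly mp 2}) f,
    (sizeY P).-1%:Z <= p i k &
    forall m n, (size P`_m`_n).-1%:Z <= p j k].
Proof.
move=> us ind.
have [P0 P00 IP0] := three_dependent us erefl sV finV dimV.
have [|P [IP Pn0 Pgen]] := principal_over_zero (@mp_factorial (C R) 2) (IV_prime us erefl sV finV (isT : 3 <= 4)%N) _ (ex_intro2 _ _ P0 IP0 P00).
  by move=> a /contract_IV/ind.
have us1 : uniq [:: i; k; j; l].
  by apply: etrans us; apply: perm_uniq; rewrite (perm_cons i) (perm_catCA [:: k] [:: j] [:: l]).
have us2 : uniq [:: j; i; k; l].
  by apply: etrans us; apply: perm_uniq; rewrite (perm_catCA [:: j] [:: i] [:: k; l]).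
have us3 : uniq [:: j; k; i; l].
  by apply: etrans us2; apply: perm_uniq; rewrite (perm_cons j) (perm_catCA [:: k] [:: i] [:: l]).
exists P; split=> //.
  have [g [g0 Ig]] := degree_number psym sV dimV pc Vz cz finV us1 erefl.
  apply: le_trans; rewrite lez_nat -!subn1 leq_sub2r // sizeYE; apply: divides_size => //.
  have [h hE] := Pgen _ (IV_swapXY us1 Ig).
  by exists (swapXY h); rewrite -rmorphM /= -hE swapXYK.
move=> m n; have [g [g0 Ig]] := degree_number psym sV dimV pc Vz cz finV us3 erefl.
apply: le_trans; rewrite lez_nat -!subn1 leq_sub2r //.
have [h hE] := Pgen _ (IV_map_swapXY us2 (IV_swapXY us3 Ig)).
pose sw : {rmorphism {poly {poly {poly C R}}} -> {poly {poly {poly C R}}}} := map_poly swapXY.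
have swK f : sw (sw f) = f.
  by apply/polyP => a; rewrite !coef_map /= swapXYK.
have : divides (swapXY (sw P)) (g : {poly {poly {poly C R}}}).
  by exists (swapXY (sw h)); rewrite -rmorphM /= -(rmorphM sw) -hE swK swapXYK.
move=> /(divides_size g0); apply: leq_trans.
rewrite -sizeYE; apply: leq_trans (max_size_coefXY _ m).
by rewrite coef_map /= -sizeYE; exact: max_size_coefXY.
Qed.

End Generators.

(** * The inequality *)

Section Inequality.
Variables (R : realType) (p : 'I_4 -> 'I_4 -> int) (V : set (P1x4 R)).
Variables (c z : singular_chain R (P1x4 R) 4).
Hypothesis psym : forall a b, p a b = p b a.
Hypotheses (sV : subvariety V) (dimV : ~ subvariety_chain V 3).
Hypotheses (pc : represents_eta p c) (Vz : fundamental_cycle V z)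
  (cz : homologous setT set0 c z).
Hypothesis finV : forall t, ~ (V `<=` [set x | x t = aff false 0]).
Local Notation mp := (mp (C R)).

Section Equation.
Variables i j k l : 'I_4.
Hypothesis us : uniq [:: i; j; k; l].
Hypothesis ind : forall G : mp 2, IV [:: i; j; k; l] V G -> G = 0.
Variable P : {poly {poly {poly C R}}}.
Hypotheses (IP : IV [:: i; j; k; l] V (P : mp 3)) (P0 : P != 0)
  (Pgen : forall f : mp 3, IV [:: i; j; k; l] V f -> divides (P : {poly mp 2}) f).

(** If the generator were divisible by [X - x] in the first variable, then [X -
    x] would lie in the ideal, making this variable alone dependent, or the
    cofactor would, and then [X - x] would be a unit. *)
Lemma no_vertical x : exists y, map_poly (ev (pt (x, y)) 2) (P : {poly mp 2}) != 0.
Proof.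
apply: contrapT => no.
pose t : {poly C R} := 'X - x%:P.
have [f fE] : divides (t%:P%:P : {poly mp 2}) P.
  apply/divides_polyC => m; apply/(@divides_polyC (mp 1)) => n.
  suff : line x P`_m = 0.
    move=> l0; have : root (P`_m`_n) x.
      by rewrite rootE -horner_evalE -(coef_map (horner_eval x)) -/(line x _) l0 coef0.
    by move/factor_theorem.
  apply/eqP; apply: contrapT => /negP/exists_nonroot[y ly]; apply: no; exists y.
  apply: contra_neq ly => m0; rewrite -[RHS](coef0 _ m) -m0 coef_map.
  by symmetry; exact: ev2.
have pI := IV_prime us erefl sV finV (isT : 3 <= 4)%N.
have : IV [:: i; j; k; l] V (f * (t%:P%:P : {poly mp 2}) : mp 3) by rewrite -fE.
case/(prime_idealP pI) => [/Pgen[d dE]|/contract_IV/ind/eqP]; last first.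
  by rewrite polyC_eq0 polyXsubC_eq0.
have dt : d * (t%:P%:P : {poly mp 2}) = 1.
  by apply: (mulIf P0); rewrite mul1r [RHS]fE dE mulrAC.
have t0 : ev (fun=> x) 3 (t%:P%:P : {poly mp 2}) = 0.
  by rewrite 2!ev_C evS map_poly_id // /t hornerXsubC subrr.
have := oner_neq0 (C R); rewrite -(rmorph1 (ev (fun=> x) 3)) -dt => /eqP; case.
by apply: etrans (rmorphM _ _ _) _; rewrite t0 mulr0.
Qed.

(** If the coordinates [i] and [k] are independent, the curve [e = 0] is avoided
    outside the zeros of its norm; if they are dependent, the equation does not
    involve the coordinate [j], and general points of their plane do not lie on
    the projection at all. *)
Lemma generic_section (e : mp 2) : e != 0 -> exists2 n : mp 2, n != 0 &
  forall x, ev x 2 n != 0 -> ev x 2 (lead_coef (swapXY P) : mp 2) != 0 /\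
    (ev x 3 (swapXY P : mp 3) = 0 -> ev (exchange 1 x) 2 e != 0).
Proof.
move=> e0; have us1 : uniq [:: i; k; j; l].
  by apply: etrans us; apply: perm_uniq; rewrite (perm_cons i) (perm_catCA [:: k] [:: j] [:: l]).
have lP : lead_coef (swapXY P) != 0 by rewrite lead_coef_eq0 swapXY_eq0.
have [ind1|] := pselect (forall G : mp 2, IV [:: i; k; j; l] V G -> G = 0); last first.
  move=> /existsNP[G /not_implyP[IG /eqP G0]]; exists (lead_coef (swapXY P)) => // x nx; split=> //.
  have IG3 : IV [:: i; k; j; l] V ((G%:P : {poly mp 2}) : mp 3) by apply/contract_IV.
  have [d dE] := Pgen (IV_swapXY us1 IG3).
  have dv : divides (swapXY P) (G%:P : {poly {poly {poly C R}}}).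
    by exists (swapXY d); rewrite -rmorphM /= -dE swapXYK.
  have := divides_size _ dv; rewrite polyC_eq0 G0 size_polyC G0 => /(_ isT)/size1_polyC PE.
  by move: nx; rewrite PE lead_coefC ev_C => /eqP.
have [P1 P10 IP1] := three_dependent us1 erefl sV finV dimV.
have p3 := IV_prime us1 erefl sV finV (isT : 3 <= 4)%N.
have [g gm] : exists g : mp 3, min_poly (IV [:: i; k; j; l] V (n := 3)) g.
  apply: (min_poly_exists p3 IP1 (k := (size (P1 : {poly mp 2})).-1)).
  move=> /contract_IV/ind1/eqP; rewrite -lead_coefE lead_coef_eq0; exact/negP.
pose f : mp 3 := swapXY (e%:P : {poly {poly {poly C R}}}).
have nf : ~ IV [:: i; k; j; l] V f.
  by move=> /(IV_swapXY us1); rewrite /f swapXYK => /contract_IV/ind/eqP; rewrite (negbTE e0).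
have [n n0 nP] := norm3 us1 erefl sV finV gm nf.
exists (n * lead_coef (swapXY P)); first by rewrite mulf_neq0.
move=> x; rewrite rmorphM mulf_eq0 negb_or => /andP[nx lx]; split=> // Px.
have : ev x 3 f != 0.
  apply: nP => // a Ia; have [d dE] := Pgen (IV_swapXY us1 Ia).
  have aE : a = swapXY d * swapXY P by rewrite -rmorphM /= -dE swapXYK.
  by rewrite aE rmorphM Px mulr0.
by rewrite (@ev_swapXY _ 1) ev_C.
Qed.

End Equation.

Lemma independent (s : seq 'I_4) : uniq s -> size s = 4%N ->
  0 < p (nth ord0 s 0) (nth ord0 s 1) -> forall G : mp 2, IV s V G -> G = 0.
Proof.
move=> us ss pos G IG; apply/eqP; apply: contrapT => /negP G0; move: pos.
by rewrite (dependent_number psym sV pc Vz cz finV us ss G0 IG) ltxx.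
Qed.

Lemma exists_common_nonroot (K : numClosedFieldType) (fs : seq {poly K}) :
  (forall f, f \in fs -> f != 0) -> exists y, forall f, f \in fs -> f.[y] != 0.
Proof.
move=> f0; have [|y yf] := @exists_nonroot K (\prod_(f <- fs) f).
  rewrite prodf_seq_neq0; apply/allP => f /f0 //.
exists y => f ffs; move: yf; rewrite horner_prod prodf_seq_neq0 => /allP; exact.
Qed.

Lemma size_section (K : numClosedFieldType) (P : {poly {poly {poly K}}}) y a n :
  (forall m, ((size (P`_m`_n)%R).-1 <= a)%N) -> (size (P.[y%:P%:P]`_n)%R <= a.+1)%N.
Proof.
move=> Pa; rewrite horner_coef coef_sum; apply: leq_trans (size_sum _ _ _) _.
apply/bigmax_leqP => m _; rewrite -!rmorphXn coefMC mulrC mul_polyC.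
apply: leq_trans (size_scale_leq _ _) _; move: (Pa m); lia.
Qed.

(** The value [ck] and a line [x0] are chosen first, and then [cl] outside the
    roots of finitely many nonzero polynomials, so that the two curves have no
    common vertical line and do not meet on the line [x0]. *)
Lemma finite_inequality (i j k l : 'I_4) : uniq [:: i; j; k; l] -> 0 < p i j ->
  p k l <= p i k * p j l + p i l * p j k.
Proof.
move=> us pos.
have us' : uniq [:: i; j; l; k].
  by apply: etrans us; apply: perm_uniq; rewrite (perm_cons i) (perm_cons j) (perm_catCA [:: l] [:: k] [::]).
have us4 : uniq [:: k; l; i; j].
  by apply: etrans us; apply: perm_uniq; rewrite (perm_catC [:: k; l] [:: i; j]).
have ind := independent us erefl pos; have ind' := independent us' erefl pos.
have [P [IP P0 Pgen Pik Pjk]] := generator psym sV dimV pc Vz cz finV us ind.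
have [Q [IQ Q0 Qgen Qil Qjl]] := generator psym sV dimV pc Vz cz finV us' ind'.
have ge0 (n : nat) (a : int) : n%:Z <= a -> exists b : nat, a = b%:Z.
  by case: a => [b|b]; [exists b|].
have [[a aE] [b bE]] := (ge0 _ _ (Pjk 0%N 0%N), ge0 _ _ (Qjl 0%N 0%N)).
have [[a' a'E] [b' b'E]] := (ge0 _ _ Pik, ge0 _ _ Qil).
rewrite aE bE a'E b'E in Pjk Qjl Pik Qil *.
have [ind4|] := pselect (forall G : mp 2, IV [:: k; l; i; j] V G -> G = 0); last first.
  move=> /existsNP[G /not_implyP[IG /eqP G0]].
  by rewrite [p k l](dependent_number psym sV pc Vz cz finV us4 erefl G0 IG) -!PoszM -PoszD.
have [_ [h [_ _ h0 _ fib]]] := fibre_number psym sV dimV pc Vz cz finV us4 erefl ind4.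
have e0 : lead_coef Q != 0 by rewrite lead_coef_eq0.
have [n n0 nP] := generic_section us ind P0 Pgen (e := lead_coef Q) e0.
pose hk : {poly C R} := lead_coef (h : {poly {poly C R}}).
have hk0 : hk != 0 by rewrite lead_coef_eq0.
(* one point gives both the line [x0] and the value [ck] *)
have [|x] := @exists_nonzero _ 2 (n * map_poly polyC hk).
  by rewrite mulf_neq0 // map_polyC_eq0.
have -> : ev x 2 (n * map_poly polyC hk) = ev x 2 n * hk.[x 1%N].
  rewrite rmorphM; congr (_ * _); apply: etrans (ev2 _ _) _; congr (_.[_]).
  by rewrite /line -map_poly_comp; apply: map_poly_id => y _; rewrite /= horner_evalE hornerC.
rewrite mulf_eq0 negb_or => /andP[nx hkx]; have [lPx _] := nP x nx.
set x0 := x 0%N in lPx; set ck := x 1%N in hkx lPx.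
pose P' : {poly {poly C R}} := P.[ck%:P%:P].
have lP' : (lead_coef P').[x0] != 0.
  have H : (lead_coef (swapXY P)).[ck%:P].[x0] != 0.
    by rewrite horner_line; move: lPx; rewrite ev2.
  have H' : horner_eval ck%:P (lead_coef (swapXY P)) != 0.
    by apply: contra_neq H; rewrite /horner_eval => ->; rewrite horner0.
  by rewrite /P' horner_polyC (lead_coef_map_eq H').
have lineP (u : {poly {poly C R}}) w : (lead_coef u).[w] != 0 -> line w u != 0.
  by apply: contra_neq => l0; rewrite lead_coefE -horner_evalE -(coef_map (horner_eval w)) -/(line w u) l0 coef0.
have evP w y t : ev (pt (w, y)) 2 t = (line w (t : {poly {poly C R}})).[y] by rewrite ev2.
have evQ w y d : (map_poly (ev (pt (w, y)) 2) (Q : {poly mp 2})).[d] = (line w Q.[d%:P%:P]).[y].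
  by have := ev3 (Q : mp 3) (set_var (pt (w, y)) 2 d); rewrite ev_set_varS.
have [rsY rsYE] := closed_field_poly_normal (line x0 P').
have [rsX rsXE] := closed_field_poly_normal (lead_coef P').
have inY y : root (line x0 P') y -> y \in rsY.
  by rewrite rsYE rootZ ?lead_coef_eq0 ?lineP // root_prod_XsubC.
have inX w : line w P' = 0 -> w \in rsX.
  move=> l0; have : root (lead_coef P') w.
    by apply: contrapT => /negP/lineP; rewrite l0 eqxx.
  rewrite rsXE rootZ ?root_prod_XsubC // lead_coef_eq0.
  by apply: contra_neq lP' => ->; rewrite horner0.
have [wy wyP] := choice (no_vertical us' ind' IQ Q0 Qgen).
pose fY y := map_poly (ev (pt (x0, y)) 2) (Q : {poly mp 2}).
pose fX w := map_poly (ev (pt (w, wy w)) 2) (Q : {poly mp 2}).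
pose fH := line ck (h : {poly {poly C R}}).
(* [fH] keeps the fibre over [(ck, cl)] general; the [fX w] exclude common
   vertical lines, the [fY y] common points on the line [x0] *)
have [|cl clP] := @exists_common_nonroot _ (fH :: [seq fX w | w <- rsX] ++ [seq fY y | y <- rsY & root (line x0 P') y]).
  move=> f; rewrite inE mem_cat => /orP[/eqP ->|/orP[/mapP[w _ ->]|/mapP[y]]].
  - exact: lineP.
  - exact: wyP.
  rewrite mem_filter => /andP[ry _] ->.
  have : ev (pt (x0, y)) 2 (lead_coef Q) != 0.
    have [|_ Py] := nP (set_var x 2 y); first by rewrite ev_set_var.
    have : ev (set_var x 2 y) 3 (swapXY P : mp 3) = 0.
      rewrite (@ev_swapXY _ 1) ev3; exact/rootP.
    by move=> /Py; congr (_ != 0); apply: eq_evM => -[|[|]].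
  by apply: contra_neq => f0; rewrite lead_coefE -coef_map -/(fY y) f0 coef0.
pose Q' : {poly {poly C R}} := Q.[cl%:P%:P].
have hkl : ev (pt (ck, cl)) 2 h != 0 by rewrite evP; apply: clP; rewrite mem_head.
have [L [uL -> LV]] := fib (ck, cl) hkl.
suff : (size L <= (size Q').-1 * a + (size P').-1 * b)%N.
  move=> sL; rewrite -!PoszM -PoszD lez_nat; apply: leq_trans sL _.
  rewrite addnC; apply: leq_add; rewrite leq_mul2r; apply/orP; right.
    by apply: leq_trans Pik; rewrite -!subn1 leq_sub2r // max_size_evalC.
  by apply: leq_trans Qil; rewrite -!subn1 leq_sub2r // max_size_evalC.
apply: (@bezout _ P' Q' a b x0) => //.
- by move=> m; apply: size_section => r; exact: Pjk.
- by move=> m; apply: size_section => r; exact: Qjl.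
- move=> y ry; have := clP (fY y); rewrite evQ -/Q'; apply.
  by rewrite inE mem_cat map_f ?orbT // mem_filter ry inY.
- move=> w lw; have := clP (fX w); rewrite evQ -/Q' => H.
  have : (line w Q').[wy w] != 0 by apply: H; rewrite inE mem_cat map_f ?orbT // inX.
  by apply: contra_neq => ->; rewrite horner0.
move=> y /LV Vy; split; apply/rootP.
  have Vy' : V (apt [:: i; j; k; l] (fpt (pt y) ck cl)).
    move: Vy; congr V; apply/esym.
    by apply: (@apt_reorder _ _ _ (fun m => nth 0%N [:: 2; 3; 0; 1]%N m)) => // -[|[|[|[|]]]].
  by have := IP _ Vy'; rewrite ev3.
have Vy' : V (apt [:: i; j; l; k] (fpt (pt y) cl ck)).
  move: Vy; congr V; apply/esym.
  by apply: (@apt_reorder _ _ _ (fun m => nth 0%N [:: 2; 3; 1; 0]%N m)) => // -[|[|[|[|]]]].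
by have := IQ _ Vy'; rewrite ev3.
Qed.

End Inequality.

Theorem proposition5p2 (R : realType) (p : 'I_4 -> 'I_4 -> int)
  (p_sym : forall i j : 'I_4, p i j = p j i)
  (p_realizable : eta_realizable R p)
  (i j k l : 'I_4) (ijkl_distinct : uniq [:: i; j; k; l])
  (p_pos : 0 < p i j) :
  p k l <= p i k * p j l + p i l * p j k.
Proof.
have [V [sV [_ dimV] [c [z [pc Vz cz]]]]] := p_realizable.
have [inf|/forallNP finV] := pselect (exists t, V `<=` [set x | x t = aff false 0]); last first.
  exact: (finite_inequality p_sym sV dimV pc Vz cz finV).
have [t Vt] := inf; have zero a : t != a -> p t a = 0.
  by move=> ta; exact: (infinite_number p_sym pc Vz cz ta Vt).
have zero' a : t != a -> p a t = 0 by rewrite p_sym; exact: zero.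
move: (ijkl_distinct); rewrite /= !inE !negb_or !andbT => /and3P[/and3P[ij ik il] /andP[jk jl] kl].
have [ti|ti] := eqVneq t i; first by move: p_pos; rewrite -ti zero ?ltxx // ti.
have [tj|tj] := eqVneq t j; first by move: p_pos; rewrite -tj zero' ?ltxx // tj eq_sym.
have [tk|tk] := eqVneq t k.
  by rewrite -tk zero ?zero' ?(zero' j) ?tk ?mul0r ?mulr0 ?addr0 // eq_sym.
have [tl|tl] := eqVneq t l.
  by rewrite -tl !zero' ?tl ?mul0r ?mulr0 ?addr0 // eq_sym.
have := mem_order ijkl_distinct erefl t.
by rewrite !inE (negbTE ti) (negbTE tj) (negbTE tk) (negbTE tl).
Qed.
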